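(* Let $d\ge 2$ and let $S\subset\mathbb{R}^d$ be a smooth embedded hypersurface (a $(d-1)$-dimensional submanifold, possibly with boundary $\partial S$) whose interior $\operatorname{Int}S$ has non-vanishing Gaussian curvature at every point. Let $$C:=\{h(x,1)\,:\,x\in S,\ h\in\mathbb{R}\}\subset\mathbb{R}^{d+1}$$ be the cone generated by $S$. Then $\dim_F(C)=d-1$.
   Context: For a Borel set $A\subset\mathbb{R}^n$, $\mathcal{M}(A)$ denotes the set of nonzero finite (positive) Borel measures $\mu$ on $\mathbb{R}^n$ supported on $A$. The Fourier transform of $\mu$ is $\widehat{\mu}(\xi)=\int e^{-2\pi i x\cdot\xi}\,d\mu(x)$. The Fourier dimension of $A$ is $$\dim_F(A):=\sup\Big\{s\in[0,n]\,:\,\exists\,\mu\in\mathcal{M}(A)\text{ with }\sup_{\xi\in\mathbb{R}^n}|\xi|^{s/2}|\widehat{\mu}(\xi)|<\infty\Big\}.$$ *)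

(* Defs.v *)
From HB Require Import structures.
From mathcomp Require Import all_boot all_order all_algebra.
From mathcomp Require Import all_classical all_reals all_analysis.
Set Implicit Arguments. Unset Strict Implicit. Unset Printing Implicit Defensive.
Import Order.TTheory GRing.Theory Num.Theory.
Import numFieldNormedType.Exports.
Local Open Scope classical_set_scope.
Local Open Scope ring_scope.

Section Defs.
Variable R : realType.

Definition dotv n (u v : 'rV[R]_n) : R := \sum_(i < n) u 0 i * v 0 i.
Definition enorm n (u : 'rV[R]_n) : R := Num.sqrt (dotv u u).
Definition ev n (i : 'I_n) : 'rV[R]_n := delta_mx 0 i.

Definition borelRV n := g_sigma_algebraType (@open 'rV[R]_n).

Definition supported_on n (mu : {measure set (borelRV n) -> \bar R})
  (A : set 'rV[R]_n) : Prop :=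
  exists B : set (borelRV n), measurable B /\ B `<=` A /\ mu (~` B) = 0%E.

(** |mu^(xi)| where mu^(xi) = int e^{-2 pi i x.xi} dmu(x) *)
Definition fourier_abs n (mu : {measure set (borelRV n) -> \bar R})
  (xi : 'rV[R]_n) : R :=
  let re := \int[mu]_(x in setT) cos (2 * pi * dotv (x : 'rV[R]_n) xi) in
  let im := - \int[mu]_(x in setT) sin (2 * pi * dotv (x : 'rV[R]_n) xi) in
  Num.sqrt (re ^+ 2 + im ^+ 2).

Definition fourier_dim n (A : set 'rV[R]_n) : R :=
  sup [set s : R | 0 <= s <= n%:R /\
    exists mu : {finite_measure set (borelRV n) -> \bar R},
      supported_on mu A /\ (0 < mu setT)%E /\
      exists M : R, forall xi : 'rV[R]_n,
        enorm xi `^ (s / 2) * fourier_abs mu xi <= M].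

Definition partial m n (i : 'I_m) (F : 'rV[R]_m -> 'rV[R]_n) : 'rV[R]_m -> 'rV[R]_n :=
  fun y => 'D_(ev i) F y.
Definition iter_partial m n (l : seq 'I_m) (F : 'rV[R]_m -> 'rV[R]_n) :=
  foldr (@partial m n) F l.
Definition smooth_on m n (O : set 'rV[R]_m) (F : 'rV[R]_m -> 'rV[R]_n) : Prop :=
  forall (l : seq 'I_m) (y : 'rV[R]_m), O y ->
    {for y, continuous (iter_partial l F)} /\
    forall i : 'I_m, derivable (iter_partial l F) y (ev i).

Definition jacobian m n (F : 'rV[R]_m -> 'rV[R]_n) (y : 'rV[R]_m) : 'M[R]_(m, n) :=
  \matrix_(i < m, j < n) partial i F y 0 j.

Definition halfspace m : set 'rV[R]_m :=
  [set y | forall i : 'I_m, nat_of_ord i = 0%N -> 0 <= y 0 i].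
Definition halfspace_int m : set 'rV[R]_m :=
  [set y | forall i : 'I_m, nat_of_ord i = 0%N -> 0 < y 0 i].

(** (O, U, F) is a boundary-type local parametrization of S: F is smooth on the
    open set O, an immersion, and a homeomorphism of O /\ H onto S /\ U. *)
Definition is_chart m n (S : set 'rV[R]_n) (O : set 'rV[R]_m) (U : set 'rV[R]_n)
  (F : 'rV[R]_m -> 'rV[R]_n) : Prop :=
  open O /\ open U /\ smooth_on O F /\
      (forall y, O y -> row_free (jacobian F y)) /\
      F @` (O `&` (@halfspace m)) = S `&` U /\
      (forall y y', (O `&` (@halfspace m)) y -> (O `&` (@halfspace m)) y' ->
         F y = F y' -> y = y') /\
      (forall y, (O `&` (@halfspace m)) y -> forall e : R, 0 < e ->
         exists2 del : R, 0 < del & forall y', (O `&` (@halfspace m)) y' ->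
           `|F y' - F y| < del -> `|y' - y| < e).

Definition embedded_submanifold m n (S : set 'rV[R]_n) : Prop :=
  forall p, S p -> exists (O : set 'rV[R]_m) U F, is_chart S O U F /\ U p.

Definition manifold_interior m n (S : set 'rV[R]_n) : set 'rV[R]_n :=
  [set p | exists O U F (y : 'rV[R]_m),
     is_chart S O U F /\ (O `&` (@halfspace_int m)) y /\ F y = p].

Definition first_ff m n (F : 'rV[R]_m -> 'rV[R]_n) y : 'M[R]_m :=
  \matrix_(i, j) dotv (partial i F y) (partial j F y).
Definition second_ff m n (F : 'rV[R]_m -> 'rV[R]_n) y (nu : 'rV[R]_n) : 'M[R]_m :=
  \matrix_(i, j) dotv (partial i (partial j F) y) nu.
Definition gauss_curv m n (F : 'rV[R]_m -> 'rV[R]_n) y nu : R :=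
  \det (second_ff F y nu) / \det (first_ff F y).
Definition unit_normal m n (F : 'rV[R]_m -> 'rV[R]_n) y (nu : 'rV[R]_n) : Prop :=
  enorm nu = 1 /\ forall i, dotv nu (partial i F y) = 0.

Definition nonvanishing_gauss_interior m n (S : set 'rV[R]_n) : Prop :=
  forall O U F (y : 'rV[R]_m) nu,
    is_chart S O U F -> (O `&` (@halfspace_int m)) y -> unit_normal F y nu ->
    gauss_curv F y nu != 0.

Definition cone d (S : set 'rV[R]_d) : set 'rV[R]_(d + 1) :=
  [set z | exists (x : 'rV[R]_d) (h : R), S x /\ z = h *: row_mx x (const_mx 1)].

End Defs.

(* Main.v *)
Require Import Defs.
From HB Require Import structures.
From mathcomp Require Import all_boot all_order all_algebra.
From mathcomp Require Import all_classical all_reals all_analysis measurable_realfun.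
From mathcomp Require Import ring lra zify.
Import Order.TTheory GRing.Theory Num.Theory.
Import numFieldNormedType.Exports.
Local Open Scope classical_set_scope.
Local Open Scope ring_scope.
Set Implicit Arguments. Unset Strict Implicit. Unset Printing Implicit Defensive.

(* Write m = d - 1.

   Upper bound.  Let mu on the cone satisfy |mu^(xi)| <= M |xi|^(-s/2) with s > m.
   Over a patch of S of diameter delta the part of the cone at height bounded away
   from 0 lies within O(delta^2) of the hyperplane nu.z = 0 tangent along a ray, so
   cos(2 pi la nu.z) >= 1/2 there as long as la is slightly below delta^-2.  Multiply
   this wave by powers of sin(t)/t that localise to the patch; by Viete's product such
   a factor is a bounded limit of products of cosines, so only values of mu^ at
   frequencies near la nu enter, and the patch has mass O(la^(-s/2)).  A piece of S
   needs O(delta^-m) patches, whence mu vanishes near each of its points.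

   Lower bound.  Push a(y, h) dy dh forward by (y, h) |-> h (F(y), 1), where F is a
   chart around an interior point and a is a bump.  By compactness and the curvature
   hypothesis, for every unit xi = (xi', tau) either xi'.F + tau, the phase derivative
   in h, is bounded below, or some xi'.d_j F is, or for every small w some
   xi'.(d_j F(y + w) - d_j F(y)) is at least k |w|.  In the first two cases one
   integrates by parts.  In the third, Weyl differencing over a grid of n^m shifts in
   y bounds the square of the integral by a diagonal term O(n^-m) plus differenced
   integrals, which are O((n / |xi|)^N) by integration by parts; n = |xi|^(s/m) and N
   large give the exponent s for every s < m. *)

(** The upper bound must beat the number of patches. Patches have size b^-(a+1), while flatness is
    required up to the coarser scale b^-a; the spare factor [b] between the two scales makes the
    localising weight O(b^-2k) wherever flatness fails. The frequency is then about b^(2a-1), and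
    b^((a+1)m) patches of mass b^(-(2a-1)s/2) total at most a constant over [b] once a(s - m) >= s/2
    + m + 1. Hence a large [a], available exactly because s > m. The tangent-plane argument breaks
    down at the vertex, so the hyperplane of height 0 is shown null separately, from s >= 1 alone.
    The cone itself need not be Borel: everything runs on a Borel subset that carries the measure.

    In the lower bound, an asymptotic expansion at stationary points is avoided. Differencing asks
    only for integration by parts and a lower bound on increments of the gradient, at the price of
    an arbitrarily small loss in the exponent, which a supremum does not see. Only finitely many
    derivatives are ever taken, so the cutoff can be a piecewise polynomial. *)

Ltac lra_ineq := repeat match goal with H : ?P |- _ =>
  lazymatch type of P with Prop =>
    lazymatch P with is_true _ => fail | _ = _ => fail | _ => clear H end end end; lra.

(** * Sup norm, dot product and partial derivatives *)

Section RowVectors.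
Context {R : realType}.

Lemma normrV_le n (y : 'rV[R]_n) (e : R) :
  0 <= e -> (forall i, `|y 0 i| <= e) -> `|y| <= e.
Proof.
move=> e0 H; rewrite [`|y|]mx_normrE; apply: bigmax_le => // -[i j] _ /=.
by rewrite ord1.
Qed.

Lemma normrV_lt n (y : 'rV[R]_n) (e : R) :
  0 < e -> (forall i, `|y 0 i| < e) -> `|y| < e.
Proof.
move=> e0 H; rewrite [`|y|]mx_normrE; apply: bigmax_lt => // -[i j] _ /=.
by rewrite ord1.
Qed.

Lemma coord_norm_le n (y : 'rV[R]_n) i : `|y 0 i| <= `|y|.
Proof. by rewrite [`|y|]mx_normrE; exact: (le_bigmax _ _ (ord0, i)). Qed.

Lemma ballrVE n (x : 'rV[R]_n) e : ball x e = [set y | `|x - y| < e].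
Proof. by rewrite mx_norm_ball. Qed.

Lemma open_rV_ball n (O : set 'rV[R]_n) y :
  open O -> O y -> exists2 r : R, 0 < r & forall z : 'rV[R]_n, `|z - y| < r -> O z.
Proof.
move=> oO Oy; have : nbhs y O by exact: open_nbhs_nbhs.
case/nbhs_ballP => r /= r0 H; exists r => // z zr; apply: H.
by rewrite ballrVE /= distrC.
Qed.

Lemma mulmx_norm_le m n (u : 'rV[R]_m) (A : 'M[R]_(m, n)) (e : R) :
  0 <= e -> (forall i j, `|A i j| <= e) -> `|u *m A| <= m%:R * e * `|u|.
Proof.
move=> e0 Ae; apply: normrV_le => [|j]; first by rewrite !mulr_ge0.
rewrite mxE (le_trans (ler_norm_sum _ _ _))//.
rewrite -mulrA mulr_natl -[X in _ *+ X]card_ord.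
rewrite -sumr_const; apply: ler_sum => i _.
by rewrite normrM mulrC ler_pM // coord_norm_le.
Qed.

Lemma dotvDl n (u v w : 'rV[R]_n) : dotv (u + v) w = dotv u w + dotv v w.
Proof. by rewrite -big_split; apply: eq_bigr => i _; rewrite mxE mulrDl. Qed.

Lemma dotvZl n a (u w : 'rV[R]_n) : dotv (a *: u) w = a * dotv u w.
Proof. by rewrite mulr_sumr; apply: eq_bigr => i _; rewrite mxE mulrA. Qed.

Lemma dotvC n (u w : 'rV[R]_n) : dotv u w = dotv w u.
Proof. by apply: eq_bigr => i _; rewrite mulrC. Qed.

Lemma dotvBl n (u v w : 'rV[R]_n) : dotv (u - v) w = dotv u w - dotv v w.
Proof. by rewrite dotvDl -scaleN1r dotvZl mulN1r. Qed.

Lemma dotvDr n (u v w : 'rV[R]_n) : dotv w (u + v) = dotv w u + dotv w v.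
Proof. by rewrite dotvC dotvDl !(dotvC w). Qed.

Lemma dotvBr n (u v w : 'rV[R]_n) : dotv w (u - v) = dotv w u - dotv w v.
Proof. by rewrite dotvC dotvBl !(dotvC w). Qed.

Lemma dotvZr n a (u w : 'rV[R]_n) : dotv u (a *: w) = a * dotv u w.
Proof. by rewrite dotvC dotvZl dotvC. Qed.

Lemma dotv_norm_le n (u v : 'rV[R]_n) : `|dotv u v| <= n%:R * `|u| * `|v|.
Proof.
rewrite (le_trans (ler_norm_sum _ _ _))// -mulrA mulr_natl.
rewrite -[X in _ *+ X](card_ord n) -sumr_const; apply: ler_sum => i _.
by rewrite normrM ler_pM // coord_norm_le.
Qed.

Lemma dotv_row_mx n p (a b : 'rV[R]_n) (c d : 'rV[R]_p) :
  dotv (row_mx a c) (row_mx b d) = dotv a b + dotv c d.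
Proof.
rewrite /dotv big_split_ord /=; congr (_ + _); apply: eq_bigr => i _.
  by rewrite !row_mxEl.
by rewrite !row_mxEr.
Qed.

Lemma dotv_ge0 n (u : 'rV[R]_n) : 0 <= dotv u u.
Proof. by apply: sumr_ge0 => i _; rewrite -expr2 sqr_ge0. Qed.

Lemma dotv_eq0 n (u : 'rV[R]_n) : dotv u u = 0 -> u = 0.
Proof.
move=> /eqP; rewrite psumr_eq0; last by move=> i _; rewrite -expr2 sqr_ge0.
move=> /allP H; apply/rowP => i; rewrite mxE; apply/eqP.
by have := H i (mem_index_enum i); rewrite mulf_eq0 orbb.
Qed.

Lemma norm_le_enorm n (u : 'rV[R]_n) : `|u| <= enorm u.
Proof.
apply: normrV_le => [|i]; first exact: sqrtr_ge0.
rewrite -[X in X <= _]sqrtr_sqr ler_sqrt ?dotv_ge0//.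
rewrite /dotv (bigD1 i) //= expr2 lerDl.
by apply: sumr_ge0 => j _; rewrite -expr2 sqr_ge0.
Qed.

Lemma enorm_le_norm n (u : 'rV[R]_n) : enorm u <= n%:R * `|u|.
Proof.
rewrite -(@ler_pXn2r _ 2%N) ?nnegrE ?sqrtr_ge0 ?mulr_ge0//.
rewrite sqr_sqrtr ?dotv_ge0//; apply: (le_trans (ler_norm _)).
apply: (le_trans (dotv_norm_le u u)); rewrite exprMn -mulrA -expr2.
apply: ler_wpM2r; first exact: sqr_ge0.
by rewrite -natrX ler_nat; case: n {u} => // n; rewrite expnS expn1 leq_pmull.
Qed.

Lemma dotv_continuous n (v : 'rV[R]_n) : continuous (fun u : 'rV[R]_n => dotv u v).
Proof.
have -> : (fun u => dotv u v) = \sum_(i < n) (fun u : 'rV[R]_n => u 0 i * v 0 i).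
  by apply/funext => u; rewrite fct_sumE.
elim/big_ind : _ => [|f g cf cg|i _] u; first exact: cst_continuous.
  exact: continuousD (cf u) (cg u).
apply: (@continuousM _ _ (fun u : 'rV[R]_n => u 0 i) (cst (v 0 i)) u).
  exact: coord_continuous.
exact: cst_continuous.
Qed.

End RowVectors.

Section PartialDerivatives.
Context {R : realType}.

Lemma is_derive_along m (V : normedModType R) (g : 'rV[R]_m -> V) (z v : 'rV[R]_m) (t : R) :
  derivable g (z + t *: v) v ->
  is_derive t (1 : R) (fun s : R => g (z + s *: v)) ('D_v g (z + t *: v)).
Proof.
move=> dg.
have E : (fun h : R => h^-1 *: (g (z + (h *: 1 + t) *: v) - g (z + t *: v))) =
   (fun h : R => h^-1 *: (g (h *: v + (z + t *: v)) - g (z + t *: v))).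
  apply/funext => h; congr (_ *: (g _ - _)).
  by rewrite [h *: 1]mulr1 scalerDl addrCA.
split; first by rewrite /derivable /= E; exact: dg.
by rewrite /derive /= E.
Qed.

Lemma is_derive_dotv m n (G : 'rV[R]_m -> 'rV[R]_n) y v (xi : 'rV[R]_n) :
  derivable G y v -> is_derive y v (fun z => dotv (G z) xi) (dotv ('D_v G y) xi).
Proof.
move=> dG; have /derivable_mxP dG' := dG.
have H : forall j, is_derive y v (fun z => G z 0 j * xi 0 j) ('D_v G y 0 j * xi 0 j).
  move=> j; have := derivableP (dG' 0 j).
  rewrite (derive_mx dG) mxE => H0.
  have -> : (fun z => G z 0 j * xi 0 j) = xi 0 j *: (fun z => G z 0 j).
    by apply/funext => z; rewrite /= mulrC.
  by rewrite mulrC; exact: is_deriveZ.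
rewrite /dotv.
have -> : (fun z => \sum_(i < n) G z 0 i * xi 0 i) = \sum_(i < n) (fun z => G z 0 i * xi 0 i).
  by apply/funext => z; rewrite fct_sumE.
exact: is_derive_sum.
Qed.

Lemma mvt_bound (h dh : R -> R) (M : R) :
  (forall t : R, 0 <= t <= 1 -> is_derive t (1 : R) h (dh t)) ->
  (forall t : R, 0 <= t <= 1 -> `|dh t| <= M) -> `|h 1 - h 0| <= M.
Proof.
move=> hd hM.
have hd' (x : R) : x \in `]0, 1[ -> is_derive x 1 h (dh x).
  by rewrite in_itv /= => /andP[x0 x1]; apply: hd; rewrite !ltW.
have hc : {within `[0, 1], continuous h}.
  apply: derivable_within_continuous => x; rewrite in_itv /= => x01.
  by case: (hd x x01).
have [c] := MVT_segment ler01 hd' hc.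
by rewrite in_itv /= => /hM c01 ->; rewrite subr0 mulr1.
Qed.

(* Telescoping along the coordinate path from [y'] to [y]. *)
Lemma partial_lipschitz m (g : 'rV[R]_m -> R) (y y' : 'rV[R]_m) (M : R) :
  (forall z, `|z - y'| <= `|y - y'| -> forall i,
     derivable g z (ev R i) /\ `|'D_(ev R i) g z| <= M) ->
  `|g y - g y'| <= m%:R * M * `|y - y'|.
Proof.
move=> H; set D := `|y - y'|.
pose z (k : nat) : 'rV[R]_m := \row_j (if (j < k)%N then y 0 j else y' 0 j).
have z0 : z 0%N = y' by apply/rowP => j; rewrite mxE.
have zm : z m = y by apply/rowP => j; rewrite mxE ltn_ord.
have step (k : 'I_m) : `|g (z k.+1) - g (z k)| <= M * D.
  (* Each coordinate of the path lies between those of [y'] and [y], so in the sup norm the path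
     never leaves the ball where the hypothesis is available. *)
  have zS (t : R) : 0 <= t <= 1 ->
      `|z k + (t * (y 0 k - y' 0 k)) *: ev R k - y'| <= D.
    move=> /andP[t0 t1]; apply: normrV_le => [|j]; first exact: normr_ge0.
    rewrite !mxE /=.
    have Dj : `|y 0 j - y' 0 j| <= D.
      by have := coord_norm_le (y - y') j; rewrite !mxE.
    have [->|jk] := eqVneq j k.
      rewrite ltnn mulr1 addrAC subrr add0r normrM ger0_norm//.
      have Dk : `|y 0 k - y' 0 k| <= D.
        by have := coord_norm_le (y - y') k; rewrite !mxE.
      by rewrite (le_trans _ Dk)// ler_piMl.
    rewrite mulr0 addr0; case: ifP => _ //.
    by rewrite subrr normr0 normr_ge0.
  pose h := fun t : R => g (z k + (t * (y 0 k - y' 0 k)) *: ev R k).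
  have zS1 : z k.+1 = z k + (y 0 k - y' 0 k) *: ev R k.
    apply/rowP => j; rewrite !mxE /= ltnS.
    have [->|jk] := eqVneq j k; first by rewrite leqnn ltnn mulr1 addrC subrK.
    by rewrite mulr0 addr0 leq_eqVlt (negbTE (jk : (j != k :> nat))).
  have hd (t : R) : 0 <= t <= 1 -> is_derive t (1:R) h
      ((y 0 k - y' 0 k) * 'D_(ev R k) g (z k + (t * (y 0 k - y' 0 k)) *: ev R k)).
    move=> t01; have [dg _] := H _ (zS _ t01) k.
    have H1 := is_derive_along dg.
    have H2 : is_derive t (1:R) (fun t : R => t * (y 0 k - y' 0 k)) (y 0 k - y' 0 k).
      have -> : (fun t : R => t * (y 0 k - y' 0 k)) = (y 0 k - y' 0 k) *: (id : R -> R).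
        by apply/funext => s /=; rewrite mulrC.
      by apply: is_derive_eq; rewrite [LHS]mulr1.
    have H3 := @is_derive1_comp R (fun s => g (z k + s *: ev R k))
      (fun t : R => t * (y 0 k - y' 0 k)) t _ _ H1 H2.
    by apply: (is_derive_eq H3); exact: mulrC.
  have h1 : h 1 = g (z k.+1) by rewrite zS1 /h mul1r.
  have h0 : h 0 = g (z k) by rewrite /h mul0r scale0r addr0.
  rewrite -h1 -h0; apply: (mvt_bound hd) => t t01.
  rewrite mulrC normrM; apply: ler_pM; [exact: normr_ge0|exact: normr_ge0| |].
    by have [_ MD] := H _ (zS _ t01) k.
  by have := coord_norm_le (y - y') k; rewrite !mxE.
have -> : g y - g y' = \sum_(k < m) (g (z k.+1) - g (z k)).
  rewrite -(big_mkord xpredT (fun k => g (z k.+1) - g (z k))).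
  by rewrite telescope_sumr// zm z0.
rewrite (le_trans (ler_norm_sum _ _ _))// -mulrA mulr_natl.
by rewrite -[X in _ *+ X](card_ord m) -sumr_const; apply: ler_sum.
Qed.

Lemma is_derive_iter_partial m n (O : set 'rV[R]_m) (F : 'rV[R]_m -> 'rV[R]_n)
    (xi : 'rV[R]_n) l i y :
  smooth_on O F -> O y ->
  is_derive y (ev R i) (fun z => dotv (iter_partial l F z) xi)
    (dotv (iter_partial (i :: l) F y) xi).
Proof. by move=> sF Oy; apply: is_derive_dotv; exact: (sF l y Oy).2. Qed.

Lemma iter_partial_lipschitz m n (O : set 'rV[R]_m) (F : 'rV[R]_m -> 'rV[R]_n)
    (xi : 'rV[R]_n) l (y y' : 'rV[R]_m) (M : R) :
  smooth_on O F ->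
  (forall z, `|z - y'| <= `|y - y'| -> O z /\
     forall i, `|dotv (iter_partial (i :: l) F z) xi| <= M) ->
  `|dotv (iter_partial l F y - iter_partial l F y') xi| <= m%:R * M * `|y - y'|.
Proof.
move=> sF H; rewrite dotvBl.
apply: (@partial_lipschitz m (fun z => dotv (iter_partial l F z) xi)) => z zy i.
have [Oz Hz] := H z zy; have D := is_derive_iter_partial xi l i sF Oz.
by split; [case: D|rewrite derive_val; exact: Hz].
Qed.

Lemma smooth_on_ball m n (O : set 'rV[R]_m) (F : 'rV[R]_m -> 'rV[R]_n) y0 (K : nat) (e : R) :
  open O -> smooth_on O F -> O y0 -> 0 < e ->
  exists2 r : R, 0 < r & forall y : 'rV[R]_m, `|y - y0| < r -> O y /\
    forall l, (size l <= K)%N -> `|iter_partial l F y - iter_partial l F y0| <= e.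
Proof.
move=> oO sF Oy0 e0.
have Hs (ls : seq (seq 'I_m)) : exists2 r : R, 0 < r & forall y : 'rV[R]_m, `|y - y0| < r -> O y /\
    forall l, l \in ls -> `|iter_partial l F y - iter_partial l F y0| <= e.
  elim: ls => [|l ls [r r0 IH]].
    have [r r0 H] := open_rV_ball oO Oy0.
    by exists r => // y /H.
  have [/cvgrPdist_le /(_ e e0) + _] := sF l y0 Oy0.
  case/nbhs_ballP => r' /= r'0; rewrite ballrVE => H'.
  exists (Num.min r r'); first by rewrite lt_min r0.
  move=> y; rewrite lt_min => /andP[yr yr']; have [Oy IHy] := IH _ yr.
  split=> // l'; rewrite inE => /orP[/eqP ->|]; last exact: IHy.
  by rewrite distrC; apply: H'; rewrite /= distrC.
pose ls := flatten [seq [seq tval t | t <- enum {: k.-tuple 'I_m}] | k <- iota 0 K.+1].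
have [r r0 H] := Hs ls; exists r => // y /H[Oy Hy]; split=> // l lK; apply: Hy.
apply/flattenP; exists [seq tval t | t <- enum {: (size l).-tuple 'I_m}].
  by apply/mapP; exists (size l) => //; rewrite mem_iota add0n ltnS.
by apply/mapP; exists (in_tuple l) => //; rewrite mem_enum.
Qed.

Lemma iter_partial_bound m n (F : 'rV[R]_m -> 'rV[R]_n) y0 (K : nat) :
  exists2 C : R, 0 < C & forall l, (size l <= K)%N -> `|iter_partial l F y0| <= C.
Proof.
have Hs (ls : seq (seq 'I_m)) :
    exists2 C : R, 0 < C & forall l, l \in ls -> `|iter_partial l F y0| <= C.
  elim: ls => [|l ls [C C0 IH]]; first by exists 1.
  exists (C + `|iter_partial l F y0|); first by rewrite ltr_pwDl.
  move=> l'; rewrite inE => /orP[/eqP ->|/IH H]; first by rewrite lerDr ltW.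
  by rewrite (le_trans H)// lerDl.
pose ls := flatten [seq [seq tval t | t <- enum {: k.-tuple 'I_m}] | k <- iota 0 K.+1].
have [C C0 H] := Hs ls; exists C => // l lK; apply: H.
apply/flattenP; exists [seq tval t | t <- enum {: (size l).-tuple 'I_m}].
  by apply/mapP; exists (size l) => //; rewrite mem_iota add0n ltnS.
by apply/mapP; exists (in_tuple l) => //; rewrite mem_enum.
Qed.

End PartialDerivatives.

(** * Fourier integrals against band-limited weights *)

Section BorelRV.
Context {R : realType}.

Lemma open_measurable_rV n (A : set 'rV[R]_n) : open A -> measurable (A : set (borelRV R n)).
Proof. by move=> oA; apply: sub_sigma_algebra. Qed.

Lemma closed_measurable_rV n (A : set 'rV[R]_n) :
  closed A -> measurable (A : set (borelRV R n)).
Proof.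
move=> cA; rewrite -(setCK A); apply: measurableC; apply: open_measurable_rV.
exact: closed_openC.
Qed.

Lemma open_continuous_preimage n (T : topologicalType) (D : set 'rV[R]_n)
    (f : 'rV[R]_n -> T) (V : set T) :
  open D -> (forall y, D y -> {for y, continuous f}) -> open V ->
  open (D `&` f @^-1` V).
Proof.
move=> oD cf oV; rewrite openE => y [Dy Vy]; apply: filterI.
  exact: open_nbhs_nbhs.
by apply: (cf y Dy); exact: open_nbhs_nbhs.
Qed.

Lemma continuous_measurable_open n (D : set 'rV[R]_n) (f : 'rV[R]_n -> R) :
  open D -> (forall y, D y -> {for y, continuous f}) ->
  measurable_fun (D : set (borelRV R n)) f.
Proof.
move=> oD cf mD; apply: (measurability _ (RGenOpens.measurableE R)) => //.
move=> _ [_ [a [b ->] <-]]; apply: open_measurable_rV.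
apply: open_continuous_preimage => //; exact: interval_open.
Qed.

Lemma continuous_measurable_rV n (f : 'rV[R]_n -> R) :
  continuous f -> measurable_fun (setT : set (borelRV R n)) f.
Proof. move=> cf; have oT : open (setT : set 'rV[R]_n) by exact: openT.
by have := continuous_measurable_open oT (fun y _ => cf y). Qed.

Lemma dotv_measurable n (v : 'rV[R]_n) :
  measurable_fun (setT : set (borelRV R n)) (fun x : 'rV[R]_n => dotv x v).
Proof. by apply: continuous_measurable_rV; exact: dotv_continuous. Qed.

End BorelRV.

Section BoundedIntegrals.
Context {R : realType} d (T : measurableType d).

Lemma bounded_integrable (mu : {finite_measure set T -> \bar R}) (f : T -> R) (C : R) :
  measurable_fun setT f -> (forall x, `|f x| <= C) -> mu.-integrable setT (EFin \o f).
Proof.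
move=> mf fC; apply: measurable_bounded_integrable => //.
  by rewrite -ge0_fin_numE// fin_num_measure.
exists C; split; first exact: num_real.
by move=> M CM x _ /=; rewrite (le_trans (fC x))// ltW.
Qed.

Lemma normr_Rintegral_le (mu : {finite_measure set T -> \bar R}) (f : T -> R) (C : R) :
  measurable_fun setT f -> (forall x, `|f x| <= C) ->
  `|\int[mu]_(x in setT) f x| <= C * fine (mu setT).
Proof.
move=> mf fC; have If := bounded_integrable mu mf fC.
rewrite (le_trans (le_normr_Rintegral _ If))//.
rewrite -Rintegral_cst//; apply: le_Rintegral => //.
  apply: (@bounded_integrable mu _ C); last by move=> x; rewrite normr_id.
  exact: measurableT_comp.
by apply: (@bounded_integrable mu _ `|C|) => //; exact: measurable_cst.
Qed.

(** Dominated convergence with a constant majorant; it carries estimates from Viete's partial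
    products to their limit. *)
Lemma Rintegral_cvg_bounded (mu : {finite_measure set T -> \bar R})
    (f_ : nat -> T -> R) (f : T -> R) (C : R) :
  (forall k, measurable_fun setT (f_ k)) -> (forall k x, `|f_ k x| <= C) ->
  (forall x, f_ k x @[k --> \oo] --> f x) ->
  [/\ measurable_fun setT f, forall x, `|f x| <= C &
  \int[mu]_(x in setT) f_ k x @[k --> \oo] --> \int[mu]_(x in setT) f x].
Proof.
move=> mf fC cf.
have mfl : measurable_fun setT f.
  apply: (@measurable_fun_cvg _ _ _ setT f_) => // x _; exact: cf.
have fCl x : `|f x| <= C.
  have H : `|f_ k x| @[k --> \oo] --> `|f x| by apply: cvg_norm; exact: cf.
  rewrite -(cvg_lim _ H)//; apply: limr_le; first exact: cvgP H.
  by near=> k; exact: fC.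
split => //.
have [] := @dominated_convergence _ T R mu setT measurableT
   (fun k => EFin \o f_ k) (EFin \o f) (EFin \o cst C).
- by move=> k; exact/measurable_EFinP.
- exact/measurable_EFinP.
- by apply: aeW => x _; apply: cvg_EFin; [near=> k|exact: cf].
- by apply: (@bounded_integrable mu _ `|C|) => //; exact: measurable_cst.
- by apply: aeW => x k _; rewrite lee_fin; exact: fC.
move=> If _ H; apply: fine_cvg; rewrite fineK //.
exact: integrable_fin_num.
Unshelve. all: by end_near. Qed.

End BoundedIntegrals.

(** * The function sin(x)/x and Viete's product *)

Section Sinc.
Context {R : realType}.
Implicit Types x t : R.

(** Trading the sine for a cosine at a smaller angle reduces every later bound on [sin] and [sinc]
    to one on [cos]. *)
Lemma sin_mvt t : exists2 c, `|c| <= `|t| & sin t = t * cos c.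
Proof.
wlog t0 : t / 0 <= t => [H|].
  have [/H//|/ltW t0] := leP 0 t.
  have [|c ct E] := H (- t); first by rewrite oppr_ge0.
  exists c; first by rewrite normrN in ct.
  by apply: oppr_inj; rewrite -sinN E mulNr.
have [c] : exists2 c, c \in `[0, t]%R & sin t - sin 0 = cos c * (t - 0).
  apply: (@MVT_segment R sin cos) => //.
  by apply: continuous_subspaceT; exact: continuous_sin.
rewrite in_itv /= sin0 !subr0 => /andP[c0 ct] ->.
by exists c; [rewrite !ger0_norm|rewrite mulrC].
Qed.

Lemma sin_le_norm t : `|sin t| <= `|t|.
Proof.
have [c _ ->] := sin_mvt t; rewrite normrM ler_piMr//.
by rewrite ler_norml cos_geN1 cos_le1.
Qed.

Lemma cos_ge_quadratic t : 1 - t ^+ 2 / 2 <= cos t.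
Proof.
have -> : cos t = 1 - 2 * sin (t / 2) ^+ 2.
  rewrite [in LHS](_ : t = (t / 2) *+ 2); last by rewrite -mulr_natr divfK.
  by rewrite cos_mulr2n cos2sin2; ring.
have : sin (t / 2) ^+ 2 <= (t / 2) ^+ 2.
  by rewrite -ler_sqrt ?sqr_ge0// !sqrtr_sqr sin_le_norm.
rewrite expr_div_n; lra_ineq.
Qed.

Lemma sin_sub_le t : `|sin t - t| <= `|t| * (t ^+ 2 / 2).
Proof.
have [c ct ->] := sin_mvt t.
rewrite -{2}[t]mulr1 -mulrBr normrM ler_wpM2l// ler0_norm ?subr_le0 ?cos_le1//.
have := cos_ge_quadratic c.
have : c ^+ 2 <= t ^+ 2 by rewrite -ler_sqrt ?sqr_ge0// !sqrtr_sqr.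
lra_ineq.
Qed.

Definition sinc x := if x == 0 then 1 else sin x / x.

Lemma sinc_mvt x : exists2 c, `|c| <= `|x| & sinc x = cos c.
Proof.
rewrite /sinc; case: eqVneq => [->|x0]; first by exists 0; rewrite ?cos0.
have [c cx ->] := sin_mvt x; exists c => //.
by rewrite mulrAC divff// mul1r.
Qed.

Lemma sinc_le1 x : `|sinc x| <= 1.
Proof. by have [c _ ->] := sinc_mvt x; rewrite ler_norml cos_geN1 cos_le1. Qed.

Lemma sinc_ge_half x : `|x| <= 1 -> 1 / 2 <= sinc x.
Proof.
move=> x1; have [c cx ->] := sinc_mvt x.
apply: le_trans (cos_ge_quadratic c).
have : c ^+ 2 <= 1 ^+ 2 by rewrite -ler_sqrt ?sqr_ge0// !sqrtr_sqr normr1 (le_trans cx).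
rewrite expr1n; lra_ineq.
Qed.

Lemma sinc_decay x (a : R) : 0 < a -> a <= `|x| -> `|sinc x| <= a^-1.
Proof.
move=> a0 ax; have x0 : x != 0 by rewrite -normr_gt0 (lt_le_trans a0).
rewrite /sinc (negbTE x0) normrM normfV.
rewrite (@le_trans _ _ (1 * `|x|^-1))//.
  by rewrite ler_wpM2r// ler_norml sin_geN1 sin_le1.
by rewrite mul1r lef_pV2// posrE// (lt_le_trans a0).
Qed.

Definition viete (J : nat) x := \prod_(j < J) cos (x / 2 ^+ j.+1).

(** Apply sin(2u) = 2 sin u cos u, halving the angle [J] times. *)
Lemma vieteE J x : sin x = 2 ^+ J * sin (x / 2 ^+ J) * viete J x.
Proof.
elim: J => [|J IH]; first by rewrite /viete big_ord0 expr0 invr1 !mulr1 mul1r.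
rewrite IH /viete big_ord_recr /=.
rewrite [in LHS](_ : x / 2 ^+ J = (x / 2 ^+ J.+1) *+ 2); last first.
  by rewrite -mulr_natr exprS invfM; field; rewrite expf_neq0.
rewrite sin_mulr2n exprS -mulr_natr; ring.
Qed.

Lemma viete_cvg x : viete J x @[J --> \oo] --> sinc x.
Proof.
rewrite /sinc; case: eqVneq => [->|x0].
  rewrite (_ : (fun J => viete J 0) = cst 1); first exact: cvg_cst.
  apply/funext => J; rewrite /viete big1 // => j _; by rewrite mul0r cos0.
(* The cubic error of the sine at x / 2^J leaves a factor 4^-J after multiplication by 2^J; a
   geometric majorant of ratio 1/2 is enough. *)
have Hs : (2 ^+ J * sin (x / 2 ^+ J)) @[J --> \oo] --> x.
  have G : `|x| ^+ 3 * (1 / 2) ^+ J @[J --> \oo] --> (0 : R).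
    by apply: (@cvg_geometric R); rewrite ger0_norm//; lra_ineq.
  apply/cvgrPdist_le => e e0.
  move/cvgrPdist_le : G => /(_ e e0); apply: filterS => J.
  rewrite sub0r normrN ger0_norm; last by rewrite mulr_ge0// exprn_ge0//; lra_ineq.
  apply: le_trans; have p0 : 0 < 2 ^+ J :> R by rewrite exprn_gt0.
  rewrite [X in X - _](_ : x = 2 ^+ J * (x / 2 ^+ J)); last by rewrite mulrC divfK ?gt_eqF.
  rewrite -mulrBr normrM gtr0_norm// distrC.
  apply: (@le_trans _ _ (2 ^+ J * (`|x / 2 ^+ J| * ((x / 2 ^+ J) ^+ 2 / 2)))).
    by rewrite ler_wpM2l ?(ltW p0)// sin_sub_le.
  rewrite normrM normfV (gtr0_norm p0) expr_div_n -[x ^+ 2]real_normK ?num_real//.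
  rewrite div1r exprVn.
  have -> : 2 ^+ J * (`|x| / 2 ^+ J * (`|x| ^+ 2 / (2 ^+ J) ^+ 2 / 2)) =
     `|x| ^+ 3 * (2 ^+ J)^-1 * ((2 ^+ J)^-1 / 2) by field; rewrite gt_eqF.
  rewrite ler_piMr ?mulr_ge0 ?invr_ge0 ?exprn_ge0 ?(ltW p0)//.
  have : (2 ^+ J)^-1 <= 1 :> R by rewrite invf_le1// exprn_ege1// ler1n.
  lra_ineq.
have HV : (sin x / (2 ^+ J * sin (x / 2 ^+ J))) @[J --> \oo] --> sin x / x.
  by apply: cvgMr; apply: cvgV.
apply: cvg_trans HV; apply: near_eq_cvg.
(* The divisor tends to [x], which is nonzero, so [vieteE] can eventually be solved for the
   product. *)
have : \forall J \near \oo, 2 ^+ J * sin (x / 2 ^+ J) != 0 by exact: cvgr_neq0 Hs x0.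
apply: filterS => J J0.
by rewrite (vieteE J x) mulrAC divff// mul1r.
Qed.

End Sinc.

(** * Weights of bounded frequency spread *)

Section FourierShift.
Context {R : realType} n (mu : {finite_measure set (borelRV R n) -> \bar R}).

(** The free phase [al] covers the cosine and sine parts at once and keeps every integral real. *)
Definition wave (xi : 'rV[R]_n) (al : R) (x : 'rV[R]_n) : R := cos (2 * pi * dotv x xi + al).

Lemma wave_measurable xi al : measurable_fun (setT : set (borelRV R n)) (wave xi al).
Proof.
apply: (measurableT_comp (continuous_measurable_fun (@continuous_cos R))) => //.
apply: measurable_funD; last exact: measurable_cst.
apply: measurable_funM; first exact: measurable_cst.
exact: dotv_measurable.
Qed.

Lemma wave_le1 xi al x : `|wave xi al x| <= 1.
Proof. by rewrite ler_norml cos_geN1 cos_le1. Qed.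

(** The integral is the inner product of the unit vector (cos al, sin al) with the real and
    imaginary parts of the transform, so Cauchy-Schwarz applies. *)
Lemma wave_integral_le xi al :
  `|\int[mu]_(x in setT) wave xi al x| <= fourier_abs mu xi.
Proof.
rewrite /fourier_abs.
set A := \int[mu]_(x in setT) cos _; set B := \int[mu]_(x in setT) sin _.
have E : \int[mu]_(x in setT) wave xi al x = cos al * A - sin al * B.
  have mc : measurable_fun (setT : set (borelRV R n)) (fun x => cos (2 * pi * dotv (x : 'rV[R]_n) xi)).
    apply: (measurableT_comp (continuous_measurable_fun (@continuous_cos R))) => //.
    by apply: measurable_funM; [exact: measurable_cst|exact: dotv_measurable].
  have ms : measurable_fun (setT : set (borelRV R n)) (fun x => sin (2 * pi * dotv (x : 'rV[R]_n) xi)).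
    apply: (measurableT_comp (continuous_measurable_fun (@continuous_sin R))) => //.
    by apply: measurable_funM; [exact: measurable_cst|exact: dotv_measurable].
  have ic := @bounded_integrable _ _ _ mu _ 1 mc (fun x => (ltac:(by rewrite ler_norml cos_geN1 cos_le1))).
  have is_ := @bounded_integrable _ _ _ mu _ 1 ms (fun x => (ltac:(by rewrite ler_norml sin_geN1 sin_le1))).
  rewrite -RintegralZl// -RintegralZl// -RintegralB//.
  - by apply: eq_Rintegral => x _; rewrite /wave cosD; ring.
  - apply: (@bounded_integrable _ _ _ mu _ 1); first by apply: measurable_funM => //; exact: measurable_cst.
    by move=> x; rewrite normrM mulr_ile1// ler_norml ?cos_geN1 ?cos_le1.
  - apply: (@bounded_integrable _ _ _ mu _ 1); first by apply: measurable_funM => //; exact: measurable_cst.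
    by move=> x; rewrite normrM mulr_ile1// ler_norml ?sin_geN1 ?sin_le1.
rewrite E -[X in X <= _]sqrtr_sqr ler_sqrt; last by rewrite addr_ge0 ?sqr_ge0.
have H := cos2Dsin2 al.
rewrite -[X in _ <= X]mul1r -H -subr_ge0.
set c := cos al; set s := sin al.
have -> : (c ^+ 2 + s ^+ 2) * (A ^+ 2 + (- B) ^+ 2) - (c * A - s * B) ^+ 2 = (s * A + c * B) ^+ 2 by ring.
exact: sqr_ge0.
Qed.

(** Stands for: the spectrum of [phi] lies in the ball of radius [rho]. Stating it by duality with
    [mu] avoids a transform of [phi] and makes the property stable under bounded pointwise
    limits. *)
Definition freq_local (rho : R) (phi : 'rV[R]_n -> R) : Prop :=
  [/\ measurable_fun (setT : set (borelRV R n)) phi, forall x, `|phi x| <= 1 &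
  forall xi al B, (forall ze, `|ze - xi| <= rho -> fourier_abs mu ze <= B) ->
    `|\int[mu]_(x in setT) (phi x * wave xi al x)| <= B].

Lemma freq_local_cst1 : freq_local 0 (cst 1).
Proof.
split; [exact: measurable_cst|by move=> x; rewrite normr1|].
move=> xi al B H; under eq_Rintegral do rewrite mul1r.
by rewrite (le_trans (wave_integral_le _ _))// H// subrr normr0.
Qed.

(** The product of two cosines is the mean of the cosines of the sum and of the difference, which
    moves the frequency by [v] in either direction. *)
Lemma freq_local_wave rho phi v ga :
  freq_local rho phi -> freq_local (rho + `|v|) (fun x => wave v ga x * phi x).
Proof.
move=> [mphi phi1 H]; split.
- by apply: measurable_funM => //; exact: wave_measurable.
- by move=> x; rewrite normrM mulr_ile1// wave_le1.
move=> xi al B HB.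
have int ze be : mu.-integrable setT (EFin \o (fun x => phi x * wave ze be x)).
  apply: (@bounded_integrable _ _ _ mu _ 1).
    by apply: measurable_funM => //; exact: wave_measurable.
  by move=> x; rewrite normrM mulr_ile1// wave_le1.
have -> : \int[mu]_(x in setT) (wave v ga x * phi x * wave xi al x) =
   2^-1 * (\int[mu]_(x in setT) (phi x * wave (xi + v) (al + ga) x) +
        \int[mu]_(x in setT) (phi x * wave (xi - v) (al - ga) x)).
  rewrite -RintegralD// -RintegralZl//; last first.
    have := integrableD (@measurableT _ (borelRV R n)) (int (xi + v) (al + ga)) (int (xi - v) (al - ga)).
    by [].
  apply: eq_Rintegral => x _; rewrite /wave.
  set a := 2 * pi * dotv x v + ga; set b := 2 * pi * dotv x xi + al.
  have -> : 2 * pi * dotv x (xi + v) + (al + ga) = b + a by rewrite dotvDr /a /b; ring.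
  have -> : 2 * pi * dotv x (xi - v) + (al - ga) = b - a by rewrite dotvBr /a /b; ring.
  have Q (p ca cb sa sb : R) : ca * p * cb =
      2^-1 * (p * (cb * ca - sb * sa) + p * (cb * ca + sb * sa)) by field.
  by clearbody a b; rewrite cosD cosB; exact: Q.
have H1 : `|\int[mu]_(x in setT) (phi x * wave (xi + v) (al + ga) x)| <= B.
  apply: H => ze hz; apply: HB.
  rewrite (_ : ze - xi = (ze - (xi + v)) + v); last by rewrite opprD addrA subrK.
  by rewrite (le_trans (ler_normD _ _))// lerD2r.
have H2 : `|\int[mu]_(x in setT) (phi x * wave (xi - v) (al - ga) x)| <= B.
  apply: H => ze hz; apply: HB.
  rewrite (_ : ze - xi = (ze - (xi - v)) - v); last by rewrite opprB addrA addrAC addrK.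
  by rewrite (le_trans (ler_normB _ _))// lerD2r.
rewrite normrM ger0_norm; last lra_ineq.
have := ler_normD (\int[mu]_(x in setT) (phi x * wave (xi + v) (al + ga) x))
   (\int[mu]_(x in setT) (phi x * wave (xi - v) (al - ga) x)).
lra_ineq.
Qed.

Lemma freq_local_le rho rho' phi : rho <= rho' -> freq_local rho phi -> freq_local rho' phi.
Proof.
move=> rr [mp p1 H]; split => // xi al B HB; apply: H => ze hz; apply: HB.
exact: le_trans hz rr.
Qed.

Lemma freq_local_cvg rho (phi_ : nat -> 'rV[R]_n -> R) phi :
  (forall k, freq_local rho (phi_ k)) ->
  (forall x, phi_ k x @[k --> \oo] --> phi x) -> freq_local rho phi.
Proof.
move=> H cphi.
have [mphi phi1 _] : [/\ measurable_fun (setT : set (borelRV R n)) phi,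
     forall x, `|phi x| <= 1 &
     \int[mu]_(x in setT) phi_ k x @[k --> \oo] --> \int[mu]_(x in setT) phi x].
  apply: Rintegral_cvg_bounded => // k; first by case: (H k).
  by case: (H k).
split => // xi al B HB.
have [_ _ C] := @Rintegral_cvg_bounded R _ (borelRV R n) mu
  (fun k x => phi_ k x * wave xi al x) (fun x => phi x * wave xi al x) 1
  (ltac:(by move=> k; apply: measurable_funM; [case: (H k)|exact: wave_measurable]))
  (ltac:(by move=> k x; rewrite normrM mulr_ile1// ?wave_le1//; case: (H k)))
  (ltac:(by move=> x; apply: cvgMl; exact: cphi)).
have C' : `|\int[mu]_(x in setT) (phi_ k x * wave xi al x)| @[k --> \oo] -->
    `|\int[mu]_(x in setT) (phi x * wave xi al x)| by apply: cvg_norm; exact: C.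
rewrite -(cvg_lim _ C')//; apply: limr_le; first exact: cvgP C'.
by near=> k; case: (H k) => _ _; apply.
Unshelve. all: by end_near. Qed.

(** The J-th partial product of Viete costs |v| (1/2 + ... + 2^-J), which is below |v| for every
    [J]; the limit therefore costs no more than |v|. *)
Lemma freq_local_sinc rho phi v :
  freq_local rho phi -> freq_local (rho + `|v|) (fun x => sinc (2 * pi * dotv x v) * phi x).
Proof.
move=> Hphi.
apply: (@freq_local_cvg _ (fun J x => viete J (2 * pi * dotv x v) * phi x)); last first.
  by move=> x; apply: cvgMl; exact: viete_cvg.
move=> J.
suff : freq_local (rho + (1 - (2 ^+ J)^-1) * `|v|) (fun x => viete J (2 * pi * dotv x v) * phi x).
  by apply: freq_local_le; rewrite lerD2l ler_piMl// gerBl.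
elim: J => [|J IH].
  rewrite (_ : (fun x => _) = phi); last by apply/funext => x; rewrite /viete big_ord0 mul1r.
  by rewrite expr0 invr1 subrr mul0r addr0.
rewrite (_ : (fun x => _) = (fun x => wave ((2 ^+ J.+1)^-1 *: v) 0 x * (viete J (2 * pi * dotv x v) * phi x))).
  apply: freq_local_le (freq_local_wave _ _ IH).
  rewrite normrZ ger0_norm ?invr_ge0 ?exprn_ge0// -addrA lerD2l -mulrDl ler_wpM2r//.
  rewrite exprS invfM; lra_ineq.
apply/funext => x; rewrite /viete big_ord_recr /= /wave dotvZr addr0.
rewrite [in RHS]mulrA; congr (_ * _); rewrite mulrC; congr (cos _ * _).
by rewrite mulrC mulrCA.
Qed.

Lemma freq_local_waveX rho phi v ga k :
  freq_local rho phi -> freq_local (rho + `|v| *+ k) (fun x => wave v ga x ^+ k * phi x).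
Proof.
move=> H; elim: k => [|k IH].
  by rewrite addr0; under eq_fun do rewrite expr0 mul1r.
rewrite mulrSr addrA; under eq_fun do rewrite exprS -mulrA.
exact: freq_local_wave.
Qed.

Lemma freq_local_sincX rho phi v k : freq_local rho phi ->
  freq_local (rho + `|v| *+ k) (fun x => sinc (2 * pi * dotv x v) ^+ k * phi x).
Proof.
move=> H; elim: k => [|k IH].
  by rewrite addr0; under eq_fun do rewrite expr0 mul1r.
rewrite mulrSr addrA; under eq_fun do rewrite exprS -mulrA.
exact: freq_local_sinc.
Qed.

Lemma freq_local_prod_sincX rho phi k (I : Type) (r : seq I) (v : I -> 'rV[R]_n) (D : R) :
  (forall i, `|v i| <= D) -> freq_local rho phi ->
  freq_local (rho + D *+ (k * size r))
    (fun x => (\prod_(i <- r) sinc (2 * pi * dotv x (v i)) ^+ k) * phi x).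
Proof.
move=> vD H; elim: r => [|i r IH].
  by rewrite muln0 addr0; under eq_fun do rewrite big_nil mul1r.
under eq_fun do rewrite big_cons -mulrA.
apply: freq_local_le (freq_local_sincX _ k IH).
by rewrite /= mulnS addnC mulrnDr addrA lerD2l lerMn2r vD orbT.
Qed.

End FourierShift.

(** * Normals of an immersion *)

Section LocalGeometry.
Context {R : realType}.

(** [pinvmx A] recovers [w] from [w *m A], so its norm bounds the inverse; the added 1 keeps the
    constant positive in degenerate cases. *)
Lemma row_free_lower_bound m n (A : 'M[R]_(m, n)) : row_free A ->
  exists2 c : R, 0 < c & forall w : 'rV[R]_m, c * `|w| <= `|w *m A|.
Proof.
move=> fA; pose E := n%:R * `|pinvmx A| + 1.
have E0 : 0 < E by rewrite ltr_wpDl// mulr_ge0.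
exists E^-1 => [|w]; first by rewrite invr_gt0.
rewrite ler_pdivrMl// -[X in `|X| <= _]mulmx1 -(mulmxVp fA) mulmxA.
apply: (@le_trans _ _ (n%:R * `|pinvmx A| * `|w *m A|)).
  apply: mulmx_norm_le => // i j.
  by rewrite [`|pinvmx A|]mx_normrE; exact: (le_bigmax _ _ (i, j)).
by rewrite ler_wpM2r// /E lerDl.
Qed.

Lemma normal_exists m n (A : 'M[R]_(m, n)) : (m < n)%N ->
  exists2 nu : 'rV[R]_n, nu != 0 & forall i, dotv nu (row i A) = 0.
Proof.
move=> mn.
have : kermx A^T != 0.
  rewrite -mxrank_eq0 mxrank_ker mxrank_tr subn_eq0 -ltnNge.
  exact: leq_ltn_trans (rank_leq_row A) mn.
case/rowV0Pn => nu /sub_kermxP nuA nu0; exists nu => // i.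
have /rowP/(_ i) := nuA; rewrite !mxE => <-.
by apply: eq_bigr => j _; rewrite !mxE.
Qed.

Lemma ev_coord n (u : 'rV[R]_n) k : dotv u (ev R k) = u 0 k.
Proof.
rewrite /dotv (bigD1 k) //= mxE eqxx /= eqxx mulr1 big1 ?addr0// => i ik.
by rewrite mxE (negbTE ik) andbF mulr0.
Qed.

Lemma norm_ev n (i : 'I_n) : `|ev R i| = 1.
Proof.
apply/eqP; rewrite eq_le; apply/andP; split.
  apply: normrV_le => // j; rewrite mxE /=.
  by case: (j == i); rewrite ?normr1 ?normr0.
by have := coord_norm_le (ev R i) i; rewrite mxE !eqxx normr1.
Qed.

Lemma is_derive_linear m (c y v : 'rV[R]_m) :
  is_derive y v (fun z => dotv z c) (dotv v c).
Proof.
have H : derivable (id : 'rV[R]_m -> 'rV[R]_m) y v by exact: derivable_id.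
by have := is_derive_dotv c H; rewrite derive_id.
Qed.

(** Near [y0] an immersion is bi-Lipschitz and leaves each of its tangent spaces only to second
    order. The constants are uniform in the base point [y'], since the patches are centred at many
    different points. *)
Lemma immersion_local m n (O : set 'rV[R]_m) (F : 'rV[R]_m -> 'rV[R]_n) y0 :
  open O -> smooth_on O F -> O y0 -> row_free (Defs.jacobian F y0) ->
  exists r c K : R, [/\ 0 < r, 0 < c, 0 < K &
   forall y y', `|y - y0| < r -> `|y' - y0| < r ->
    [/\ O y, c * `|y - y'| <= `|F y - F y'|, `|F y - F y'| <= K * `|y - y'| &
    forall nu : 'rV[R]_n, `|nu| <= 1 -> (forall i, dotv nu (partial i F y') = 0) ->
      `|dotv (F y - F y') nu| <= K * `|y - y'| ^+ 2]].
Proof.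
move=> oO sF Oy0 fJ.
have [c0 c00 Hc0] := row_free_lower_bound fJ.
(* Chosen so that the linearisation error [m%:R * e] is at most half of the lower bound [c0] of the
   Jacobian. *)
pose e := c0 / (2 * (m%:R + 1)).
have m1 : 0 < m%:R + 1 :> R by rewrite ltr_wpDl.
have e0 : 0 < e by rewrite divr_gt0// mulr_gt0.
have [r0 r00 Hr0] := smooth_on_ball 2 oO sF Oy0 e0.
have [C C0 HC] := iter_partial_bound F y0 2.
pose C1 := C + e.
have C10 : 0 < C1 by rewrite addr_gt0.
have HC1 z l : `|z - y0| < r0 -> (size l <= 2)%N -> `|iter_partial l F z| <= C1.
  move=> zr sl; have [_ H] := Hr0 _ zr.
  rewrite -[iter_partial l F z](subrK (iter_partial l F y0)) /C1 [C + e]addrC.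
  by rewrite (le_trans (ler_normD _ _))// lerD ?H ?HC.
pose K := m%:R * C1 + m%:R * (m%:R * (n%:R * C1)) + 1.
(* A point no farther from [y'] than [y] is may be three of these radii away from [y0], whence the
   division by 3. *)
exists (r0 / 3), (c0 / 2), K; split.
- by rewrite divr_gt0.
- by rewrite divr_gt0.
- by rewrite /K ltr_wpDl// addr_ge0// !mulr_ge0// ltW.
move=> y y' yr y'r.
have zr z : `|z - y'| <= `|y - y'| -> `|z - y0| < r0.
  move=> H.
  have E1 : `|z - y0| <= `|z - y'| + `|y' - y0| by exact: ler_distD.
  have E2 : `|y - y'| <= `|y - y0| + `|y' - y0|.
    by rewrite (le_trans (ler_distD y0 _ _))// [`|y0 - y'|]distrC.
  lra_ineq.
have Kn : 0 <= `|y - y'| by [].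
split.
- by apply: (Hr0 y _).1; lra_ineq.
(* Subtracting the linear map given by the Jacobian at [y0] leaves, in each coordinate, a function
   whose partial derivatives are at most [e]. *)
- have main : `|F y - F y' - (y - y') *m Defs.jacobian F y0| <= m%:R * e * `|y - y'|.
    apply: normrV_le => [|k]; first by rewrite !mulr_ge0// ltW.
    pose g z := dotv (F z) (ev R k) - dotv z (\row_i Defs.jacobian F y0 i k).
    have -> : (F y - F y' - (y - y') *m Defs.jacobian F y0) 0 k = g y - g y'.
      have subE (A B : 'rV[R]_n) : (A - B) 0 k = A 0 k - B 0 k by rewrite !mxE.
      have JE w : (w *m Defs.jacobian F y0) 0 k = dotv w (\row_i Defs.jacobian F y0 i k).
        by rewrite mxE; apply: eq_bigr => i _; rewrite [in X in _ = _ * X]mxE.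
      have Q (a b c d : R) : a - b - (c - d) = a - c - (b - d) by ring.
      by rewrite !subE JE dotvBl /g !ev_coord; exact: Q.
    apply: partial_lipschitz => z /zr zr0 i.
    have [Oz Hz] := Hr0 _ zr0.
    have D1 : is_derive z (ev R i) (fun z => dotv (F z) (ev R k)) (dotv (iter_partial [:: i] F z) (ev R k)).
      exact: (is_derive_iter_partial (ev R k) [::] i sF Oz).
    have D2 := is_derive_linear (\row_i Defs.jacobian F y0 i k) z (ev R i).
    have D3 := is_deriveB D1 D2.
    have D4 : is_derive z (ev R i) g (dotv (iter_partial [:: i] F z) (ev R k) - dotv (ev R i) (\row_i Defs.jacobian F y0 i k)).
      exact: D3.
    split; first by case: D4.
    rewrite (@derive_val _ _ _ _ _ _ _ D4) ev_coord dotvC ev_coord !mxE.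
    have := Hz [:: i] isT; apply: le_trans.
    by have := coord_norm_le (iter_partial [:: i] F z - iter_partial [:: i] F y0) k; rewrite !mxE.
  have H1 := Hc0 (y - y').
  have H2 : `|(y - y') *m Defs.jacobian F y0| <= `|F y - F y'| + `|F y - F y' - (y - y') *m Defs.jacobian F y0|.
    rewrite -[X in `|X| <= _](subKr (F y - F y')).
    exact: ler_normB.
  have H3 : m%:R * e * `|y - y'| <= c0 / 2 * `|y - y'|.
    rewrite ler_wpM2r// /e.
    rewrite (_ : m%:R * (c0 / (2 * (m%:R + 1))) = c0 / 2 * (m%:R / (m%:R + 1))); last by field; rewrite gt_eqF.
    rewrite ler_piMr//; first by rewrite divr_ge0// ltW.
    by rewrite ler_pdivrMr// mul1r lerDl.
  lra_ineq.
- have : `|F y - F y'| <= m%:R * C1 * `|y - y'|.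
    apply: normrV_le => [|k]; first by rewrite !mulr_ge0// ltW.
    rewrite -ev_coord.
    apply: (@iter_partial_lipschitz R m n O F (ev R k) [::]) => // z /zr zr0.
    split; first by have [] := Hr0 _ zr0.
    move=> i; rewrite ev_coord (le_trans (coord_norm_le _ _))//.
    exact: HC1.
  move=> H; rewrite (le_trans H)// ler_wpM2r// /K -addrA lerDl addr_ge0//.
  by rewrite !mulr_ge0// ltW.
move=> nu nu1 nuF.
(* The first derivatives of F . nu vanish at [y'], so they are O(|z - y'|) at [z]; a second mean
   value estimate yields the square. *)
have H : `|dotv (F y - F y') nu| <= m%:R * (m%:R * (n%:R * C1) * `|y - y'|) * `|y - y'|.
  apply: (@iter_partial_lipschitz R m n O F nu [::]) => // z zy; have zr0 := zr _ zy.
  split; first by have [] := Hr0 _ zr0.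
  move=> i.
  have -> : dotv (iter_partial [:: i] F z) nu =
     dotv (iter_partial [:: i] F z - iter_partial [:: i] F y') nu.
    by rewrite dotvBl [X in _ - X](_ : _ = 0) ?subr0// dotvC; exact: nuF.
  apply: (@le_trans _ _ (m%:R * (n%:R * C1) * `|z - y'|)).
    apply: (@iter_partial_lipschitz R m n O F nu [:: i]) => // z' z'y.
    have z'r0 : `|z' - y0| < r0 by apply: zr; exact: le_trans z'y zy.
    split; first by have [] := Hr0 _ z'r0.
    move=> j; rewrite (le_trans (dotv_norm_le _ _))// -[X in _ <= X]mulr1.
    rewrite ler_pM// ?mulr_ge0//.
    by rewrite ler_wpM2l//; exact: HC1.
  by rewrite ler_wpM2l// !mulr_ge0// ltW.
apply: (le_trans H).
have mC : 0 <= m%:R * C1 by rewrite mulr_ge0// ltW.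
have -> : m%:R * (m%:R * (n%:R * C1) * `|y - y'|) * `|y - y'| =
  m%:R * (m%:R * (n%:R * C1)) * `|y - y'| ^+ 2 by ring.
by rewrite ler_wpM2r ?sqr_ge0// /K; lra_ineq.
Qed.

End LocalGeometry.

(** * Mass of one patch of the cone *)

Section CapEstimate.
Context {R : realType} (d : nat).

Definition height (z : 'rV[R]_(d + 1)) : R := z 0 (rshift d 0).
(** A linear substitute for the distance, inside the cone, to the ray over [x0]: at h (x, 1) its
    value is h (x - x0). *)
Definition offset (x0 : 'rV[R]_d) (z : 'rV[R]_(d + 1)) : 'rV[R]_d :=
  lsubmx z - height z *: x0.
(** The transpose of [offset x0]: waves at this frequency depend on the offset only, which puts the
    hyperplane tangent along the ray over [x0] in terms of a normal of [S]. *)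
Definition lift_dual (x0 v : 'rV[R]_d) : 'rV[R]_(d + 1) :=
  row_mx v (const_mx (- dotv x0 v)).

Lemma dotv_lift_dual x0 v z : dotv z (lift_dual x0 v) = dotv (offset x0 z) v.
Proof.
rewrite -{1}(hsubmxK z) dotv_row_mx dotvBl dotvZl; congr (_ + _).
by rewrite /dotv big_ord1 !mxE mulrN.
Qed.

Lemma norm_lift_dual_ge x0 v : `|v| <= `|lift_dual x0 v|.
Proof.
apply: normrV_le => // i; have := coord_norm_le (lift_dual x0 v) (lshift 1 i).
by rewrite /lift_dual row_mxEl.
Qed.

Lemma norm_lift_dual_le x0 v : `|lift_dual x0 v| <= (1 + d%:R * `|x0|) * `|v|.
Proof.
apply: normrV_le => [|i]; first by rewrite mulr_ge0// addr_ge0// mulr_ge0.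
case: (split_ordP i) => j ->.
  rewrite /lift_dual row_mxEl (le_trans (coord_norm_le _ _))// ler_peMl//.
  by rewrite lerDl mulr_ge0.
rewrite /lift_dual row_mxEr mxE normrN (le_trans (dotv_norm_le _ _))//.
by rewrite ler_wpM2r// lerDr.
Qed.

Definition height_dual : 'rV[R]_(d + 1) := ev R (rshift d 0).

Lemma dotv_height_dual z : dotv z height_dual = height z.
Proof. exact: ev_coord. Qed.

Lemma height_measurable : measurable_fun (setT : set (borelRV R (d + 1))) height.
Proof.
have := dotv_measurable height_dual.
by under eq_fun do rewrite dotv_height_dual.
Qed.

Lemma offset_coord x0 z i : offset x0 z 0 i = dotv z (lift_dual x0 (ev R i)).
Proof. by rewrite dotv_lift_dual ev_coord. Qed.

Variable mu : {finite_measure set (borelRV R (d + 1)) -> \bar R}.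
Variables (s M : R).
Hypothesis s0 : 0 <= s.
Hypothesis decay : forall xi, enorm xi `^ (s / 2) * fourier_abs mu xi <= M.

Lemma M_ge0 : 0 <= M.
Proof.
apply: le_trans (decay 0); rewrite mulr_ge0// ?powR_ge0//; exact: sqrtr_ge0.
Qed.

(** All frequencies that enter have size at least [la - rho], hence at least [la / 2]. *)
Lemma freq_local_decay (rho : R) phi xi al (la : R) :
  freq_local mu rho phi -> 0 < la -> 2 * rho <= la -> la <= `|xi| ->
  `|\int[mu]_(x in setT) (phi x * wave xi al x)| <= M * (la / 2) `^ (- (s / 2)).
Proof.
move=> [_ _ H] la0 rl lx; apply: H => ze hz.
have ze2 : la / 2 <= `|ze|.
  have := ler_distD ze xi 0; rewrite !subr0 distrC; lra_ineq.
have en : la / 2 <= enorm ze by rewrite (le_trans ze2)// norm_le_enorm.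
have l20 : 0 < la / 2 by rewrite divr_gt0.
have E : (la / 2) `^ (s / 2) * fourier_abs mu ze <= M.
  apply: le_trans (decay ze); rewrite ler_wpM2r ?sqrtr_ge0//.
  apply: ge0_ler_powR => //; first by rewrite divr_ge0.
    by rewrite nnegrE ltW.
  by rewrite nnegrE (le_trans _ en)// ltW.
by rewrite powRN ler_pdivlMr ?powR_gt0// mulrC.
Qed.

(** The patch [Q] lives at scale b^-(a+1), the flatness hypothesis holds up to scale b^-a. Test [mu]
    against a weight localised to [Q] times a wave along the normal: the decay bounds the integral
    from above, while the mass of [Q], less a localisation error, bounds it from below. *)
Lemma cap_estimate (B : set (borelRV R (d + 1))) (x0 nu : 'rV[R]_d)
    (X K q kap b : R) (a k : nat) :
  measurable B -> mu (~` B) = 0%E ->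
  `|x0| <= X -> `|nu| = 1 -> 0 < K -> 0 < q -> 0 <= kap -> 1 <= b ->
  (forall z, B z -> `|offset x0 z| <= b ^- a -> b^-1 <= `|height z| ->
     `|dotv (offset x0 z) nu| <= K * b * `|offset x0 z| ^+ 2) ->
  let rho := kap *+ (2 * k) + ((1 + d%:R * X) * b ^+ a.+1) *+ (2 * k * d) in
  let la := b ^+ a * b ^+ a / b / (2 * pi * K) in
  2 * rho <= la ->
  let Q := [set z : borelRV R (d + 1) | `|offset x0 z| <= b ^- a.+1 / (2 * pi) /\
               q <= `|sin (2 * pi * (kap * height z))|] in
  measurable Q /\
  (1 / 2) ^+ (2 * k * d) * q ^+ (2 * k) * fine (mu Q) <=
   2 * M * (la / 2) `^ (- (s / 2)) +
     4 * ((1 + 2 * pi * kap) / b) ^+ (2 * k) * fine (mu setT).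
Proof.
move=> mB muB x0X nu1 K0 q0 kap0 b1 geom rho la rhola Q.
have pi0 : 0 < pi :> R by exact: pi_gt0.
have b0 : 0 < b by rewrite (lt_le_trans ltr01).
pose N := b ^+ a.+1.
have N0 : 0 < N by rewrite exprn_gt0.
pose v i := N *: lift_dual x0 (ev R i).
(* The sinc factors localise the offset coordinates. The wave with phase -pi/2 is a sine of the
   height and suppresses heights below 1/b, where [geom] says nothing. The even exponent makes the
   weight nonnegative. *)
pose phi z := (\prod_(i <- index_enum 'I_d) sinc (2 * pi * dotv z (v i)) ^+ (2 * k)) *
   (wave (kap *: height_dual) (- (pi / 2)) z ^+ (2 * k) * 1).
have fl : freq_local mu rho phi.
  have vD i : `|v i| <= (1 + d%:R * X) * N.
    rewrite /v normrZ gtr0_norm// mulrC ler_wpM2r ?(ltW N0)//.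
    rewrite (le_trans (norm_lift_dual_le _ _))// norm_ev mulr1 lerD2l.
    by rewrite ler_wpM2l.
  have H1 := freq_local_waveX (kap *: height_dual) (- (pi / 2)) (2 * k) (freq_local_cst1 mu).
  have H2 := freq_local_prod_sincX (2 * k) (index_enum 'I_d) vD H1.
  apply: freq_local_le H2; rewrite add0r normrZ norm_ev mulr1 ger0_norm// /rho.
  by rewrite -[index_enum _]enumT -cardT card_ord.
have [mphi phi1 _] := fl.
have phi_ge0 z : 0 <= phi z.
  rewrite /phi mulr1 mulr_ge0 ?exprn_even_ge0 ?oddM//.
  by apply: prodr_ge0 => i _; rewrite exprn_even_ge0 ?oddM.
have waveE z : wave (kap *: height_dual) (- (pi / 2)) z = sin (2 * pi * (kap * height z)).
  by rewrite /wave dotvZr dotv_height_dual cosBpihalf.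
have dvE z i : dotv z (v i) = N * offset x0 z 0 i by rewrite dotvZr offset_coord.
(* [T] dominates the weight in both bad regions: an offset coordinate beyond b^-a makes its sinc
   factor at most 1/b, and a height below 1/b makes the sine at most 2 pi kap / b. *)
pose T := ((1 + 2 * pi * kap) / b) ^+ (2 * k).
have Tb : (1 / b) ^+ (2 * k) <= T.
  rewrite lerXn2r ?nnegrE ?divr_ge0 ?(ltW b0)// ?addr_ge0 ?mulr_ge0 ?(ltW pi0)//.
  by rewrite ler_wpM2r ?invr_ge0 ?(ltW b0)// lerDl !mulr_ge0// ltW.
have T0 : 0 <= T by apply: le_trans Tb; rewrite exprn_ge0// divr_ge0// ltW.
have psinc z : 0 <= \prod_(i <- index_enum 'I_d) sinc (2 * pi * dotv z (v i)) ^+ (2 * k) <= 1.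
  apply/andP; split; first by apply: prodr_ge0 => i _; rewrite exprn_even_ge0 ?oddM.
  apply: prodr_ile1 => i _; rewrite exprn_even_ge0 ?oddM//= -[X in X <= _]ger0_norm ?exprn_even_ge0 ?oddM//.
  by rewrite normrX exprn_ile1// sinc_le1.
have far1 z : b ^- a < `|offset x0 z| -> phi z <= T.
  move=> uz; have [i ui] : exists i, b ^- a < `|offset x0 z 0 i|.
    apply: contrapT => H; move: uz; rewrite ltNge => /negP; apply.
    apply: normrV_le => [|i]; first by rewrite invr_ge0 exprn_ge0// ltW.
    by rewrite leNgt; apply/negP => Hi; apply: H; exists i.
  rewrite /phi mulr1 (bigD1_seq i) ?mem_index_enum ?index_enum_uniq//=.
  set P := \prod_(_ <- _ | _) _; set w := wave _ _ _.
  have P01 : 0 <= P <= 1.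
    apply/andP; split; first by apply: prodr_ge0 => j _; rewrite exprn_even_ge0 ?oddM.
    apply: prodr_ile1 => j _; rewrite exprn_even_ge0 ?oddM//= -[X in X <= _]ger0_norm ?exprn_even_ge0 ?oddM//.
    by rewrite normrX exprn_ile1// sinc_le1.
  have w01 : 0 <= w ^+ (2 * k) <= 1.
    rewrite exprn_even_ge0 ?oddM//= -[X in X <= _]ger0_norm ?exprn_even_ge0 ?oddM//.
    by rewrite normrX exprn_ile1// wave_le1.
  case/andP: P01 => P0 P1; case/andP: w01 => w0 w1.
  have S0 : 0 <= sinc (2 * pi * dotv z (v i)) ^+ (2 * k) by rewrite exprn_even_ge0 ?oddM.
  rewrite (@le_trans _ _ (sinc (2 * pi * dotv z (v i)) ^+ (2 * k)))//.
    by rewrite -[X in X <= _]mulrA ler_piMr// mulr_ile1.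
  apply: le_trans Tb; rewrite -[X in X <= _]ger0_norm// normrX lerXn2r ?nnegrE ?divr_ge0 ?(ltW b0)//.
  rewrite div1r; apply: sinc_decay => //; rewrite dvE !normrM (gtr0_norm N0) (gtr0_norm pi0) normr_nat.
  apply: (@le_trans _ _ (N * b ^- a)).
    by rewrite /N exprS mulfK// expf_neq0// gt_eqF.
  apply: (@le_trans _ _ (N * `|offset x0 z 0 i|)).
    by rewrite ler_wpM2l ?(ltW ui)// ltW.
  rewrite ler_peMl// ?mulr_ge0 ?(ltW N0)//.
  have := pi_ge2 R; lra_ineq.
have far2 z : `|height z| < b^-1 -> phi z <= T.
  move=> hz; rewrite /phi mulr1 waveE; case/andP: (psinc z) => p0 p1.
  have S0 : 0 <= sin (2 * pi * (kap * height z)) ^+ (2 * k) by rewrite exprn_even_ge0 ?oddM.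
  rewrite (@le_trans _ _ (sin (2 * pi * (kap * height z)) ^+ (2 * k)))//.
    by rewrite ler_piMl.
  rewrite -[X in X <= _]ger0_norm// normrX lerXn2r ?nnegrE//.
    by rewrite divr_ge0 ?(ltW b0)// addr_ge0// !mulr_ge0// ltW.
  rewrite (le_trans (sin_le_norm _))// !normrM (ger0_norm kap0) (gtr0_norm pi0) normr_nat.
  have k2 : 0 <= 2 * pi * kap by rewrite !mulr_ge0// ltW.
  rewrite mulrA (@le_trans _ _ (2 * pi * kap / b))//.
    by rewrite ler_wpM2l// ltW.
  by rewrite ler_wpM2r ?invr_ge0 ?(ltW b0)// lerDr.
pose q' : R := (1 / 2) ^+ (2 * k * d) * q ^+ (2 * k).
have nearQ z : Q z -> q' <= phi z.
  move=> [uz qz].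
  have near1 i : `|2 * pi * dotv z (v i)| <= 1.
    rewrite dvE !normrM (gtr0_norm pi0) (gtr0_norm N0) normr_nat.
    apply: (@le_trans _ _ (2 * pi * (N * (b ^- a.+1 / (2 * pi))))).
      rewrite ler_wpM2l ?mulr_ge0 ?(ltW pi0)// ler_wpM2l ?(ltW N0)//.
      exact: le_trans (coord_norm_le _ _) uz.
    have E (x y : R) : 0 < x -> 0 < y -> x * (y * (y^-1 / x)) = 1.
      by move=> x_0 y_0; field; rewrite ?(gt_eqF x_0) ?(gt_eqF y_0).
    by rewrite -/N E ?mulr_gt0.
  rewrite /phi mulr1 waveE /q'; apply: ler_pM.
  - by rewrite exprn_ge0// divr_ge0.
  - by rewrite exprn_ge0// ltW.
  - rewrite exprM -[X in _ ^+ X]card_ord -prodr_const; apply: ler_prod => i _.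
    rewrite exprn_ge0 ?divr_ge0//= lerXn2r ?nnegrE ?divr_ge0//.
      by rewrite (le_trans _ (sinc_ge_half _)) ?divr_ge0//; exact: near1.
    by apply: sinc_ge_half; exact: near1.
  - rewrite -[X in _ <= X]ger0_norm ?exprn_even_ge0 ?oddM// normrX.
    by rewrite lerXn2r ?nnegrE ?(ltW q0).
have mQ : measurable Q.
  have -> : Q = (\bigcap_(i in [set: 'I_d]) [set z : borelRV R (d + 1) |
       `|dotv z (lift_dual x0 (ev R i))| <= b ^- a.+1 / (2 * pi)]) `&`
     [set z : borelRV R (d + 1) | q <= `|sin (2 * pi * (kap * height z))|].
    apply/seteqP; split => z /=.
      move=> [uz qz]; split => // i _ /=; rewrite -offset_coord.
      exact: le_trans (coord_norm_le _ _) uz.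
    move=> [uz qz]; split => //; apply: normrV_le => [|i].
      by rewrite divr_ge0 ?invr_ge0 ?exprn_ge0 ?mulr_ge0 ?(ltW pi0) ?(ltW b0).
    by rewrite offset_coord; exact: uz.
  apply: measurableI.
    apply: fin_bigcap_measurable => // i _.
    have mf : measurable_fun setT (fun z : borelRV R (d + 1) => `|dotv (z : 'rV[R]_(d + 1)) (lift_dual x0 (ev R i))|).
      by apply: measurableT_comp => //; exact: dotv_measurable.
    have := mf measurableT _ (measurable_itv `]-oo, (b ^- a.+1 / (2 * pi))]).
    by rewrite setTI; congr measurable; apply/seteqP; split => z /=; rewrite in_itv.
  have mf : measurable_fun setT (fun z : borelRV R (d + 1) => `|sin (2 * pi * (kap * height z))|).
    apply: measurableT_comp => //.
    apply: (measurableT_comp (continuous_measurable_fun (@continuous_sin R))) => //.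
    apply: measurable_funM; first exact: measurable_cst.
    by apply: measurable_funM; [exact: measurable_cst|exact: height_measurable].
  have := mf measurableT _ (measurable_itv `[q, +oo[).
  by rewrite setTI; congr measurable; apply/seteqP; split => z /=; rewrite in_itv /= andbT.
split => //.
pose xi := la *: lift_dual x0 nu.
have la0 : 0 < la by rewrite !divr_gt0 ?mulr_gt0 ?exprn_gt0.
have lax : la <= `|xi|.
  rewrite normrZ gtr0_norm// ler_peMr ?(ltW la0)// -nu1.
  exact: norm_lift_dual_ge.
have I1 := @freq_local_decay rho phi xi 0 la fl la0 rhola lax.
(* Where the weight is at most [T], the product with the wave is at least -T and half of the
   indicator term is at most T/2, so 2T is enough; elsewhere the wave itself is at least 1/2. *)
have pointwise z : B z -> 1 / 2 * (q' * \1_Q z) - 2 * T <= phi z * wave xi 0 z.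
  move=> Bz.
  have q1 : q' * \1_Q z <= phi z.
    rewrite indicE; case: (asboolP (Q z)) => Qz.
      by rewrite mem_set// mulr1 nearQ.
    by rewrite memNset// mulr0.
  have Q0 := phi_ge0 z.
  have := wave_le1 xi 0 z; rewrite ler_norml => /andP[w1 w2].
  have far : phi z <= T -> 1 / 2 * (q' * \1_Q z) - 2 * T <= phi z * wave xi 0 z.
    move=> fT; nra.
  have [u1|u1] := leP `|offset x0 z| (b ^- a); last exact/far/far1.
  have [h1|h1] := leP b^-1 `|height z|; last exact/far/far2.
  have G := geom z Bz u1 h1.
  suff : 1 / 2 <= wave xi 0 z by move=> ?; nra.
  rewrite /wave addr0 dotvZr dotv_lift_dual.
  apply: le_trans (cos_ge_quadratic _).
  set ph := 2 * pi * _.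
  have : `|ph| <= 1.
    rewrite /ph normrM [`|2 * pi|]gtr0_norm ?mulr_gt0// normrM (gtr0_norm la0).
    apply: (@le_trans _ _ (2 * pi * (la * (K * b * (b ^- a) ^+ 2)))).
      rewrite ler_wpM2l ?mulr_ge0 ?(ltW pi0)// ler_wpM2l ?(ltW la0)//.
      rewrite (le_trans G)// ler_wpM2l ?mulr_ge0 ?(ltW K0) ?(ltW b0)//.
      by rewrite lerXn2r ?nnegrE// invr_ge0 exprn_ge0// ltW.
    (* This is where [la] comes from: at offset b^-a the bound on the phase is exactly 1. *)
    have E (x y w p : R) : 0 < x -> 0 < y -> 0 < w -> 0 < p ->
        2 * p * (y * y / x / (2 * p * w) * (w * x * y^-1 ^+ 2)) = 1.
      move=> x_0 y_0 w_0 p_0; field.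
      by rewrite (gt_eqF x_0) (gt_eqF y_0) (gt_eqF w_0) (gt_eqF p_0).
    by rewrite /la E ?exprn_gt0.
  rewrite -ler_sqr ?nnegrE// real_normK ?num_real// expr1n; lra_ineq.
have int1 : mu.-integrable setT (EFin \o (fun z => phi z * wave xi 0 z)).
  apply: (@bounded_integrable _ _ _ mu _ 1).
    by apply: measurable_funM => //; exact: wave_measurable.
  by move=> z; rewrite normrM mulr_ile1// wave_le1.
have mind : measurable_fun setT (\1_Q : borelRV R (d + 1) -> R) by exact: measurable_indic.
have int2 : mu.-integrable setT (EFin \o (fun z => 1 / 2 * (q' * \1_Q z) - 2 * T)).
  apply: (@bounded_integrable _ _ _ mu _ (`|1 / 2| * `|q'| + `|2 * T|)).
    apply: measurable_funB; last exact: measurable_cst.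
    by apply: measurable_funM; [exact: measurable_cst|apply: measurable_funM => //; exact: measurable_cst].
  move=> z; rewrite (le_trans (ler_normB _ _))// lerD2r normrM ler_wpM2l// normrM ler_piMr//.
  by rewrite indicE; case: (_ \in _); rewrite ?normr1 ?normr0.
have I2 : \int[mu]_(z in B) (1 / 2 * (q' * \1_Q z) - 2 * T) <=
    \int[mu]_(z in B) (phi z * wave xi 0 z).
  apply: le_Rintegral => //; [exact: integrableS int2|exact: integrableS int1].
(* The pointwise bound is known on [B] only, but the complement of [B] is null. *)
have restr f : mu.-integrable setT (EFin \o f) ->
    \int[mu]_(z in B) f z = \int[mu]_(z in setT) f z.
  move=> If; rewrite /Rintegral; congr fine.
  rewrite [RHS](negligible_integral (N := ~` B))//; last exact: measurableC.
  by rewrite setTD setCK.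
rewrite !restr// in I2.
have I3 : \int[mu]_(z in setT) (1 / 2 * (q' * \1_Q z) - 2 * T) =
    1 / 2 * (q' * fine (mu Q)) - 2 * T * fine (mu setT).
  have iind : mu.-integrable setT (EFin \o (\1_Q : borelRV R (d + 1) -> R)).
    apply: (@bounded_integrable _ _ _ mu _ 1) => // z.
    by rewrite indicE; case: (_ \in _); rewrite ?normr1 ?normr0.
  have iq : mu.-integrable setT (EFin \o (fun z : borelRV R (d + 1) => q' * \1_Q z)).
    apply: (@bounded_integrable _ _ _ mu _ `|q'|).
      by apply: measurable_funM => //; exact: measurable_cst.
    move=> z; rewrite normrM ler_piMr//.
    by rewrite indicE; case: (_ \in _); rewrite ?normr1 ?normr0.
  rewrite RintegralB//; last first.
  - by apply: (@bounded_integrable _ _ _ mu _ `|2 * T|) => //; exact: measurable_cst.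
  - apply: (@bounded_integrable _ _ _ mu _ (`|1 / 2| * `|q'|)).
      by apply: measurable_funM; [exact: measurable_cst|apply: measurable_funM => //; exact: measurable_cst].
    move=> z; rewrite normrM ler_wpM2l// normrM ler_piMr//.
    by rewrite indicE; case: (_ \in _); rewrite ?normr1 ?normr0.
  rewrite (@RintegralZl _ _ _ mu setT _ (1 / 2) measurableT iq).
  rewrite (@RintegralZl _ _ _ mu setT _ q' measurableT iind) Rintegral_cst//.
  congr (_ * (_ * _) - _).
  by rewrite /Rintegral integral_indic// setIT.
rewrite I3 in I2.
move: I1; rewrite ler_norml => /andP[_ I1].
rewrite -/q' -/T; lra_ineq.
Qed.

End CapEstimate.

(** * The cone is locally null *)

Section Countability.
Context {R : realType}.

(** A base of the topology indexed by a countable type, so that [unpickle] can enumerate it. *)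
Definition rat_ball n (ck : 'rV[rat]_n * nat) : set 'rV[R]_n :=
  [set z | `|z - map_mx ratr ck.1| < ck.2.+1%:R^-1].

Lemma rat_ball_exists n (U : set 'rV[R]_n) z : open U -> U z ->
  exists2 ck, rat_ball ck z & rat_ball ck `<=` U.
Proof.
move=> oU Uz; have [r r0 H] := open_rV_ball oU Uz.
(* Two radii must fit in [r]: from a point of the small ball to its centre, and from there to
   [z]. *)
have [k kr] : exists k : nat, 2 * k.+1%:R^-1 < r.
  exists (Num.truncn (2 / r)).
  rewrite mulrC ltr_pdivrMl// mulrC -ltr_pdivrMl// mulrC.
  by have /andP[] := truncn_itv (divr_ge0 (ltW (ltr0Sn R 1)) (ltW r0)).
have [e ek] : exists e : R, e = k.+1%:R^-1 by exists (k.+1%:R^-1).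
rewrite -ek in kr; have e0 : 0 < e by rewrite ek invr_gt0.
have /fin_all_exists[c Hc] (i : 'I_n) : exists q : rat, `|z 0 i - ratr q| < e.
  have : z 0 i - e < z 0 i + e by lra_ineq.
  case/rat_in_itvoo => q; rewrite in_itv /= => /andP[q1 q2]; exists q.
  by rewrite ltr_norml; apply/andP; split; lra_ineq.
have zc : rat_ball (\row_i c i, k) z.
  by rewrite /rat_ball /= -ek; apply: normrV_lt => // i; rewrite !mxE.
exists (\row_i c i, k) => // x /= xc; apply: H.
apply: (le_lt_trans (ler_distD (map_mx ratr (\row_i c i)) _ _)).
rewrite [X in _ + X]distrC; move: zc xc; rewrite /rat_ball /= -ek; lra_ineq.
Qed.

Lemma open_rat_ball n ck : open (@rat_ball n ck).
Proof.
rewrite /rat_ball.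
have -> : [set z : 'rV[R]_n | `|z - map_mx ratr ck.1| < ck.2.+1%:R^-1] =
   ball (map_mx ratr ck.1 : 'rV[R]_n) (ck.2.+1%:R^-1).
  by rewrite ballrVE; apply/seteqP; split => z /=; rewrite distrC.
exact: ball_open.
Qed.

(** The base balls that meet [A] in a null set cover [A], and there are countably many; the
    enumeration replaces all other balls by the empty set. *)
Lemma locally_null_null n (mu : {measure set (borelRV R n) -> \bar R}) (A : set (borelRV R n)) :
  measurable A ->
  (forall z : 'rV[R]_n, A z -> exists W : set 'rV[R]_n, [/\ open W, W z & mu (W `&` A) = 0%E]) ->
  mu A = 0%E.
Proof.
move=> mA H.
pose F (i : nat) : set (borelRV R n) :=
  if @unpickle ('rV[rat]_n * nat)%type i is Some ck then
    if `[< mu (rat_ball ck `&` A) = 0%E >] then rat_ball ck `&` A else set0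
  else set0.
have mD ck : measurable ((rat_ball ck : set (borelRV R n)) `&` A).
  by apply: measurableI => //; apply: open_measurable_rV; exact: open_rat_ball.
have FN i : mu.-negligible (F i).
  rewrite /F; case: unpickle => [ck|]; last exact: negligible_set0.
  case: asboolP => [E|_]; last exact: negligible_set0.
  by apply/negligibleP.
have := negligible_bigcup FN.
move=> /(negligibleS (B := A)) N; apply/negligibleP => //; apply: N => z Az.
have [W [oW Wz W0]] := H z Az.
have [ck zck ckW] := rat_ball_exists oW Wz.
exists (pickle ck) => //; rewrite /F pickleK.
case: asboolP => // -[].
apply/eqP; rewrite eq_le measure_ge0 andbT -W0; apply: le_measure; rewrite ?inE//.
  by apply: measurableI => //; exact: open_measurable_rV.
exact: setSI.
Qed.

Lemma finite_cover_measure d (T : measurableType d) (mu : {finite_measure set T -> \bar R})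
    (J : finType) (Q : J -> set T) (A : set T) (E : R) :
  (forall j, measurable (Q j)) -> measurable A -> (forall z, A z -> exists j, Q j z) ->
  (forall j, fine (mu (Q j)) <= E) -> fine (mu A) <= #|J|%:R * E.
Proof.
move=> mQ mA cov QE.
have H (s : seq J) : measurable (\big[setU/set0]_(j <- s) Q j) /\
    fine (mu (\big[setU/set0]_(j <- s) Q j)) <= (size s)%:R * E.
  elim: s => [|j s [mS IH]]; first by rewrite big_nil measure0 mul0r; split.
  rewrite big_cons; split; first exact: measurableU.
  apply: (@le_trans _ _ (fine (mu (Q j)) + fine (mu (\big[setU/set0]_(j <- s) Q j)))).
    rewrite -fineD ?fin_num_measure//; apply: fine_le.
    - by rewrite fin_num_measure//; exact: measurableU.
    - by rewrite fin_numD !fin_num_measure.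
    - exact: measureU2.
  by rewrite /= -add1n natrD mulrDl mul1r lerD.
have [mS] := H (index_enum J).
have -> : size (index_enum J) = #|J| by rewrite cardT enumT.
apply: le_trans; apply: fine_le.
- by rewrite fin_num_measure.
- by rewrite fin_num_measure.
apply: le_measure; rewrite ?inE// => z Az.
have [j Qz] := cov z Az.
by rewrite -bigcup_seq; exists j => //=; rewrite mem_index_enum.
Qed.

Lemma le_inv_nat_le0 (x C : R) (b0 : R) :
  (forall b : nat, (0 < b)%N -> b0 <= b%:R -> x <= C / b%:R) -> x <= 0.
Proof.
move=> H; rewrite leNgt; apply/negP => x0.
pose B := `|b0| + `|C| / x + 1.
have B0 : 0 <= B by rewrite !addr_ge0// divr_ge0// ltW.
pose b := (Num.truncn B).+1.
have bB : B < b%:R by have /andP[] := truncn_itv B0.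
have b00 : 0 < b%:R :> R by rewrite ltr0n.
have Cx0 : 0 <= `|C| / x by rewrite divr_ge0// ltW.
have n0 : 0 <= `|b0| by [].
have := H b isT; have -> : b0 <= b%:R.
  by rewrite (le_trans (ler_norm _))//; move: bB; rewrite /B; lra_ineq.
move=> /(_ isT); rewrite leNgt => /negP; apply.
rewrite ltr_pdivrMr// (le_lt_trans (ler_norm _))// mulrC -ltr_pdivrMr//.
move: bB; rewrite /B; lra_ineq.
Qed.

End Countability.

(** * Base points of the patches and balance of exponents *)

Section Grid.
Context {R : realType}.

Lemma sup_normal_exists m n (F : 'rV[R]_m -> 'rV[R]_n) y : (m < n)%N ->
  exists2 nu : 'rV[R]_n, `|nu| = 1 & forall i, dotv nu (partial i F y) = 0.
Proof.
move=> /(normal_exists (Defs.jacobian F y)) [nu nu0 H].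
have nn : `|nu| != 0 by rewrite normr_eq0.
exists (`|nu|^-1 *: nu) => [|i].
  by rewrite normrZ normfV normr_id mulVf.
rewrite dotvZl (_ : partial i F y = row i (Defs.jacobian F y)) ?H ?mulr0//.
by apply/rowP => j; rewrite !mxE.
Qed.

Definition grid_point m (G : nat) (rho : R) (y0 : 'rV[R]_m)
    (j : {ffun 'I_m -> 'I_(2 * G).+1}) : 'rV[R]_m :=
  y0 + \row_i (rho * ((j i)%:R / G%:R - 1)).

Lemma grid_point_near m G (rho : R) (y0 : 'rV[R]_m)
    (j : {ffun 'I_m -> 'I_(2 * G).+1}) : (0 < G)%N -> 0 <= rho ->
  `|grid_point rho y0 j - y0| <= rho.
Proof.
move=> G0 rho0; rewrite /grid_point addrC addKr; apply: normrV_le => // i.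
rewrite mxE normrM ger0_norm// ler_piMr// ler_norml.
have G0' : 0 < G%:R :> R by rewrite ltr0n.
have j0 : 0 <= (j i)%:R / G%:R :> R by rewrite divr_ge0.
have : (j i)%:R / G%:R <= 2 :> R.
  by rewrite ler_pdivrMr// -natrM ler_nat -ltnS.
move=> j2; apply/andP; split; lra_ineq.
Qed.

Lemma grid_approx m G (rho : R) (y0 y : 'rV[R]_m) : (0 < G)%N -> 0 < rho ->
  `|y - y0| < rho -> exists j : {ffun 'I_m -> 'I_(2 * G).+1},
    `|y - grid_point rho y0 j| <= rho / G%:R.
Proof.
move=> G0 rho0 yr; have G0' : 0 < G%:R :> R by rewrite ltr0n.
have t1 i : `|(y 0 i - y0 0 i) / rho| <= 1.
  rewrite normrM normfV (gtr0_norm rho0) ler_pdivrMr// mul1r.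
  by have := coord_norm_le (y - y0) i; rewrite !mxE => H; rewrite (le_trans H)// ltW.
pose t i := ((y 0 i - y0 0 i) / rho + 1) * G%:R.
have t0 i : 0 <= t i.
  rewrite mulr_ge0//; have := t1 i; rewrite ler_norml => /andP[]; lra_ineq.
have t2 i : (Num.truncn (t i) < (2 * G).+1)%N.
  rewrite ltnS -(ler_nat R) (le_trans (y := t i))//.
    by have /andP[] := truncn_itv (t0 i).
  rewrite natrM ler_wpM2r ?(ltW G0')//.
  by have := t1 i; rewrite ler_norml => /andP[_ ?]; rewrite -[2]/(1 + 1) lerD2r.
exists [ffun i => Ordinal (t2 i)]; apply: normrV_le => [|i].
  by rewrite divr_ge0// ltW.
rewrite !mxE ffunE /=.
have -> : y 0 i - (y0 0 i + rho * ((Num.truncn (t i))%:R / G%:R - 1)) =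
    rho / G%:R * (t i - (Num.truncn (t i))%:R).
  by rewrite /t; field; rewrite (gt_eqF rho0) (gt_eqF G0').
rewrite normrM ger0_norm ?divr_ge0 ?(ltW rho0)// ler_piMr ?divr_ge0 ?(ltW rho0)//.
have /andP[] := truncn_itv (t0 i); rewrite -natr1 => ? ?.
by rewrite ler_norml; apply/andP; split; lra_ineq.
Qed.

Lemma scaled_freq_le (x A N : R) (n : nat) : 0 <= x -> 1 <= N ->
  2 * (x + (A * N) *+ n) <= 2 * (x + A *+ n) * N.
Proof.
move=> x0 N1; rewrite -(mulr_natr _ n) -(mulr_natr A n).
have : x <= x * N by rewrite ler_peMr.
by lra_ineq.
Qed.

Lemma cell_size_eq (h K r g n p : R) : g != 0 -> n != 0 -> p != 0 ->
  2 * h * (K * (r / (g * n))) = n^-1 / (2 * p) * (4 * p * h * K * r / g).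
Proof. by move=> g0 n0 p0; field; rewrite g0 n0 p0. Qed.

Lemma powR_neg_le (c b s : R) (p e : nat) : 0 < c -> 1 <= b -> 0 <= s -> e%:R <= p%:R * s ->
  (c * b ^+ p) `^ (- s) <= c `^ (- s) / b ^+ e.
Proof.
move=> c0 b1 s0 eps; have b0 : 0 < b by rewrite (lt_le_trans ltr01).
rewrite powRM ?exprn_ge0 ?(ltW b0) ?(ltW c0)//; apply: ler_wpM2l; first exact: powR_ge0.
rewrite powRN lef_pV2 ?posrE ?powR_gt0 ?exprn_gt0//.
rewrite -!powR_mulrn ?(ltW b0)// -powRrM; exact: ler_powR.
Qed.

(** [p] is the power of [b] inside [la], [e] the order of decay wanted: the decay term needs p s/2
    >= e, the localisation term 2k >= e. *)
Lemma cap_error_le (M mt c1 la b s y : R) (e k p : nat) :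
  0 <= M -> 0 <= mt -> 0 < c1 -> 1 <= b -> 0 <= s -> 0 <= y ->
  la / 2 = c1 * b ^+ p -> e%:R <= p%:R * (s / 2) -> (e <= 2 * k)%N ->
  2 * M * (la / 2) `^ (- (s / 2)) + 4 * (y / b) ^+ (2 * k) * mt <=
  (2 * M * c1 `^ (- (s / 2)) + 4 * y ^+ (2 * k) * mt) / b ^+ e.
Proof.
move=> M0 mt0 c10 b1 s0 y0 laE eps ek; have b0 : 0 < b by rewrite (lt_le_trans ltr01).
rewrite [X in _ <= X]mulrDl lerD//.
  rewrite -[X in _ <= X]mulrA ler_wpM2l ?mulr_ge0// laE.
  by apply: powR_neg_le => //; rewrite divr_ge0.
have H : (y / b) ^+ (2 * k) <= y ^+ (2 * k) / b ^+ e.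
  rewrite expr_div_n ler_wpM2l ?exprn_ge0// lef_pV2 ?posrE ?exprn_gt0//.
  exact: ler_weXn2l.
have : mt * (y / b) ^+ (2 * k) <= mt * (y ^+ (2 * k) / b ^+ e) by rewrite ler_wpM2l.
lra_ineq.
Qed.

(** With scale exponent a + 3, the patch count contributes b^((a+4)m), one more power of [b] is to
    be gained, and [la] is of order b^(2a+5). The hypothesis is that comparison, rearranged. *)
Lemma cap_exponent_le (s : R) (m a : nat) :
  s / 2 + m%:R + 1 <= a.+3%:R * (s - m%:R) ->
  ((a.+4 * m).+1)%:R <= ((2 * a).+1.+4)%:R * (s / 2).
Proof.
have -> : a.+3%:R = a%:R + 3 :> R by rewrite -addn3 natrD.
have -> : ((a.+4 * m).+1)%:R = (a%:R + 4) * m%:R + 1 :> R.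
  by rewrite -natr1 natrM -addn4 natrD.
have -> : ((2 * a).+1.+4)%:R = 5 + 2 * a%:R :> R.
  by rewrite -[(2 * a).+1.+4]/(5 + 2 * a)%N natrD natrM.
lra_ineq.
Qed.

Lemma odd_grid_le (G : nat) : (0 < G)%N -> ((2 * G).+1)%:R <= 3 * G%:R :> R.
Proof. by move=> G0; rewrite -natrM ler_nat; lia. Qed.

(** There are n^m patches; the exponent (am)+1 in the bound for [E] pays for all of them and leaves
    one factor 1/b. *)
Lemma grid_sum_le (x q E C b g n : R) (m a : nat) :
  0 < q -> 0 < b -> 0 <= n -> 0 <= E -> E <= C / b ^+ (a * m).+1 -> n <= 3 * g * b ^+ a ->
  x <= n ^+ m * (E / q) -> q * x <= (3 * g) ^+ m * C / b.
Proof.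
move=> q0 b0 n0 E0 EC nb H.
apply: (@le_trans _ _ ((3 * g * b ^+ a) ^+ m * E)).
  have xq : x * q <= n ^+ m * E by rewrite -ler_pdivlMr// -mulrA.
  rewrite mulrC (le_trans xq)//; apply: ler_wpM2r => //.
  by rewrite lerXn2r ?nnegrE// (le_trans n0).
apply: (@le_trans _ _ ((3 * g * b ^+ a) ^+ m * (C / b ^+ (a * m).+1))).
  by rewrite ler_wpM2l// exprn_ge0// (le_trans n0).
have bm : b ^+ (a * m) != 0 by rewrite expf_neq0// gt_eqF.
rewrite exprMn -exprM exprS invfM; move: bm; move: (b ^+ (a * m)) ((3 * g) ^+ m) => y z y0.
by rewrite le_eqVlt; apply/orP; left; apply/eqP; field; rewrite y0 gt_eqF.
Qed.

End Grid.

(** * Points of the cone away from height 0 *)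

Section ConeNull.
Context {R : realType} (d : nat) (S : set 'rV[R]_d).
Hypothesis d2 : (2 <= d)%N.
Hypothesis embS : embedded_submanifold d.-1 S.
Variable mu : {finite_measure set (borelRV R (d + 1)) -> \bar R}.
Variables (s M : R).
Hypothesis sm : d.-1%:R < s.
Hypothesis decay : forall xi, enorm xi `^ (s / 2) * fourier_abs mu xi <= M.
Variable B : set (borelRV R (d + 1)).
Hypothesis mB : measurable B.
Hypothesis BC : B `<=` cone S.
Hypothesis muB : mu (~` B) = 0%E.

Lemma height_cone (h : R) (x : 'rV[R]_d) : height (h *: row_mx x (const_mx 1)) = h.
Proof. by rewrite /height mxE row_mxEr mxE mulr1. Qed.

Lemma offset_cone (h : R) (x x0 : 'rV[R]_d) :
  offset x0 (h *: row_mx x (const_mx 1)) = h *: (x - x0).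
Proof.
by rewrite /offset height_cone scalerBr scale_row_mx row_mxKl.
Qed.

Lemma offset_sub (x0 : 'rV[R]_d) z z' : offset x0 (z - z') = offset x0 z - offset x0 z'.
Proof.
apply/rowP => i; rewrite /offset /height !mxE; ring.
Qed.

Lemma norm_offset_le (x0 : 'rV[R]_d) (z : 'rV[R]_(d + 1)) : `|offset x0 z| <= (1 + `|x0|) * `|z|.
Proof.
apply: normrV_le => [|i]; first by rewrite mulr_ge0// addr_ge0.
rewrite /offset /height !mxE (le_trans (ler_normB _ _))// mulrDl mul1r lerD ?coord_norm_le//.
by rewrite normrM mulrC ler_pM// coord_norm_le.
Qed.

Lemma cone_null_nbhd (z0 : 'rV[R]_(d + 1)) : B z0 -> height z0 != 0 ->
  exists W : set 'rV[R]_(d + 1), [/\ open W, W z0 & mu (W `&` B) = 0%E].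
Proof.
move=> Bz0; have [p [h0 [Sp z0E]]] := BC Bz0.
rewrite z0E height_cone => h00.
have [Oc [U [F [[oO [oU [sF [immF [FS [injF homF]]]]]] Up]]]] := embS Sp.
have [y0 [Oy0 Hy0] Fy0] : (F @` (Oc `&` @halfspace R d.-1)) p by rewrite FS.
have [r [c [K1 [r0 c0 K10 loc]]]] := immersion_local oO sF Oy0 (immF _ Oy0).
have [eU eU0 HU] := open_rV_ball oU Up.
have near_chart (e : R) : 0 < e -> exists2 et : R, 0 < et & forall x, S x -> `|x - p| < et ->
    exists2 y, `|y - y0| < e & F y = x.
  move=> e0; have [del del0 Hdel] := homF _ (conj Oy0 Hy0) e e0.
  exists (Num.min del eU); first by rewrite lt_min del0.
  move=> x Sx; rewrite lt_min => /andP[xd xU].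
  have [y [Oy Hy] Fy] : (F @` (Oc `&` @halfspace R d.-1)) x.
    by rewrite FS; split => //; exact: HU.
  by exists y => //; apply: Hdel => //; rewrite Fy Fy0.
have [eta eta0 Heta] := near_chart r r0.
(* Images of grid nodes then stay within eta/2 of [p]; the other half of [eta] is left for points of
   [S] close to a node. *)
pose rho2 := Num.min (r / 2) (eta / (4 * K1)).
have rho20 : 0 < rho2 by rewrite lt_min !divr_gt0// mulr_gt0.
have rho2r : rho2 < r by rewrite gt_min; apply/orP; left; lra_ineq.
have rho2e : K1 * rho2 < eta / 2.
  apply: (@le_lt_trans _ _ (eta / 4)); last lra_ineq.
  have -> : eta / 4 = K1 * (eta / (4 * K1)) by field; rewrite gt_eqF.
  by rewrite ler_wpM2l ?(ltW K10)// /rho2 ge_min lexx orbT.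
have [eta2 eta20 Heta2] := near_chart rho2 rho20.
have Fnear y : `|y - y0| <= rho2 -> `|F y - p| < eta / 2.
  move=> yr; have [||_ _ H _] := loc y y0; first exact: le_lt_trans rho2r.
    by rewrite subrr normr0.
  by rewrite -Fy0 (le_lt_trans H)// (le_lt_trans _ rho2e)// ler_wpM2l// ltW.
have pi0 : 0 < pi :> R by exact: pi_gt0.
have nh0 : 0 < `|h0| by rewrite normr_gt0.
(* At height [h0] the angle 2 pi kap h0 is pi/2 up to sign, where the sine has absolute value 1. *)
pose kap := (4 * `|h0|)^-1.
have kap0 : 0 < kap by rewrite invr_gt0 mulr_gt0.
(* The three bounds keep the height within a factor 2 of [h0], the base point within [eta2] of [p],
   and the angle of the sine within 1 of its extremum. *)
pose ep := Num.min (Num.min (`|h0| / 2) (eta2 * `|h0| / 2 / (1 + `|p|))) ((2 * pi * kap)^-1).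
have p1 : 0 < 1 + `|p| by rewrite ltr_pwDl.
have ep0 : 0 < ep by rewrite !lt_min !divr_gt0 ?mulr_gt0// invr_gt0 !mulr_gt0.
exists (ball z0 ep); rewrite -z0E; split; [exact: ball_open|exact: ballxx|].
have WB z : ball z0 ep z -> B z -> [/\ `|height z| <= 2 * `|h0|,
    1 / 2 <= `|sin (2 * pi * (kap * height z))| &
    exists2 y, `|y - y0| < rho2 & z = height z *: row_mx (F y) (const_mx 1)].
  rewrite ballrVE /= distrC !lt_min => /andP[/andP[e1 e2] e3] Bz.
  have hz : `|height z - h0| <= `|z - z0|.
    have := coord_norm_le (z - z0) (rshift d 0); rewrite !mxE -/(height z) -/(height z0).
    by rewrite z0E height_cone.
  have hz0 : `|h0| / 2 <= `|height z|.
    have := ler_distD (height z) h0 0; rewrite !subr0 distrC; lra_ineq.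
  split.
  - have := ler_distD h0 (height z) 0; rewrite !subr0; lra_ineq.
  - pose t := 2 * pi * (kap * (height z - h0)).
    have t1 : `|t| <= 1.
      rewrite /t mulrA normrM [X in X * _]gtr0_norm ?mulr_gt0//.
      have k20 : 0 < 2 * pi * kap by rewrite !mulr_gt0.
      rewrite -(@ler_pdivlMl _ (2 * pi * kap))// mulr1.
      by rewrite (le_trans hz)// ltW.
    have -> : 2 * pi * (kap * height z) = t + 2 * pi * (kap * h0) by rewrite /t; ring.
    have ct : 1 / 2 <= cos t.
      apply: le_trans (cos_ge_quadratic t).
      have : `|t| ^+ 2 <= 1 ^+ 2 by rewrite lerXn2r ?nnegrE.
      rewrite real_normK ?num_real// expr1n; lra_ineq.
    have ct0 : 0 <= cos t by lra_ineq.
    have [hp|hn] := ltP 0 h0.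
      have -> : 2 * pi * (kap * h0) = pi / 2.
        by rewrite /kap gtr0_norm// invfM mulrA; move: (pi : R) => q; field; rewrite gt_eqF.
      by rewrite sinDpihalf ger0_norm.
    have hn' : h0 < 0 by rewrite lt_neqAle h00.
    have -> : 2 * pi * (kap * h0) = - (pi / 2).
      by rewrite /kap ltr0_norm//; move: (pi : R) => q; field; rewrite lt_eqF.
    by rewrite sinBpihalf normrN ger0_norm.
  - have [x [h [Sx zE]]] := BC Bz.
    have hE : h = height z by rewrite zE height_cone.
    have := offset_sub p z z0.
    have offz0 : offset p z0 = 0 by rewrite z0E offset_cone subrr scaler0.
    rewrite offz0 subr0 => offE.
    have offz : offset p z = h *: (x - p) by rewrite zE offset_cone.
    have := norm_offset_le p (z - z0); rewrite offE offz normrZ hE => H1.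
    have xp : `|x - p| < eta2.
      have H2 : (1 + `|p|) * `|z - z0| < eta2 * `|h0| / 2.
        by rewrite mulrC -ltr_pdivlMr.
      have H3 := le_lt_trans H1 H2.
      have H4 : `|h0| / 2 * `|x - p| <= `|height z| * `|x - p| by rewrite ler_wpM2r.
      have H5 : `|h0| / 2 * `|x - p| < `|h0| / 2 * eta2 by lra_ineq.
      by move: H5; rewrite ltr_pM2l// divr_gt0.
    have [y yr Fy] := Heta2 x Sx xp.
    by exists y => //; rewrite Fy -hE.
set W := ball z0 ep.
have mWB : measurable ((W : set (borelRV R (d + 1))) `&` B).
  by apply: measurableI => //; apply: open_measurable_rV; exact: ball_open.
suff H0 : fine (mu (W `&` B)) <= 0.
  have fW : mu (W `&` B) \is a fin_num by rewrite fin_num_measure.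
  rewrite -(fineK fW); congr (_%:E); apply/eqP; rewrite eq_le H0 fine_ge0//.
pose m := d.-1.
have md : (m < d)%N by rewrite /m prednK// (leq_trans _ d2).
have s0 : 0 <= s by rewrite (le_trans _ (ltW sm)).
(* The second condition is the one of [cap_exponent_le]; a >= 3 leaves spare powers of [b] for the
   frequency condition and for the nearness of points to nodes. *)
have [a a3 Ha] : exists2 a : nat, (3 <= a)%N & s / 2 + m%:R + 1 <= a%:R * (s - m%:R).
  pose A := (s / 2 + m%:R + 1) / (s - m%:R).
  have sm0 : 0 < s - m%:R by rewrite subr_gt0.
  have A0 : 0 <= A by rewrite divr_ge0 ?(ltW sm0)// !addr_ge0// divr_ge0.
  exists (Num.truncn A + 3)%N; first by rewrite leq_addl.
  rewrite -ler_pdivrMr// -/A; have /andP[_] := truncn_itv A0.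
  by move=> /ltW H; apply: (le_trans H); rewrite ler_nat -addn1 leq_add2l.
(* The exponent of the patch count plus one; taking [k] equal to it makes the localisation error
   small enough as well. *)
pose e := (a.+1 * m).+1.
pose k := e.
(* The second-order bound is in parameters; dividing by c^2 restates it in distances on [S]. *)
have [K KE K0] : exists2 K, K = K1 / c ^+ 2 & 0 < K.
  by exists (K1 / c ^+ 2); rewrite // divr_gt0// exprn_gt0.
pose X := `|p| + eta.
have X0 : 0 < X by rewrite ltr_wpDl.
pose q : R := 1 / 2.
have q0 : 0 < q by rewrite divr_gt0.
pose q' := (1 / 2) ^+ (2 * k * d) * q ^+ (2 * k).
have q'0 : 0 < q' by rewrite mulr_gt0// exprn_gt0// divr_gt0.
(* Refines the grid by a constant so that a cell at height up to 2|h0| has offset at most b^-(a+1) /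
   (2 pi). *)
pose gc := (Num.truncn (4 * pi * `|h0| * K1 * rho2)).+1.
have gcP : 4 * pi * `|h0| * K1 * rho2 < gc%:R.
  have A0 : 0 <= 4 * pi * `|h0| * K1 * rho2 by rewrite !mulr_ge0// ltW.
  by have /andP[] := truncn_itv A0.
pose cr := kap *+ (2 * k) + (1 + d%:R * X) *+ (2 * k * d).
have cr0 : 0 <= cr by rewrite addr_ge0 ?mulrn_wge0// ?addr_ge0// ?mulr_ge0// ltW.
pose c1 := (2 * pi * K)^-1 / 2.
have c10 : 0 < c1 by rewrite divr_gt0// invr_gt0 !mulr_gt0.
pose C1 := 2 * M * c1 `^ (- (s / 2)) + 4 * (1 + 2 * pi * kap) ^+ (2 * k) * fine (mu setT).
(* The first term puts points of small offset within eta/2 of their node, the last makes twice the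
   frequency spread at most [la]. *)
pose b0 := 2 / eta + 1 + 4 * pi * K * cr.
suff main (b : nat) : (0 < b)%N -> b0 <= b%:R ->
    q' * fine (mu (W `&` B)) <= ((3 * gc%:R) ^+ m * C1) / b%:R.
  have := le_inv_nat_le0 main; rewrite pmulr_rle0//.
move=> bgt0 bb0.
have bR0 : 0 < b%:R :> R by rewrite ltr0n.
have b1 : 1 <= b%:R :> R by rewrite ler1n.
pose G := (gc * b ^ a.+1)%N.
have G0 : (0 < G)%N by rewrite muln_gt0 expn_gt0 bgt0.
have GE : G%:R = gc%:R * b%:R ^+ a.+1 :> R by rewrite natrM natrX.
have GR0 : 0 < G%:R :> R by rewrite ltr0n.
pose y_ := @grid_point R m G rho2 y0.
(* When [p] is a boundary point some nodes leave the half-space; at the nodes only the behaviour of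
   [F] on the open set [Oc] is used. *)
have y_near j : `|y_ j - y0| <= rho2 by apply: grid_point_near => //; exact: ltW.
have y_r j : `|y_ j - y0| < r by exact: le_lt_trans (y_near j) rho2r.
have /fin_all_exists2[nu nu1 nuF] (j : {ffun 'I_m -> 'I_(2 * G).+1}) :=
  @sup_normal_exists R m d F (y_ j) md.
pose la : R := b%:R ^+ a * b%:R ^+ a / b%:R / (2 * pi * K).
pose E := 2 * M * (la / 2) `^ (- (s / 2)) +
   4 * ((1 + 2 * pi * kap) / b%:R) ^+ (2 * k) * fine (mu setT).
pose Q j := [set z : borelRV R (d + 1) | `|offset (F (y_ j)) z| <= b%:R ^- a.+1 / (2 * pi) /\
               q <= `|sin (2 * pi * (kap * height z))|].
pose N := b%:R ^+ a.+1 : R.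
have [a' aE] : exists a', a = a'.+3 by exists (a - 3)%N; rewrite -[RHS]addn3 subnK.
have laE : la = N * b%:R ^+ a'.+1 / (2 * pi * K).
  rewrite /la /N aE -[in RHS]exprD -exprD; congr (_ / _).
  rewrite (_ : (a'.+3 + a'.+3)%N = (a'.+4 + a'.+1).+1); last by rewrite !addSn !addnS.
  by rewrite exprSr mulfK// gt_eqF.
have rhola : 2 * (kap *+ (2 * k) + ((1 + d%:R * X) * b%:R ^+ a.+1) *+ (2 * k * d)) <= la.
  have N1 : 1 <= N by rewrite exprn_ege1.
  have H1 : 2 * (kap *+ (2 * k) + ((1 + d%:R * X) * N) *+ (2 * k * d)) <= 2 * cr * N.
    have A0 : 0 <= kap *+ (2 * k) by rewrite mulrn_wge0// ltW.
    exact: scaled_freq_le.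
  apply: (le_trans H1); rewrite laE mulrC.
  rewrite -[X in _ <= X]mulrA ler_wpM2l ?(le_trans _ N1)// ler_pdivlMr ?mulr_gt0//.
  apply: (@le_trans _ _ b%:R); last by rewrite exprS ler_peMr ?(ltW bR0)// exprn_ege1.
  apply: le_trans bb0; rewrite /b0 (_ : 2 * cr * (2 * pi * K) = 4 * pi * K * cr); last by ring.
  have : 0 <= 2 / eta by rewrite divr_ge0// ltW.
  lra_ineq.
have capj j : measurable (Q j) /\ q' * fine (mu (Q j)) <= E.
  apply: (cap_estimate s0 decay mB muB (X := X) (K := K) (nu := nu j)) => //.
  - have := ler_distD p (F (y_ j)) 0; rewrite !subr0 => H; rewrite (le_trans H)// /X addrC lerD2l.
    by have := Fnear _ (y_near j); lra_ineq.
  - exact: ltW.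
  move=> z Bz; have [x [h [Sx ->]]] := BC Bz.
  rewrite height_cone offset_cone => u1 h1.
  have hn0 : 0 < `|h| by rewrite (lt_le_trans _ h1)// invr_gt0.
  rewrite normrZ in u1.
  have xF : `|x - F (y_ j)| < eta / 2.
    have bD : `|x - F (y_ j)| / b%:R <= b%:R ^- a.
      by apply: le_trans u1; rewrite mulrC ler_wpM2r.
    apply: (@le_lt_trans _ _ b%:R^-1).
      rewrite ler_pdivrMr// in bD; apply: (le_trans bD).
      rewrite aE exprS invfM mulrAC mulVf ?gt_eqF// mul1r lef_pV2 ?posrE ?exprn_gt0//.
      by rewrite exprS ler_peMr ?(ltW bR0)// exprn_ege1.
    rewrite -(invrK (eta / 2)) ltf_pV2 ?posrE ?invr_gt0 ?divr_gt0// invf_div.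
    apply: lt_le_trans bb0; rewrite /b0.
    have : 0 <= 4 * pi * K * cr by rewrite !mulr_ge0// ltW.
    lra_ineq.
  have xp : `|x - p| < eta.
    have := ler_distD (F (y_ j)) x p; have := Fnear _ (y_near j); lra_ineq.
  have [y yr Fy] := Heta x Sx xp; rewrite -Fy in u1 xF *.
  have [_ lo _ qu] := loc y (y_ j) yr (y_r j).
  have H1 := qu (nu j) _ (nuF j); rewrite nu1 lexx in H1; have {}H1 := H1 isT.
  rewrite dotvZl normrM normrZ exprMn.
  have H2 : `|y - y_ j| ^+ 2 <= c ^- 2 * `|F y - F (y_ j)| ^+ 2.
    rewrite -exprVn -exprMn lerXn2r ?nnegrE ?mulr_ge0 ?invr_ge0 ?(ltW c0)//.
    by rewrite mulrC ler_pdivlMr// mulrC.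
  apply: (@le_trans _ _ (`|h| * (K * `|F y - F (y_ j)| ^+ 2))).
    rewrite ler_wpM2l// (le_trans H1)// KE -mulrA ler_wpM2l// ltW//.
  (* The normal component carries one factor |h| and the squared offset carries two; b |h| >= 1
     makes up for the difference. This is the origin of the factor [b] in [geom]. *)
  have -> : K * b%:R * (`|h| ^+ 2 * `|F y - F (y_ j)| ^+ 2) =
     `|h| * (K * `|F y - F (y_ j)| ^+ 2) * (b%:R * `|h|) by ring.
  rewrite ler_peMr//; first by rewrite !mulr_ge0 ?exprn_ge0// ltW.
  by rewrite -ler_pdivrMl// mulr1.
have cov z : (W `&` B) z -> exists j, Q j z.
  move=> [Wz Bz]; have [hz sz [y yr zE]] := WB z Wz Bz.
  have [j jy] := grid_approx G0 rho20 yr.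
  exists j; split; last exact: sz.
  rewrite zE offset_cone normrZ.
  have [_ _ up _] := loc y (y_ j) (lt_trans yr rho2r) (y_r j).
  apply: (@le_trans _ _ (2 * `|h0| * (K1 * (rho2 / G%:R)))).
    by rewrite ler_pM// (le_trans up)// ler_wpM2l ?(ltW K10).
  rewrite GE (cell_size_eq `|h0| K1 rho2 (_ : gc%:R != 0) (_ : b%:R ^+ a.+1 != 0) (lt0r_neq0 pi0)) ?pnatr_eq0//; last first.
    by rewrite expf_neq0// gt_eqF.
  rewrite ler_piMr//; first by rewrite divr_ge0 ?invr_ge0 ?exprn_ge0 ?mulr_ge0 ?(ltW pi0).
  by rewrite ler_pdivrMr ?mul1r ?ltr0n// ltW.
have H1 : fine (mu (W `&` B)) <= #|{: {ffun 'I_m -> 'I_(2 * G).+1}}|%:R * (E / q').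
  apply: (finite_cover_measure (Q := Q)) => //.
    by move=> j; case: (capj j).
  by move=> j; have [_ H] := capj j; rewrite ler_pdivlMr// mulrC.
rewrite card_ffun !card_ord in H1.
have M0 := M_ge0 decay.
have muT0 : 0 <= fine (mu setT) by rewrite fine_ge0.
have E0 : 0 <= E.
  by rewrite addr_ge0// ?mulr_ge0 ?powR_ge0// exprn_ge0// divr_ge0 ?(ltW bR0)// addr_ge0// !mulr_ge0// ltW.
have EC : E <= C1 / b%:R ^+ e.
  apply: (cap_error_le (p := (2 * a').+1.+4)) => //.
  - by rewrite addr_ge0// !mulr_ge0// ltW.
  - rewrite laE /N aE -exprD (_ : (a'.+4 + a'.+1)%N = (2 * a').+1.+4).
      by rewrite /c1 -mulrA mulrC.
    by rewrite mul2n -addnn !addSn !addnS.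
  - by rewrite /e aE; apply: cap_exponent_le; rewrite -aE.
  - by rewrite /k leq_pmull.
have G1 : ((2 * G).+1)%:R <= 3 * gc%:R * b%:R ^+ a.+1 :> R.
  by rewrite -mulrA -GE; exact: odd_grid_le.
by apply: grid_sum_le E0 EC G1 _ => //; rewrite -natrX.
Qed.
End ConeNull.

(** * Upper bound on the decay *)

Section UpperBound.
Context {R : realType}.

(** The functions [f N] have frequencies within 2N of N^2, so their integrals are O(N^-s); pointwise
    they tend to the indicator of the hyperplane. *)
Lemma hyperplane_null d (mu : {finite_measure set (borelRV R (d + 1)) -> \bar R}) (s M : R) :
  1 <= s -> (forall xi, enorm xi `^ (s / 2) * fourier_abs mu xi <= M) ->
  mu [set z : borelRV R (d + 1) | height z = 0] = 0%E.
Proof.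
move=> s1 decay; set Z := [set z : borelRV R (d + 1) | height z = 0].
have s0 : 0 <= s by lra_ineq.
have pi0 : 0 < pi :> R by exact: pi_gt0.
have mZ : measurable Z.
  have := (@height_measurable R d) measurableT _ (measurable_set1 0).
  by rewrite setTI; congr measurable; apply/seteqP; split.
pose phi (N : nat) z := sinc (2 * pi * dotv z (N%:R *: (@height_dual R d))) ^+ 2 * (1 : R).
pose f (N : nat) z := phi N z * wave ((N%:R ^+ 2) *: (@height_dual R d)) 0 z.
have fl N : freq_local mu (N%:R *+ 2) (phi N).
  have := freq_local_sincX (N%:R *: (@height_dual R d)) 2 (freq_local_cst1 mu).
  by rewrite add0r normrZ norm_ev mulr1 normr_nat.
have fE N z : f N z = sinc (2 * pi * (N%:R * height z)) ^+ 2 * cos (2 * pi * (N%:R ^+ 2 * height z)).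
  by rewrite /f /phi /wave mulr1 !dotvZr dotv_height_dual addr0.
have f1 N z : `|f N z| <= 1.
  by have [_ H _] := fl N; rewrite /f normrM mulr_ile1// wave_le1.
have mf N : measurable_fun setT (f N : borelRV R (d + 1) -> R).
  by have [H _ _] := fl N; apply: measurable_funM => //; exact: wave_measurable.
have cf z : f N z @[N --> \oo] --> (\1_Z z : R).
  have [h0|h0] := eqVneq (height z) 0.
    rewrite indicE mem_set//; rewrite (_ : (fun N => f N z) = cst 1); first exact: cvg_cst.
    by apply/funext => N; rewrite fE h0 !mulr0 cos0 /sinc eqxx expr1n mulr1.
  rewrite indicE memNset; last by move/eqP; rewrite (negbTE h0).
  apply/cvgrPdist_le => e e0.
  have hp : 0 < `|height z| by rewrite normr_gt0.
  exists (Num.truncn (e * `|height z|)^-1).+1 => // N /= HN.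
  rewrite sub0r normrN fE normrM.
  have NN : (e * `|height z|)^-1 < N%:R.
    have i0 : 0 <= (e * `|height z|)^-1 by rewrite invr_ge0 mulr_ge0// ltW.
    have /andP[_ H] := truncn_itv i0; apply: (lt_le_trans H).
    by rewrite ler_nat.
  have S : `|sinc (2 * pi * (N%:R * height z))| <= e.
    rewrite -[e]invrK; apply: sinc_decay; first by rewrite invr_gt0.
    rewrite !normrM (gtr0_norm pi0) !normr_nat.
    have N0 : e^-1 <= N%:R * `|height z|.
      by rewrite -ler_pdivrMr// -invfM ltW.
    apply: (le_trans N0); rewrite ler_peMl ?mulr_ge0//.
    have := pi_ge2 R; lra_ineq.
  apply: (@le_trans _ _ `|sinc (2 * pi * (N%:R * height z))|) => //.
  have w1 : `|cos (2 * pi * (N%:R ^+ 2 * height z))| <= 1 by rewrite ler_norml cos_geN1 cos_le1.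
  have x1 := sinc_le1 (2 * pi * (N%:R * height z)).
  move: x1 w1; rewrite normrX; move: `|sinc _| `|cos _| (normr_ge0 (sinc (2 * pi * (N%:R * height z)))) => x w x0 x1 w1.
  by rewrite expr2 -mulrA ler_piMr//; nra.
have [_ _ C] := Rintegral_cvg_bounded mu mf f1 cf.
have muE : \int[mu]_(x in setT) (\1_Z x : R) = fine (mu Z).
  by rewrite /Rintegral integral_indic// setIT.
rewrite muE in C.
have fZ : mu Z \is a fin_num by rewrite fin_num_measure.
rewrite -(fineK fZ); congr (_%:E); apply/eqP; rewrite eq_le [X in _ && X]fine_ge0// andbT.
pose K := M * (1 / 2) `^ (- (s / 2)).
(* N >= 4 makes the spread 2N at most half of the frequency N^2; s >= 1 turns (N^2/2)^(-s/2) into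
   O(1/N). *)
have IN (N : nat) : (4 <= N)%N -> \int[mu]_(x in setT) f N x <= K / N%:R.
  move=> N4; have N4' : 4 <= N%:R :> R by rewrite ler_nat.
  have := @freq_local_decay R d mu s M s0 decay (N%:R *+ 2) (phi N)
    ((N%:R ^+ 2) *: (@height_dual R d)) 0 (N%:R ^+ 2) (fl N).
  rewrite normrZ norm_ev mulr1 ger0_norm ?sqr_ge0//.
  have -> : 0 < N%:R ^+ 2 :> R by rewrite exprn_gt0// (lt_le_trans _ N4').
  have -> : 2 * (N%:R *+ 2) <= N%:R ^+ 2 :> R.
    by rewrite expr2 -mulr_natr; nra.
  rewrite lexx => /(_ isT isT isT) H.
  apply: (le_trans (ler_norm _)); apply: (le_trans H).
  rewrite /K -mulrA; apply: ler_wpM2l; first exact: M_ge0 decay.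
  have -> : N%:R ^+ 2 / 2 = 1 / 2 * N%:R ^+ 2 :> R by lra_ineq.
  have := @powR_neg_le R (1 / 2) N%:R (s / 2) 2 1.
  rewrite (expr1 N%:R) => H1; apply: H1; lra_ineq.
rewrite leNgt; apply/negP => v0.
pose e := fine (mu Z) / 2.
have e0 : 0 < e by rewrite divr_gt0.
suff : fine (mu Z) <= e by rewrite /e; lra_ineq.
rewrite -(cvg_lim _ C)//; apply: limr_le; first exact: cvgP C.
have B0 : 0 <= `|K| / e by rewrite divr_ge0// ltW.
exists ((Num.truncn (`|K| / e)).+1 + 4)%N => // N /= HN.
have N4 : (4 <= N)%N by rewrite (leq_trans _ HN)// leq_addl.
apply: (le_trans (IN N N4)).
have N0 : 0 < N%:R :> R by rewrite ltr0n (leq_trans _ N4).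
rewrite ler_pdivrMr// (le_trans (ler_norm _))// mulrC -ler_pdivrMr//.
have /andP[_ /ltW H] := truncn_itv B0; apply: (le_trans H).
by rewrite ler_nat (leq_trans _ HN)// leq_addr.
Qed.

Lemma cone_decay_le d (S : set 'rV[R]_d) (s M : R)
    (mu : {finite_measure set (borelRV R (d + 1)) -> \bar R}) :
  (2 <= d)%N -> embedded_submanifold d.-1 S -> supported_on mu (cone S) ->
  (0 < mu setT)%E -> (forall xi, enorm xi `^ (s / 2) * fourier_abs mu xi <= M) ->
  s <= d.-1%:R.
Proof.
move=> d2 embS [B [mB [BC muB]]] mupos decay; rewrite leNgt; apply/negP => sm.
have s1 : 1 <= s.
  by rewrite (le_trans _ (ltW sm))// ler1n; case: (d) d2 => [//|[]].
have Z0 := hyperplane_null s1 decay.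
set Z := [set z : borelRV R (d + 1) | height z = 0] in Z0.
have mZ : measurable Z.
  have := (@height_measurable R d) measurableT _ (measurable_set1 0).
  by rewrite setTI; congr measurable; apply/seteqP; split.
have mA : measurable (B `\` Z) by exact: measurableD.
have A0 : mu (B `\` Z) = 0%E.
  apply: locally_null_null => // z [Bz Zz].
  have [|W [oW Wz W0]] := cone_null_nbhd d2 embS sm decay mB BC muB Bz.
    by apply/eqP.
  exists W; split => //; apply/eqP; rewrite eq_le measure_ge0 andbT -W0.
  have mW : measurable (W : set (borelRV R (d + 1))) by exact: open_measurable_rV.
  by apply: le_measure; rewrite ?inE; [exact: measurableI|exact: measurableI|move=> x [? []]].
have mC : measurable (~` B) by exact: measurableC.
move: mupos; rewrite ltNge => /negP; apply.
(* The space is the union of three null sets: the complement of [B], the hyperplane of height 0, and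
   the rest of [B]. *)
apply: (@le_trans _ _ (mu ((~` B `|` Z) `|` (B `\` Z)))).
  apply: le_measure; rewrite ?inE//; first by apply: measurableU => //; exact: measurableU.
  move=> z _; have [Bz|Bz] := pselect (B z); last by left; left.
  have [Zz|Zz] := pselect (Z z); [by left; right|by right].
apply: (le_trans (measureU2 _ _ _)) => //; first exact: measurableU.
have U0 : (mu (~` B `|` Z) <= 0)%E.
  have E : (mu (~` B) + mu Z <= 0)%E by rewrite muB Z0 adde0.
  exact: le_trans (measureU2 _ mC mZ) E.
have E : (mu (~` B `|` Z) + mu (B `\` Z) <= 0)%E by rewrite A0 adde0.
exact: E.
Qed.

End UpperBound.

(** * Non-stationary phase in one variable *)

Section BoundedDerivatives.
Context {R : realType}.

(** Bounded C^k regularity with the derivatives as existential witnesses, so that products and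
    inverses go by induction on [k]. *)
Fixpoint bounded_derivs (a b C : R) (k : nat) (f : R -> R) : Prop :=
  (forall x, a < x < b -> `|f x| <= C) /\
  match k with
  | 0%N => forall x, a < x < b -> {for x, continuous f}
  | k'.+1 => exists2 f', (forall x, a < x < b -> is_derive x (1 : R) f (f' x)) &
               bounded_derivs a b C k' f'
  end.

Lemma is_derive_continuous (f : R -> R) (x l : R) :
  is_derive x (1 : R) f l -> {for x, continuous f}.
Proof. by case=> df _; apply: differentiable_continuous; exact/derivable1_diffP. Qed.

Lemma bounded_derivs_bound a b C k f x :
  bounded_derivs a b C k f -> a < x < b -> `|f x| <= C.
Proof. by case: k => [|k] [H _]; exact: H. Qed.

Lemma bounded_derivs_continuous a b C k f x :
  bounded_derivs a b C k f -> a < x < b -> {for x, continuous f}.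
Proof.
case: k => [|k] [_ H] xab; first exact: H.
by case: H => f' df _; exact: is_derive_continuous (df x xab).
Qed.

Lemma bounded_derivsW a b C k f :
  bounded_derivs a b C k.+1 f -> bounded_derivs a b C k f.
Proof.
elim: k f => [|k IH] f [H [f' df Hf']]; split => //.
  by move=> x xab; exact: is_derive_continuous (df x xab).
by exists f' => //; exact: IH.
Qed.

Lemma bounded_derivs_le a b C C' k f : C <= C' ->
  bounded_derivs a b C k f -> bounded_derivs a b C' k f.
Proof.
move=> CC; elim: k f => [|k IH] f [H Hf].
  by split => // x xab; rewrite (le_trans (H x xab)).
case: Hf => f' df Hf'; split; first by move=> x xab; rewrite (le_trans (H x xab)).
by exists f' => //; exact: IH.
Qed.

Lemma bounded_derivsD a b C D k f g : bounded_derivs a b C k f -> bounded_derivs a b D k g ->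
  bounded_derivs a b (C + D) k (fun x => f x + g x).
Proof.
elim: k f g => [|k IH] f g [Hf Hf1] [Hg Hg1]; split.
- by move=> x xab; rewrite (le_trans (ler_normD _ _))// lerD ?Hf ?Hg.
- by move=> x xab; apply: continuousD; [exact: Hf1|exact: Hg1].
- by move=> x xab; rewrite (le_trans (ler_normD _ _))// lerD ?Hf ?Hg.
case: Hf1 => f' df bf; case: Hg1 => g' dg bg.
exists (fun x => f' x + g' x); last exact: IH.
by move=> x xab; exact: is_deriveD (df x xab) (dg x xab).
Qed.

(** Each differentiation splits a product into two, whence 2^k. *)
Lemma bounded_derivsM a b C D k f g : 0 <= C -> 0 <= D ->
  bounded_derivs a b C k f -> bounded_derivs a b D k g ->
  bounded_derivs a b (2 ^+ k * (C * D)) k (fun x => f x * g x).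
Proof.
move=> C0 D0; elim: k f g => [|k IH] f g Hf Hg.
  case: Hf => Hf Hf1; case: Hg => Hg Hg1; split.
    by move=> x xab; rewrite expr0 mul1r normrM ler_pM// ?Hf ?Hg.
  by move=> x xab; apply: continuousM; [exact: Hf1|exact: Hg1].
have Hf0 := bounded_derivsW Hf; have Hg0 := bounded_derivsW Hg.
case: Hf => Hf [f' df bf]; case: Hg => Hg [g' dg bg]; split.
  move=> x xab; rewrite normrM (@le_trans _ _ (C * D))//.
    by rewrite ler_pM// ?Hf ?Hg.
  by rewrite ler_peMl ?mulr_ge0// exprn_ege1// ler1n.
exists (fun x => f x * g' x + f' x * g x).
  move=> x xab; have := is_deriveM (df x xab) (dg x xab).
  by move=> H; apply: is_derive_eq H _; rewrite /GRing.scale /= [g x * _]mulrC.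
have -> : 2 ^+ k.+1 * (C * D) = 2 ^+ k * (C * D) + 2 ^+ k * (C * D) by rewrite exprS; ring.
by apply: bounded_derivsD; exact: IH.
Qed.

(** Induction through (1/f)' = - f' (1/f)^2. The constant is chosen before the interval and the
    function: all oscillatory bounds need this uniformity. *)
Lemma bounded_derivsV k (C c : R) : 0 <= C -> 0 < c -> exists2 K : R, 0 <= K &
  forall a b f, bounded_derivs a b C k f -> (forall x, a < x < b -> c <= `|f x|) ->
    bounded_derivs a b K k (fun x => (f x)^-1).
Proof.
move=> C0 c0; elim: k => [|k [K K0 IH]].
  exists c^-1; first by rewrite invr_ge0 ltW.
  move=> a b f [Hf Hf1] cf; split => x xab.
    by rewrite normfV lef_pV2 ?posrE ?(lt_le_trans c0)// cf.
  apply: continuousV; last exact: Hf1.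
  by rewrite -normr_gt0 (lt_le_trans c0)// cf.
pose K' := c^-1 + 2 ^+ k * (C * (2 ^+ k * (K * K))).
have K20 : 0 <= 2 ^+ k * (C * (2 ^+ k * (K * K))) by rewrite !mulr_ge0// exprn_ge0.
have ci0 : 0 <= c^-1 by rewrite invr_ge0 ltW.
exists K'; first by rewrite addr_ge0.
move=> a b f Hf cf; have Hf0 := bounded_derivsW Hf; have IHf := IH a b f Hf0 cf.
case: Hf => Hf [f' df bf]; split.
  move=> x xab; rewrite (@le_trans _ _ c^-1)// ?lerDl//.
  by rewrite normfV lef_pV2 ?posrE ?(lt_le_trans c0)// cf.
exists (fun x => - f' x * ((f x)^-1 * (f x)^-1)).
  move=> x xab; have fx : f x != 0 by rewrite -normr_gt0 (lt_le_trans c0)// cf.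
  have H := is_deriveV fx (df x xab).
  apply: is_derive_eq H _.
  by rewrite /GRing.scale /= expr2 invfM mulNr mulNr mulrC.
have HN : bounded_derivs a b C k (fun x => - f' x).
  elim: k (f') bf {IH IHf Hf0 K20 K'} => [|k IHk] g [Hg Hg1]; split.
  - by move=> x xab; rewrite normrN Hg.
  - by move=> x xab; apply: continuousN; exact: Hg1.
  - by move=> x xab; rewrite normrN Hg.
  case: Hg1 => g' dg bg; exists (fun x => - g' x); last exact: IHk.
  by move=> x xab; exact: is_deriveN (dg x xab).
apply: (@bounded_derivs_le _ _ (2 ^+ k * (C * (2 ^+ k * (K * K))))); first by rewrite lerDr.
apply: bounded_derivsM => //; first by rewrite !mulr_ge0// exprn_ge0.
exact: bounded_derivsM.
Qed.

End BoundedDerivatives.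

Section NonstationaryPhase.
Context {R : realType}.
Local Notation leb := (@lebesgue_measure R).

Lemma continuous_oo_within (a b a2 b2 : R) (f : R -> R) : a < a2 -> b2 < b ->
  (forall x, a < x < b -> {for x, continuous f}) -> {within `[a2, b2], continuous f}.
Proof.
move=> aa bb cf; apply: continuous_in_subspaceT => x; rewrite inE /= in_itv /= => /andP[ax xb].
by apply: cf; rewrite (lt_le_trans aa)//= (le_lt_trans xb).
Qed.

Lemma is_derive_LRcontinuous (a b a2 b2 : R) (f f' : R -> R) : a < a2 -> a2 < b2 -> b2 < b ->
  (forall x, a < x < b -> is_derive x (1 : R) f (f' x)) ->
  derivable_oo_LRcontinuous f a2 b2 /\ {in `]a2, b2[, f^`()%classic =1 f'}.
Proof.
move=> aa ab bb df.
have H x : a2 <= x -> x <= b2 -> is_derive x (1 : R) f (f' x).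
  by move=> ax xb; apply: df; rewrite (lt_le_trans aa)//= (le_lt_trans xb).
split; [split|].
- by move=> x; rewrite in_itv /= => /andP[ax xb]; case: (H x (ltW ax) (ltW xb)).
- apply: cvg_at_right_filter; apply: is_derive_continuous; apply: H => //; exact: ltW.
- apply: cvg_at_left_filter; apply: is_derive_continuous; apply: H => //; exact: ltW.
move=> x; rewrite in_itv /= => /andP[ax xb].
by rewrite derive1E; case: (H x (ltW ax) (ltW xb)).
Qed.

Lemma normr_Rintegral_itv_le (a b C : R) (f : R -> R) : a <= b ->
  {within `[a, b], continuous f} -> (forall x, a <= x <= b -> `|f x| <= C) ->
  `|\int[leb]_(x in `[a, b]) f x| <= C * (b - a).
Proof.
move=> ab cf fC.
have If : leb.-integrable `[a, b] (EFin \o f).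
  by apply: continuous_compact_integrable => //; exact: segment_compact.
have IC : leb.-integrable `[a, b] (EFin \o cst C).
  apply: continuous_compact_integrable; first exact: segment_compact.
  by apply: continuous_subspaceT => x; exact: cst_continuous.
have In : leb.-integrable `[a, b] (EFin \o (fun x => `|f x|)).
  exact: integrable_abse If.
rewrite (le_trans (le_normr_Rintegral _ If))//.
apply: (@le_trans _ _ (\int[leb]_(x in `[a, b]) C)).
  apply: le_Rintegral => // x; rewrite /= in_itv /=; exact: fC.
rewrite Rintegral_cst//.
suff E : leb `[a, b]%classic = (b - a)%:E by have -> : b - a = fine (leb `[a, b]%classic) by rewrite E.
rewrite lebesgue_measure_itv /= lte_fin; case: ltP => // ba.
by have -> : b = a; [apply/eqP; rewrite eq_le ba ab|rewrite subrr].
Qed.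

Lemma derive_locally0 (a b : R) (f f' : R -> R) :
  (forall x, a < x < b -> is_derive x (1 : R) f (f' x)) ->
  (forall x, a < x < b -> f x = 0) -> forall x, a < x < b -> f' x = 0.
Proof.
move=> df f0 x xab.
have N : {near x, f =1 cst 0}.
  near=> y; apply: f0; apply/andP; split; near: y.
    by apply: lt_nbhsr; case/andP: xab.
  by apply: lt_nbhsl; case/andP: xab.
have [D1 D2] := df x xab.
by rewrite -D2 (near_eq_derive _ N) derive_cst.
Unshelve. all: by end_near. Qed.

(** Each integration by parts replaces [amp] by the derivative of amp / phi' and gains 1/la.
    Regularity lives on (a, b), the integral on [a2, b2], the support in [a1, b1]; the gaps kill the
    boundary terms and persist for the new amplitude. *)
Lemma nonstationary_phase (N : nat) (C c : R) : 0 <= C -> 0 < c ->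
  forall D, 0 <= D -> exists2 K : R, 0 <= K &
  forall (a a2 a1 b1 b2 b : R) (phi phi' amp : R -> R),
    a < a2 -> a2 < a1 -> a1 <= b1 -> b1 < b2 -> b2 < b ->
    (forall x, a < x < b -> is_derive x (1 : R) phi (phi' x)) ->
    bounded_derivs a b C N phi' -> (forall x, a < x < b -> c <= `|phi' x|) ->
    bounded_derivs a b D N amp ->
    (forall x, a < x < b -> x < a1 \/ b1 < x -> amp x = 0) ->
    forall la al : R, 0 < la ->
    `|\int[leb]_(x in `[a2, b2]) (amp x * cos (la * phi x + al))| <= K / la ^+ N * (b2 - a2).
Proof.
move=> C0 c0; elim: N => [|N IH] D D0.
  exists D => // a a2 a1 b1 b2 b phi phi' amp aa a21 ab b12 bb dphi bphi cphi bamp amp0 la al la0.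
  rewrite expr0 invr1 mulr1; apply: normr_Rintegral_itv_le.
  - lra_ineq.
  - apply: (continuous_oo_within aa bb) => x xab.
    apply: continuousM; first exact: bounded_derivs_continuous bamp xab.
    apply: continuous_comp; last exact: continuous_cos.
    apply: continuousD; last exact: cst_continuous.
    apply: continuousM; first exact: cst_continuous.
    exact: is_derive_continuous (dphi x xab).
  - move=> x /andP[ax xb]; have xab : a < x < b by rewrite (lt_le_trans aa)//= (le_lt_trans xb).
    rewrite normrM -[X in _ <= X]mulr1 ler_pM//; first exact: bounded_derivs_bound bamp xab.
    by rewrite ler_norml cos_geN1 cos_le1.
have [Kv Kv0 HV] := bounded_derivsV N.+1 C0 c0.
pose D' := 2 ^+ N.+1 * (D * Kv).
have D'0 : 0 <= D' by rewrite !mulr_ge0// exprn_ge0.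
have [K K0 {}IH] := IH D' D'0.
exists K => // a a2 a1 b1 b2 b phi phi' amp aa a21 ab b12 bb dphi bphi cphi bamp amp0 la al la0.
have bv := HV a b phi' bphi cphi.
have := bounded_derivsM D0 Kv0 bamp bv.
set g := (fun x => amp x * (phi' x)^-1); rewrite -/D' => -[_ [g' dg bg']].
have g0 x : a < x < b -> x < a1 \/ b1 < x -> g x = 0.
  by move=> xab x1; rewrite /g amp0// mul0r.
have g'0 x : a < x < b -> x < a1 \/ b1 < x -> g' x = 0.
  move=> /andP[ax xb] [x1|x1].
    apply: (@derive_locally0 a a1 g) => [y /andP[ay y1]|y /andP[ay y1]|]; last by rewrite ax.
      by apply: dg; rewrite ay; lra_ineq.
    by apply: g0; [rewrite ay; lra_ineq|left].
  apply: (@derive_locally0 b1 b g) => [y /andP[ay y1]|y /andP[ay y1]|]; last by rewrite x1.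
    by apply: dg; rewrite y1 andbT; lra_ineq.
  by apply: g0; [rewrite y1 andbT; lra_ineq|right].
pose G x := la^-1 * sin (la * phi x + al).
have dG x : a < x < b -> is_derive x (1 : R) G (phi' x * cos (la * phi x + al)).
  move=> xab.
  have D1 : is_derive x (1 : R) (fun y => la * phi y + al) (la * phi' x).
    have H1 := is_deriveZ la (dphi x xab).
    have H2 := is_deriveD H1 (is_derive_cst al x (1 : R)).
    by apply: is_derive_eq H2 _; rewrite addr0.
  have D2 := is_derive1_comp (is_derive_sin _) D1.
  have D3 := is_deriveZ la^-1 D2.
  apply: is_derive_eq D3 _.
  have Q (u v w : R) : u != 0 -> u^-1 * (v * (u * w)) = w * v by move=> u0; field.
  exact: Q (lt0r_neq0 la0).
have a2b2 : a2 < b2 by lra_ineq.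
have [LG EG] := is_derive_LRcontinuous aa a2b2 bb dG.
have [Lg Eg] := is_derive_LRcontinuous aa a2b2 bb dg.
have cg' : {within `[a2, b2], continuous g'}.
  by apply: (continuous_oo_within aa bb) => x xab; exact: bounded_derivs_continuous bg' xab.
have cphase x : a < x < b -> {for x, continuous (fun x => cos (la * phi x + al))}.
  move=> xab; apply: continuous_comp; last exact: continuous_cos.
  apply: continuousD; last exact: cst_continuous.
  apply: continuousM; first exact: cst_continuous.
  exact: is_derive_continuous (dphi x xab).
have cG' : {within `[a2, b2], continuous (fun x => phi' x * cos (la * phi x + al))}.
  apply: (continuous_oo_within aa bb) => x xab; apply: continuousM; last exact: cphase.
  exact: bounded_derivs_continuous bphi xab.
have ibp := Rintegration_by_parts a2b2 cg' Lg Eg cG' LG EG.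
have -> : \int[leb]_(x in `[a2, b2]) (amp x * cos (la * phi x + al)) =
    \int[leb]_(x in `[a2, b2]) (g x * (phi' x * cos (la * phi x + al))).
  apply: eq_Rintegral => x; rewrite inE /= in_itv /= => /andP[ax xb].
  have xab : a < x < b by rewrite (lt_le_trans aa)//= (le_lt_trans xb).
  rewrite /g mulrA -[amp x * _ * _]mulrA mulVf ?mulr1//.
  by rewrite -normr_gt0 (lt_le_trans c0)// cphi.
have ga2 : g a2 = 0 by apply: g0; [rewrite aa; lra_ineq|left].
have gb2 : g b2 = 0 by apply: g0; [rewrite bb andbT; lra_ineq|right].
rewrite ibp ga2 gb2.
rewrite !mul0r subr0 sub0r normrN.
(* The sine is a cosine with phase lowered by pi/2, so the induction hypothesis, stated for every
   phase, applies. *)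
have -> : \int[leb]_(x in `[a2, b2]) (g' x * G x) =
   la^-1 * \int[leb]_(x in `[a2, b2]) (g' x * cos (la * phi x + (al - pi / 2))).
  rewrite -RintegralZl//.
    by apply: eq_Rintegral => x _; rewrite /G addrA cosBpihalf; ring.
  apply: continuous_compact_integrable; first exact: segment_compact.
  apply: (continuous_oo_within aa bb) => x xab.
  apply: continuousM; first exact: bounded_derivs_continuous bg' xab.
  apply: continuous_comp; last exact: continuous_cos.
  apply: continuousD; last exact: cst_continuous.
  apply: continuousM; first exact: cst_continuous.
  exact: is_derive_continuous (dphi x xab).
have bphi' := bounded_derivsW bphi.
have := IH a a2 a1 b1 b2 b phi phi' g' aa a21 ab b12 bb dphi bphi' cphi bg' g'0 la (al - pi / 2) la0.
rewrite normrM (gtr0_norm (_ : 0 < la^-1)) ?invr_gt0// exprS invfM => H.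
rewrite [K * _]mulrCA -mulrA ler_wpM2l// invr_ge0 ltW//.
Qed.

End NonstationaryPhase.

(** * A translation-invariant measure on row vectors *)

Section Packs.
Context d (T : measurableType d) (R : realType).

(** Attaches a proof of sigma-finiteness to a measure obtained inside an existence proof, so that
    the structure can be inferred; [finite_pack] does the same for finiteness. *)
Definition sigma_finite_pack (mu : {measure set T -> \bar R})
  of sigma_finite setT mu : set T -> \bar R := mu.
Definition finite_pack (mu : {measure set T -> \bar R})
  of (mu setT < +oo)%E : set T -> \bar R := mu.

Variables (mu : {measure set T -> \bar R}) (sf : sigma_finite setT mu)
  (fi : (mu setT < +oo)%E).

HB.instance Definition _ := Measure.on (sigma_finite_pack sf).
HB.instance Definition _ := Measure_isSigmaFinite.Build _ _ _ (sigma_finite_pack sf) sf.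

HB.instance Definition _ := Measure.on (finite_pack fi).
Lemma finite_pack_fin : fin_num_fun (finite_pack fi).
Proof.
move=> A mA; rewrite ge0_fin_numE//; apply: le_lt_trans fi.
by apply: le_measure; rewrite ?inE.
Qed.
HB.instance Definition _ := Measure_isFinite.Build _ _ _ (finite_pack fi) finite_pack_fin.

End Packs.

Section Push.
Context d d' (T1 : measurableType d) (T2 : measurableType d') (R : realType).
Variables (m : {measure set T1 -> \bar R}) (f : T1 -> T2) (mf : measurable_fun setT f).

Definition push_measure : {measure set T2 -> \bar R} :=
  measure_function_pushforward__canonical__measure_function_Measure m mf.

Lemma push_measureE A : push_measure A = m (f @^-1` A).
Proof. by []. Qed.

Lemma ge0_integral_push (g : T2 -> \bar R) : measurable_fun setT g -> (forall x, 0 <= g x)%E ->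
  (\int[push_measure]_x g x = \int[m]_x g (f x))%E.
Proof.
move=> mg g0; have := @ge0_integral_pushforward _ _ _ _ R f mf m setT g measurableT mg (fun x _ => g0 x).
by rewrite preimage_setT.
Qed.

Lemma Rintegral_push (g : T2 -> R) : measurable_fun setT g ->
  m.-integrable setT (EFin \o (g \o f)) ->
  \int[push_measure]_(x in setT) g x = \int[m]_(x in setT) g (f x).
Proof.
move=> mg Ig; rewrite /Rintegral; congr fine.
have mg' : measurable_fun setT (EFin \o g) by exact/measurable_EFinP.
have := @integral_pushforward _ _ _ _ R f mf m setT (EFin \o g) mg'.
by rewrite preimage_setT; apply.
Qed.

End Push.

Section HaarMeasure.
Context {R : realType}.
Local Notation leb := (@lebesgue_measure R).

(** An open set is a countable union of rational balls, and a sup-norm ball is a finite intersection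
    of coordinate strips. *)
Lemma measurable_rV_coord d (T : measurableType d) n (g : T -> 'rV[R]_n) :
  (forall i, measurable_fun setT (fun x => g x 0 i)) ->
  measurable_fun setT (g : T -> borelRV R n).
Proof.
move=> mg; apply: (@measurability _ _ _ _ setT (g : T -> borelRV R n) (@open 'rV[R]_n)) => //.
move=> _ [U oU <-]; rewrite setTI.
pose F (i : nat) : set T :=
  if @unpickle ('rV[rat]_n * nat)%type i is Some ck then
    if `[< @rat_ball R n ck `<=` U >] then g @^-1` rat_ball ck else set0
  else set0.
have -> : g @^-1` U = \bigcup_i F i.
  apply/seteqP; split => x /=.
    move=> Ux; have [ck xck ckU] := rat_ball_exists oU Ux.
    exists (pickle ck) => //; rewrite /F pickleK.
    by case: asboolP.
  move=> [i _]; rewrite /F; case: unpickle => [ck|//].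
  by case: asboolP => // ckU /ckU.
apply: bigcup_measurable => i _; rewrite /F; case: unpickle => [ck|//].
case: asboolP => // _.
have -> : g @^-1` rat_ball ck = \bigcap_(j in [set: 'I_n])
    [set x | `|g x 0 j - ratr (ck.1 0 j)| < ck.2.+1%:R^-1].
  apply/seteqP; split => x /=.
    rewrite /rat_ball /= => H j _ /=; apply: le_lt_trans H.
    by have := coord_norm_le (g x - map_mx ratr ck.1) j; rewrite !mxE.
  move=> H; rewrite /rat_ball /=; apply: normrV_lt => [|j]; first by rewrite invr_gt0.
  by rewrite !mxE; exact: H.
apply: fin_bigcap_measurable => // j _.
have mf : measurable_fun setT (fun x => `|g x 0 j - ratr (ck.1 0 j)|).
  by apply: measurableT_comp => //; apply: measurable_funB => //; exact: measurable_cst.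
have := mf measurableT _ (measurable_itv `]-oo, (ck.2.+1%:R^-1)[).
by rewrite setTI; congr measurable; apply/seteqP; split => z /=; rewrite in_itv.
Qed.

Lemma coord_measurable n i :
  measurable_fun (setT : set (borelRV R n)) (fun y : 'rV[R]_n => y 0 i).
Proof. by have := dotv_measurable (ev R i); under eq_fun do rewrite ev_coord. Qed.

Definition shiftV n (w : 'rV[R]_n) (y : borelRV R n) : borelRV R n := (y : 'rV[R]_n) + w.

Lemma shiftV_measurable n (w : 'rV[R]_n) : measurable_fun setT (shiftV w).
Proof.
apply: measurable_rV_coord => i; under eq_fun do rewrite /shiftV mxE.
by apply: measurable_funD; [exact: coord_measurable|exact: measurable_cst].
Qed.

Definition sup_box n (r : R) : set (borelRV R n) := [set y | `|y : 'rV[R]_n| <= r].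
Arguments sup_box n r : clear implicits.

Lemma sup_box_measurable n (r : R) : measurable (sup_box n r).
Proof.
apply: closed_measurable_rV.
have -> : sup_box n r = (fun y : 'rV[R]_n => `|y|) @^-1` `]-oo, r]%classic.
  by apply/seteqP; split => y /=; rewrite in_itv.
apply: preimage_closed; last exact: interval_closed.
by move=> y _; exact: norm_continuous.
Qed.

Definition shiftR (t : R) (x : measurableTypeR R) : measurableTypeR R := (x : R) + t.

Lemma shiftR_measurable t : measurable_fun (setT : set (measurableTypeR R)) (shiftR t).
Proof.
have H : measurable_fun (setT : set R) (fun x : R => x + t).
  by apply: measurable_funD; [exact: measurable_id|exact: measurable_cst].
exact: H.
Qed.

Lemma lebesgue_shift (t : R) (A : set (measurableTypeR R)) : measurable A ->
  leb (shiftR t @^-1` A) = leb A.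
Proof.
move=> mA; have mf := shiftR_measurable t.
have := @lebesgue_measure_unique R (push_measure leb mf).
move=> H; rewrite (H _ A mA)// => X [[a b] /= _ <-].
rewrite (push_measureE leb mf).
have -> : shiftR t @^-1` `]a, b]%classic = `](a - t), (b - t)]%classic.
  by apply/seteqP; split => x /=; rewrite /shiftR !in_itv /= ltrBlDr lerBrDr.
have H1 := lebesgue_measure_itv `]a, b].
have H2 := lebesgue_measure_itv `](a - t), (b - t)].
apply: (etrans H1 (esym (etrans H2 _))) => /=.
rewrite !lte_fin ltrD2r; case: ifP => // _.
by rewrite -!EFinB; congr (_%:E); ring.
Qed.

Lemma Rintegral_setT_box d (T : measurableType d) (mu : {measure set T -> \bar R})
    (A : set T) (f : T -> R) (C : R) :
  measurable A -> (mu A < +oo)%E -> measurable_fun setT f ->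
  (forall x, `|f x| <= C) -> (forall x, ~ A x -> f x = 0) ->
  mu.-integrable setT (EFin \o f).
Proof.
move=> mA Aoo mf fC f0.
have -> : EFin \o f = (EFin \o f) \_ A.
  apply/funext => x; rewrite patchE; case: ifPn => // /negP xA /=.
  by rewrite f0// => Ax; apply: xA; exact/mem_set.
apply/(integrable_mkcond _ mA); apply: measurable_bounded_integrable => //.
  exact: measurable_funTS.
exists C; split; first exact: num_real.
by move=> M CM x _ /=; rewrite (le_trans (fC x))// ltW.
Qed.

Lemma product_shift_invariant m (L : {sigma_finite_measure set (borelRV R m) -> \bar R})
   (t : R) (w : 'rV[R]_m) (A : set (measurableTypeR R * borelRV R m)) :
  (forall w (A : set (borelRV R m)), measurable A -> L (shiftV w @^-1` A) = L A) ->
  measurable A ->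
  (leb \x L)%E ((fun z => (shiftR t z.1, shiftV w z.2)) @^-1` A) = (leb \x L)%E A.
Proof.
move=> Linv mA; rewrite /product_measure1 /=.
have mf := shiftR_measurable t.
transitivity (\int[leb]_x (L \o xsection A) (shiftR t x))%E.
  apply: eq_integral => x _ /=; rewrite -[RHS](Linv w)//; exact: measurable_xsection.
rewrite -(@ge0_integral_push _ _ _ _ R leb _ mf (L \o xsection A)).
- apply: eq_measure_integral => B mB _; rewrite (push_measureE leb mf); exact: lebesgue_shift.
- exact: measurable_fun_xsection.
- by move=> x /=.
Qed.

Definition append m (z : measurableTypeR R * borelRV R m) : borelRV R (1 + m) :=
  row_mx (const_mx (z.1 : R)) (z.2 : 'rV[R]_m).

Lemma append_measurable m : measurable_fun setT (@append m).
Proof.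
apply: measurable_rV_coord => i; case: (split_ordP i) => j ->.
  under eq_fun do rewrite /append row_mxEl mxE.
  exact: measurable_fst.
under eq_fun do rewrite /append row_mxEr.
exact: (measurableT_comp (@coord_measurable m j) (@measurable_snd _ _ _ _)).
Qed.

Lemma append_shift m (w : 'rV[R]_(1 + m)) z :
  shiftV w (append z) = append (shiftR (w 0 (lshift m 0)) z.1, shiftV (rsubmx w) z.2).
Proof.
apply/rowP => i; rewrite /append /shiftV /shiftR /= mxE; case: (split_ordP i) => j ->.
  by rewrite !row_mxEl !mxE (ord1 j).
by rewrite !row_mxEr !mxE.
Qed.

(** Built by adding one Lebesgue coordinate at a time. Later arguments see only sigma-finiteness,
    translation invariance and the positive finite size of boxes. *)
Lemma haar_measure m : exists L : {sigma_finite_measure set (borelRV R m) -> \bar R},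
  (forall w (A : set (borelRV R m)), measurable A -> L (shiftV w @^-1` A) = L A) /\
  (forall r : R, 0 < r -> (0 < L (sup_box m r) < +oo)%E).
Proof.
elim: m => [|m [L [Linv Lbox]]].
  exists (\d_ ((0 : 'rV[R]_0) : borelRV R 0)); split.
    move=> w A mA.
    have -> : shiftV w @^-1` A = A.
      by apply/funext => y; rewrite /shiftV /= (thinmx0 w) addr0.
    by [].
  move=> r r0.
  pose z : borelRV R 0 := (0 : 'rV[R]_0).
  have E : dirac z (sup_box 0 r) = 1%E :> \bar R.
    by rewrite diracE mem_set//= /sup_box /= normr0 ltW.
  change (0 < (dirac z (sup_box 0 r) : \bar R) < +oo)%E.
  by rewrite E lte01 ltry.
pose P := push_measure (leb \x L)%E (@append_measurable m).
have Pbox (r : R) : 0 < r -> P (sup_box (1 + m) r) = ((2 * r)%:E * L (sup_box m r))%E.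
  move=> r0; rewrite (push_measureE _ (@append_measurable m)).
  have -> : @append m @^-1` sup_box (1 + m) r = `[- r, r]%classic `*` sup_box m r.
    apply/seteqP; split => -[t y] /=; rewrite /sup_box /=.
      move=> H; split.
        rewrite in_itv /= -ler_norml; apply: le_trans H.
        have := coord_norm_le (append (t, y) : 'rV[R]_(1 + m)) (lshift m 0).
        by rewrite /append row_mxEl mxE.
      apply: normrV_le => [|i]; first exact: ltW.
      apply: le_trans H.
      have := coord_norm_le (append (t, y) : 'rV[R]_(1 + m)) (rshift 1 i).
      by rewrite /append row_mxEr.
    rewrite in_itv /= -ler_norml => -[tr yr]; apply: normrV_le => [|i]; first exact: ltW.
    case: (split_ordP i) => j ->; first by rewrite /append row_mxEl mxE.
    by rewrite /append row_mxEr (le_trans (coord_norm_le _ _)).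
  have mI : measurable (`[- r, r]%classic : set (measurableTypeR R)) by exact: measurable_itv.
  have E := product_measure1E leb L mI (@sup_box_measurable m r).
  apply: etrans E _; congr (_ * _)%E.
  apply: etrans (lebesgue_measure_itv `[- r, r]) _; rewrite /= lte_fin.
  have -> : - r < r by lra_ineq.
  by rewrite -EFinB; congr (_%:E); ring.
have Psf : sigma_finite setT P.
  exists (fun k => sup_box (1 + m) k.+1%:R).
    apply/seteqP; split => // y _; exists (Num.truncn `|y : 'rV[R]_(1 + m)|) => //=.
    by have /andP[_ /ltW] := truncn_itv (normr_ge0 (y : 'rV[R]_(1 + m))).
  move=> k; split; first exact: sup_box_measurable.
  by rewrite Pbox// lte_mul_pinfty// ?lee_fin//; have /andP[] := Lbox k.+1%:R (ltr0Sn _ _).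
exists (sigma_finite_pack Psf); split.
  move=> w A mA; rewrite /sigma_finite_pack !(push_measureE _ (@append_measurable m)).
  pose w1 : 'rV[R]_(1 + m) := w.
  have mA' : measurable (@append m @^-1` A).
    by have := @append_measurable m measurableT _ mA; rewrite setTI.
  rewrite -[RHS](@product_shift_invariant m L (w1 0 (lshift m 0)) (rsubmx w1) _ Linv mA').
  have E := @append_shift m w1.
  have -> : append (m:=m) @^-1` (shiftV w @^-1` A) =
     (fun z : measurableTypeR R * borelRV R m =>
      (shiftR (w1 0 (lshift m 0)) z.1, shiftV (rsubmx w1) z.2)) @^-1`
     (append (m:=m) @^-1` A) by apply/funext => z; rewrite /= E.
  by [].
move=> r r0; have /andP[L0 Loo] := Lbox r r0.
change (0 < P (sup_box (1 + m) r) < +oo)%E; rewrite Pbox//.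
by rewrite mule_gt0 ?lte_fin ?mulr_gt0//= lte_mul_pinfty// lee_fin mulr_ge0// ltW.
Qed.

End HaarMeasure.

Arguments sup_box {R} n r.

(** * Bounded functions supported on sets of finite measure *)

Section Tame.
Context d (T : measurableType d) (R : realType).
Variable mu : {measure set T -> \bar R}.
Implicit Types (f g : T -> R) (A : set T).

(** A class closed under the operations used below, from which every integrability side condition
    follows. *)
Definition tame_on A f := [/\ measurable A, (mu A < +oo)%E, measurable_fun setT f,
  (exists C : R, forall x, `|f x| <= C) & forall x, ~ A x -> f x = 0].

Lemma tame_on_integrable A f : tame_on A f -> mu.-integrable setT (EFin \o f).
Proof. by case=> mA Aoo mf [C fC] f0; exact: Rintegral_setT_box fC f0. Qed.

Lemma tame_onM A f g (C : R) : tame_on A f -> measurable_fun setT g ->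
  (forall x, `|g x| <= C) -> tame_on A (fun x => f x * g x).
Proof.
move=> [mA Aoo mf [D fD] f0] mg gC; split => //.
- exact: measurable_funM.
- exists (D * C) => x; rewrite normrM; apply: ler_pM => //.
- by move=> x /f0 ->; rewrite mul0r.
Qed.

Lemma tame_onD A f g : tame_on A f -> tame_on A g -> tame_on A (fun x => f x + g x).
Proof.
move=> [mA Aoo mf [D fD] f0] [_ _ mg [C gC] g0]; split => //.
- exact: measurable_funD.
- by exists (D + C) => x; rewrite (le_trans (ler_normD _ _))// lerD.
- by move=> x Ax; rewrite f0// g0// addr0.
Qed.

Lemma tame_onZ A f (c : R) : tame_on A f -> tame_on A (fun x => c * f x).
Proof.
move=> tf; have := @tame_onM A f (fun=> c) `|c| tf (measurable_cst _) (fun=> lexx _).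
by under eq_fun do rewrite mulrC.
Qed.

Lemma tame_on0 A : measurable A -> (mu A < +oo)%E -> tame_on A (fun=> 0).
Proof.
move=> mA Aoo; split => //.
by exists 0 => x; rewrite normr0.
Qed.

Lemma tame_on_indic A : measurable A -> (mu A < +oo)%E -> tame_on A (fun x => \1_A x).
Proof.
move=> mA Aoo; split => //.
- exact: measurable_indic.
- by exists 1 => x; rewrite indicE; case: (_ \in _); rewrite ?normr1 ?normr0.
- by move=> x nAx; rewrite indicE memNset.
Qed.

Lemma tame_on_sum A (I : Type) (s : seq I) (f : I -> T -> R) :
  measurable A -> (mu A < +oo)%E ->
  (forall i, tame_on A (f i)) -> tame_on A (fun x => \sum_(i <- s) f i x).
Proof.
move=> mA Aoo tf; elim: s => [|i s IH].
  by under eq_fun do rewrite big_nil; exact: tame_on0.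
by under eq_fun do rewrite big_cons; exact: tame_onD.
Qed.

Lemma Rintegral_tame_sum A (I : Type) (s : seq I) (f : I -> T -> R) :
  measurable A -> (mu A < +oo)%E -> (forall i, tame_on A (f i)) ->
  \int[mu]_x (\sum_(i <- s) f i x) = \sum_(i <- s) \int[mu]_x f i x.
Proof.
move=> mA Aoo tf; elim: s => [|i s IH].
  rewrite big_nil; under eq_Rintegral do rewrite big_nil.
  by rewrite Rintegral_cst// mul0r.
rewrite big_cons; under eq_Rintegral do rewrite big_cons.
rewrite RintegralD//; last 2 first.
- exact: tame_on_integrable (tf i).
- exact: tame_on_integrable (tame_on_sum s mA Aoo tf).
by rewrite IH.
Qed.

Lemma Rintegral_indic_setT A : measurable A -> \int[mu]_x (\1_A x : R) = fine (mu A).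
Proof.
by move=> mA; rewrite /Rintegral -[X in fine (mu X)]setIT -integral_indic.
Qed.

Lemma normr_Rintegral_tame A f (E : R) : tame_on A f -> (forall x, `|f x| <= E) ->
  `|\int[mu]_x f x| <= E * fine (mu A).
Proof.
move=> tf fE; have [mA Aoo mf _ f0] := tf.
have If := tame_on_integrable tf; rewrite (le_trans (le_normr_Rintegral _ If))//.
have tI := tame_on_indic mA Aoo.
rewrite -Rintegral_indic_setT// -RintegralZl//; last exact: tame_on_integrable tI.
apply: le_Rintegral => //.
- by have := integrable_norm If.
- exact: tame_on_integrable (tame_onZ E tI).
move=> x _; rewrite indicE; have [xA|xA] := boolP (x \in A); first by rewrite mulr1.
by rewrite f0 ?normr0 ?mulr0// => Ax; move/negP: xA; apply; exact/mem_set.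
Qed.

(** Expand the nonnegative integral over [A] of (f - c)^2, with [c] the mean of [f] on [A]. *)
Lemma Rintegral_Cauchy_Schwarz A f : (0 < mu A)%E -> tame_on A f ->
  (\int[mu]_x f x) ^+ 2 <= fine (mu A) * \int[mu]_x (f x ^+ 2).
Proof.
move=> A0 tf; have [mA Aoo mf [C fC] f0] := tf.
set V := fine (mu A); set I := \int[mu]_x f x; set Q := \int[mu]_x _.
have V0 : 0 < V by rewrite fine_gt0// A0.
have tI := tame_on_indic mA Aoo.
have tf2 : tame_on A (fun x => f x ^+ 2).
  by under eq_fun do rewrite expr2; exact: tame_onM fC.
pose c := I / V.
have H : \int[mu]_x ((f x ^+ 2 + (- (2 * c)) * f x) + c ^+ 2 * \1_A x) =
    Q + (- (2 * c)) * I + c ^+ 2 * V.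
  rewrite RintegralD//; last 2 first.
  - exact: tame_on_integrable (tame_onD tf2 (tame_onZ _ tf)).
  - exact: tame_on_integrable (tame_onZ _ tI).
  rewrite RintegralD//; last 2 first.
  - exact: tame_on_integrable tf2.
  - exact: tame_on_integrable (tame_onZ _ tf).
  rewrite RintegralZl//; last exact: tame_on_integrable tf.
  rewrite RintegralZl//; last exact: tame_on_integrable tI.
  by rewrite Rintegral_indic_setT.
have : 0 <= Q + (- (2 * c)) * I + c ^+ 2 * V.
  rewrite -H; apply: Rintegral_ge0 => x _; rewrite indicE.
  have [xA|xA] := boolP (x \in A).
    have -> : f x ^+ 2 + - (2 * c) * f x + c ^+ 2 * 1 = (f x - c) ^+ 2 by ring.
    exact: sqr_ge0.
  rewrite f0 ?expr0n ?mulr0 ?addr0// => Ax; move/negP: xA; apply; exact/mem_set.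
have -> : Q + - (2 * c) * I + c ^+ 2 * V = Q - I ^+ 2 / V.
  by rewrite /c; move: (V) V0 => v v0; field; rewrite gt_eqF.
by rewrite subr_ge0 ler_pdivrMr// mulrC.
Qed.

End Tame.

Section TameFubini.
Context d1 d2 (T1 : measurableType d1) (T2 : measurableType d2) (R : realType).
Variables (m1 : {sigma_finite_measure set T1 -> \bar R})
          (m2 : {sigma_finite_measure set T2 -> \bar R}).

Lemma tame_xsection A B (f : T1 * T2 -> R) x : tame_on (m1 \x m2)%E (A `*` B) f ->
  measurable B -> (m2 B < +oo)%E -> tame_on m2 B (fun y => f (x, y)).
Proof.
move=> [_ _ mf [C fC] f0] mB Boo; split => //.
- exact: measurableT_comp mf (measurable_pair1 x).
- by exists C.
- by move=> y nBy; apply: f0 => -[].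
Qed.

Lemma tame_ysection A B (f : T1 * T2 -> R) y : tame_on (m1 \x m2)%E (A `*` B) f ->
  measurable A -> (m1 A < +oo)%E -> tame_on m1 A (fun x => f (x, y)).
Proof.
move=> [_ _ mf [C fC] f0] mA Aoo; split => //.
- exact: measurableT_comp mf (measurable_pair2 y).
- by exists C.
- by move=> x nAx; apply: f0 => -[].
Qed.

Lemma tame_on_prod A B (f : T1 * T2 -> R) (C : R) :
  measurable A -> measurable B -> (m1 A < +oo)%E -> (m2 B < +oo)%E ->
  measurable_fun setT f -> (forall z, `|f z| <= C) ->
  (forall x y, ~ (A x /\ B y) -> f (x, y) = 0) ->
  tame_on (m1 \x m2)%E (A `*` B) f.
Proof.
move=> mA mB Aoo Boo mf fC f0; split => //.
- exact: measurableX.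
- have E := product_measure1E m1 m2 mA mB.
  have : ((m1 A * m2 B)%E < +oo)%E.
    by rewrite lte_mul_pinfty// ge0_fin_numE.
  by rewrite -E.
- by exists C.
- by move=> [x y] /f0.
Qed.

Lemma Rintegral_Fubini A B (f : T1 * T2 -> R) :
  tame_on (m1 \x m2)%E (A `*` B) f ->
  measurable A -> measurable B -> (m1 A < +oo)%E -> (m2 B < +oo)%E ->
  \int[m1]_x (\int[m2]_y f (x, y)) = \int[m2]_y (\int[m1]_x f (x, y)).
Proof.
move=> tf mA mB Aoo Boo; have If := tame_on_integrable tf.
rewrite {1 3}/Rintegral; congr fine.
transitivity (\int[m1]_x \int[m2]_y (EFin \o f) (x, y))%E.
  apply: eq_integral => x _; rewrite fineK//.
  apply: integrable_fin_num => //.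
  exact: tame_on_integrable (tame_xsection x tf mB Boo).
rewrite (Fubini If); apply: eq_integral => y _; rewrite fineK//.
apply: integrable_fin_num => //.
exact: tame_on_integrable (tame_ysection y tf mA Aoo).
Qed.

Lemma Rintegral_prod A B (f : T1 * T2 -> R) :
  tame_on (m1 \x m2)%E (A `*` B) f ->
  measurable A -> measurable B -> (m1 A < +oo)%E -> (m2 B < +oo)%E ->
  \int[(m1 \x m2)%E]_z f z = \int[m1]_x (\int[m2]_y f (x, y)).
Proof.
move=> tf mA mB Aoo Boo; have If := tame_on_integrable tf.
rewrite [RHS]/Rintegral; congr fine.
transitivity (\int[m1]_x \int[m2]_y (EFin \o f) (x, y))%E.
  by rewrite (integral12_prod_meas1 If).
apply: eq_integral => x _; rewrite fineK//.
apply: integrable_fin_num => //.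
exact: tame_on_integrable (tame_xsection x tf mB Boo).
Qed.

Lemma tame_Rintegral_ysection A B (f : T1 * T2 -> R) :
  tame_on (m1 \x m2)%E (A `*` B) f ->
  measurable A -> measurable B -> (m1 A < +oo)%E -> (m2 B < +oo)%E ->
  tame_on m2 B (fun y => \int[m1]_x f (x, y)).
Proof.
move=> tf mA mB Aoo Boo; have [_ _ mf [C fC] f0] := tf; split => //.
- have If := tame_on_integrable tf.
  have mG := measurable_fubini_G If.
  exact: measurableT_comp mG.
- exists (C * fine (m1 A)) => y.
  exact: (@normr_Rintegral_tame _ _ _ m1 A _ C (tame_ysection y tf mA Aoo)).
- move=> y nBy; have -> : (fun x => f (x, y)) = fun=> 0.
    by apply/funext => x; apply: f0 => -[].
  by rewrite Rintegral_cst// mul0r.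
Qed.

End TameFubini.

(** * Directional integration and Weyl differencing *)

Section Weyl.
Context {R : realType} (p : nat).
Local Notation leb := (@lebesgue_measure R).
Variable L : {sigma_finite_measure set (borelRV R p) -> \bar R}.
Hypothesis Linv : forall w (A : set (borelRV R p)), measurable A -> L (shiftV w @^-1` A) = L A.
Hypothesis Lbox : forall r : R, 0 < r -> (0 < L (sup_box p r) < +oo)%E.
Implicit Types (f g a : 'rV[R]_p -> R) (rho : R).

Definition supported_in rho f := forall z, rho < `|z| -> f z = 0.

Lemma supported_tame rho f (C : R) : 0 < rho ->
  measurable_fun (setT : set (borelRV R p)) f -> (forall z, `|f z| <= C) ->
  supported_in rho f -> tame_on L (sup_box p rho) f.
Proof.
move=> r0 mf fC f0; have /andP[_ Loo] := Lbox r0; split => //.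
- exact: sup_box_measurable.
- by exists C.
- by move=> z /negP; rewrite /sup_box /= -ltNge; exact: f0.
Qed.

Lemma Rintegral_shift A f (w : 'rV[R]_p) : tame_on L A f ->
  \int[L]_z f ((z : 'rV[R]_p) + w) = \int[L]_z f z.
Proof.
move=> tf; have [mA Aoo mf [C fC] f0] := tf; have mw := @shiftV_measurable R p w.
have mA' : measurable (shiftV w @^-1` A) by rewrite -[X in measurable X]setTI; exact: mw.
have tfw : tame_on L (shiftV w @^-1` A) (f \o shiftV w).
  split => //.
  - by apply: le_lt_trans Aoo; rewrite le_eqVlt; apply/orP; left; apply/eqP; exact: Linv.
  - exact: measurableT_comp.
  - by exists C => x; exact: fC.
  - by move=> x nx; exact: f0.
rewrite -[LHS](@Rintegral_push _ _ _ _ R L (shiftV w) mw f mf (tame_on_integrable tfw)).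
congr fine; apply: eq_measure_integral => B mB _.
by rewrite (push_measureE L mw); exact: Linv.
Qed.

Lemma line_measurable (e : 'rV[R]_p) f : measurable_fun (setT : set (borelRV R p)) f ->
  measurable_fun (setT : set (measurableTypeR R * borelRV R p))
    (fun sz => f ((sz.2 : 'rV[R]_p) + (sz.1 : R) *: e)).
Proof.
move=> mf.
have mg : measurable_fun (setT : set (measurableTypeR R * borelRV R p))
    ((fun sz => (sz.2 : 'rV[R]_p) + (sz.1 : R) *: e) : _ -> borelRV R p).
  apply: measurable_rV_coord => i.
  under eq_fun do rewrite !mxE.
  apply: measurable_funD.
    exact: (measurableT_comp (@coord_measurable R p i) (@measurable_snd _ _ _ _)).
  by apply: measurable_funM; [exact: measurable_fst|exact: measurable_cst].
exact: measurableT_comp mf mg.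
Qed.

(* The slab [0 <= z_i <= 1] is a fundamental domain up to the weight
   [1 = \int 1(0 <= z_i - s <= 1) ds], which lets Fubini integrate along [e_i] first
   without any product decomposition of [L]. *)
Lemma directional_bound rho f (i : 'I_p) (C E : R) : 0 < rho ->
  measurable_fun (setT : set (borelRV R p)) f -> (forall z, `|f z| <= C) ->
  supported_in rho f -> 0 <= E ->
  (forall z : 'rV[R]_p, `|\int[leb]_s f (z + (s : R) *: ev R i)| <= E) ->
  `|\int[L]_z f z| <= E * fine (L (sup_box p (rho + 1))).
Proof.
move=> r0 mf fC f0 E0 Hline.
have r1 : 0 < rho + 1 by lra_ineq.
have /andP[_ L1oo] := Lbox r1.
pose I01 : set R := `[0, 1]%classic; pose chi (x : R) : R := \1_I01 x.
have mchi : measurable_fun (setT : set R) chi.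
  by apply: measurable_indic; exact: measurable_itv.
have chi1 x : `|chi x| <= 1 by rewrite /chi indicE; case: (_ \in _); rewrite ?normr1 ?normr0.
have chi0 x : x < 0 \/ 1 < x -> chi x = 0.
  move=> Hx; rewrite /chi indicE memNset// /I01 /= in_itv /=.
  by case: Hx => H /andP[H1 H2]; lra_ineq.
have mB := @sup_box_measurable R p (rho + 1).
pose J : set (measurableTypeR R) := `[- (rho + 1), rho + 1]%classic.
have mJ : measurable J by exact: measurable_itv.
have Joo : (leb J < +oo)%E.
  apply: le_lt_trans (ltry (rho + 1 + (rho + 1))).
  have -> := lebesgue_measure_itv `[- (rho + 1), rho + 1].
  by case: ifP => // _; rewrite /= lee_fin; lra_ineq.
have nJ (s : R) : ~ J s -> rho + 1 < `|s|.
  by rewrite /J /= in_itv /= -ler_norml => /negP; rewrite -ltNge.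
have C0 : 0 <= C by exact: le_trans (fC 0).
pose F1 (sz : measurableTypeR R * borelRV R p) : R :=
  f (sz.2 : 'rV[R]_p) * chi ((sz.2 : 'rV[R]_p) 0 i - (sz.1 : R)).
pose F2 (sz : measurableTypeR R * borelRV R p) : R :=
  f ((sz.2 : 'rV[R]_p) + (sz.1 : R) *: ev R i) * chi ((sz.2 : 'rV[R]_p) 0 i).
have mco : measurable_fun (setT : set (measurableTypeR R * borelRV R p))
    (fun sz => (sz.2 : 'rV[R]_p) 0 i).
  exact: (measurableT_comp (@coord_measurable R p i) (@measurable_snd _ _ _ _)).
have t1 : tame_on (leb \x L)%E (J `*` sup_box p (rho + 1)) F1.
  apply: (@tame_on_prod _ _ _ _ _ _ _ _ _ _ (C * 1)) => //.
  - apply: measurable_funM.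
      exact: (measurableT_comp mf (@measurable_snd _ _ _ _)).
    apply: (measurableT_comp mchi); apply: measurable_funB; [exact: mco|].
    exact: (@measurable_fst _ _ (measurableTypeR R) (borelRV R p)).
  - by move=> z; rewrite /F1 normrM ler_pM.
  - move=> s z nAB; rewrite /F1 /=.
    have [zr|zr] := ltP rho `|z : 'rV[R]_p|; first by rewrite f0// mul0r.
    have Bz : sup_box p (rho + 1) z by rewrite /sup_box /=; lra_ineq.
    have /nJ sr : ~ J s by move=> Js; exact: nAB.
    have zi := le_trans (coord_norm_le (z : 'rV[R]_p) i) zr.
    rewrite [chi _]chi0 ?mulr0//; move: zi sr; rewrite ler_norml.
    move: ((z : 'rV[R]_p) 0 i) => x /andP[x1 x2].
    by case: (lerP 0 (s : R)) => s0; [rewrite ger0_norm//|rewrite ltr0_norm//] => H; [left|right]; lra_ineq.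
have t2 : tame_on (leb \x L)%E (J `*` sup_box p (rho + 1)) F2.
  apply: (@tame_on_prod _ _ _ _ _ _ _ _ _ _ (C * 1)) => //.
  - apply: measurable_funM; first exact: line_measurable.
    exact: (measurableT_comp mchi).
  - by move=> z; rewrite /F2 normrM ler_pM.
  - move=> s z nAB; rewrite /F2 /=.
    have [zr|zr] := ltP rho `|(z : 'rV[R]_p) + (s : R) *: ev R i|; first by rewrite f0// mul0r.
    have [zi|/chi0->] : 0 <= (z : 'rV[R]_p) 0 i <= 1 \/
        ((z : 'rV[R]_p) 0 i < 0 \/ 1 < (z : 'rV[R]_p) 0 i); last by rewrite mulr0.
      by case: (ltP ((z : 'rV[R]_p) 0 i) 0) => h1; [right; left|
         case: (ltP 1 ((z : 'rV[R]_p) 0 i)) => h2; [right; right|left]].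
    exfalso; apply: nAB; split.
      apply: contrapT => /nJ sr.
      have := le_trans (coord_norm_le ((z : 'rV[R]_p) + (s : R) *: ev R i) i) zr.
      rewrite !mxE !eqxx mulr1 ler_norml; case/andP: zi => z1 z2 /andP[h1 h2].
      by move: sr; case: (lerP 0 (s : R)) => s0; [rewrite ger0_norm//|rewrite ltr0_norm//]; lra_ineq.
    rewrite /sup_box /=; apply: normrV_le => [|j]; first exact: ltW.
    have := le_trans (coord_norm_le ((z : 'rV[R]_p) + (s : R) *: ev R i) j) zr.
    rewrite !mxE; have [->|ji] := eqVneq j i.
      by move=> _; case/andP: zi => z1 z2; rewrite ger0_norm//; lra_ineq.
    by rewrite andbF mulr0 addr0; lra_ineq.
have tf := supported_tame r0 mf fC f0.
have E1 : \int[L]_z f z = \int[L]_z \int[leb]_s F1 (s, z).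
  apply: eq_Rintegral => z _; rewrite /F1 /=.
  pose x : R := (z : 'rV[R]_p) 0 i.
  pose K : set (measurableTypeR R) := `[x - 1, x]%classic.
  have mK : measurable K by exact: measurable_itv.
  have K1 : leb K = 1%E.
    have -> := lebesgue_measure_itv `[x - 1, x].
    by rewrite /= lte_fin ltrBlDr ltrDl ltr01 -EFinB; congr (_%:E); ring.
  have Koo : (leb K < +oo)%E by rewrite K1 ltry.
  have IK : \int[leb]_s (\1_K s : R) = 1.
    exact: etrans (Rintegral_indic_setT _ mK) (congr1 fine K1).
  have Ex (s : R) : chi (x - s) = \1_K s.
    rewrite /chi !indicE; congr ((nat_of_bool _)%:R).
    apply/idP/idP => /set_mem; rewrite /I01 /K /= in_itv /= => /andP[h1 h2];
      by apply/mem_set; rewrite /= in_itv /=; apply/andP; split; lra_ineq.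
  rewrite -/x; transitivity (\int[leb]_s (f z * \1_K s)).
    rewrite RintegralZl//; last first.
      by apply: (@tame_on_integrable _ _ _ _ K); apply: tame_on_indic => //; exact: Koo.
    by rewrite [X in _ * X]IK mulr1.
  by apply: eq_Rintegral => s _; congr (_ * _); exact: esym (Ex s).
(* For fixed [s], translating [z] by s e_i frees the weight from [s]; after exchanging the
   integrals, the inner one runs along a line. *)
have E2 : \int[leb]_s \int[L]_z F1 (s, z) = \int[leb]_s \int[L]_z F2 (s, z).
  apply: eq_Rintegral => s _.
  have ts := tame_xsection s t1 mB L1oo.
  rewrite -(Rintegral_shift ((s : R) *: ev R i) ts); apply: eq_Rintegral => z _.
  by rewrite /F1 /F2 /= !mxE !eqxx mulr1 addrK.
rewrite E1 -(Rintegral_Fubini t1 mJ mB Joo L1oo) E2 (Rintegral_Fubini t2 mJ mB Joo L1oo).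
apply: (@normr_Rintegral_tame _ _ _ L (sup_box p (rho + 1))).
  exact: tame_Rintegral_ysection t2 mJ mB Joo L1oo.
move=> z; rewrite /F2 /=; have [->|->] : chi ((z : 'rV[R]_p) 0 i) = 0 \/ chi ((z : 'rV[R]_p) 0 i) = 1.
- by rewrite /chi indicE; case: (_ \in _); [right|left].
- under eq_Rintegral do rewrite mulr0.
  by rewrite Rintegral_cst// mul0r normr0.
- have -> : \int[leb]_s (f ((z : 'rV[R]_p) + (s : R) *: ev R i) * 1) =
      \int[leb]_s f ((z : 'rV[R]_p) + (s : R) *: ev R i).
    by apply: eq_Rintegral => s _; rewrite mulr1.
  exact: Hline.
Qed.

(** By invariance the integral equals its average over the shifts; Cauchy-Schwarz moves the square
    inside, where only phase differences remain. Shifts of norm at most 1 keep every translate in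
    one box. *)
Lemma weyl_differencing rho a (th : 'rV[R]_p -> R) (C : R) (K : finType) (w : K -> 'rV[R]_p) (al : R) :
  0 < rho -> measurable_fun (setT : set (borelRV R p)) a ->
  measurable_fun (setT : set (borelRV R p)) th ->
  (forall z, `|a z| <= C) -> supported_in rho a -> (forall k, `|w k| <= 1) ->
  (#|K|%:R * \int[L]_z (a z * cos (th z + al))) ^+ 2 <=
  fine (L (sup_box p (rho + 1))) * \sum_k \sum_k'
    `|\int[L]_z (a ((z : 'rV[R]_p) + (w k - w k')) * a z *
        cos (th ((z : 'rV[R]_p) + (w k - w k')) - th z))|.
Proof.
move=> r0 ma mth aC a0 w1.
have r1 : 0 < rho + 1 by lra_ineq.
have /andP[L1 L1oo] := Lbox r1.
have mB := @sup_box_measurable R p (rho + 1).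
have mcos : measurable_fun (setT : set R) (@cos R).
  exact: continuous_measurable_fun (@continuous_cos R).
have mshift v g : measurable_fun (setT : set (borelRV R p)) g ->
    measurable_fun (setT : set (borelRV R p)) (fun z : 'rV[R]_p => g (z + v)).
  move=> mg; exact: measurableT_comp mg (@shiftV_measurable R p v).
have ta k : tame_on L (sup_box p (rho + 1)) (fun z : 'rV[R]_p => a (z + w k)).
  apply: (@supported_tame _ _ C) => //; first exact: mshift.
  move=> z zr; apply: a0.
  have := ler_normB (z + w k) (w k); rewrite addrK; have := w1 k; lra_ineq.
have tac k : tame_on L (sup_box p (rho + 1))
    (fun z : 'rV[R]_p => a (z + w k) * cos (th (z + w k) + al)).
  apply: (@tame_onM _ _ _ _ _ _ _ 1) => //; last by move=> z; exact: cos_max.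
  apply: (measurableT_comp mcos); apply: measurable_funD; last exact: measurable_cst.
  exact: mshift.
have ta0 : tame_on L (sup_box p (rho + 1)) (fun z : 'rV[R]_p => a z * cos (th z + al)).
  apply: (@tame_onM _ _ _ _ _ _ _ 1) => //; last by move=> z; exact: cos_max.
    by apply: (@supported_tame _ _ C) => // z zr; apply: a0; lra_ineq.
  by apply: (measurableT_comp mcos); apply: measurable_funD; last exact: measurable_cst.
pose g (z : borelRV R p) := \sum_k (a ((z : 'rV[R]_p) + w k) * cos (th ((z : 'rV[R]_p) + w k) + al)).
have tg : tame_on L (sup_box p (rho + 1)) g by exact: tame_on_sum.
have Ig : \int[L]_z g z = #|K|%:R * \int[L]_z (a z * cos (th z + al)).
  rewrite (Rintegral_tame_sum _ mB L1oo tac).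
  under eq_bigr do rewrite (Rintegral_shift (f := fun z => a z * cos (th z + al)) _ ta0).
  by rewrite sumr_const cardE mulr_natl.
rewrite -Ig (le_trans (Rintegral_Cauchy_Schwarz L1 tg))// ler_wpM2l ?fine_ge0//.
pose G k k' (z : borelRV R p) := a ((z : 'rV[R]_p) + w k) * a ((z : 'rV[R]_p) + w k') *
   cos (th ((z : 'rV[R]_p) + w k) - th ((z : 'rV[R]_p) + w k')).
have tG k k' : tame_on L (sup_box p (rho + 1)) (G k k').
  apply: (@tame_onM _ _ _ _ _ _ _ 1); last by move=> z; exact: cos_max.
    by apply: (@tame_onM _ _ _ _ _ _ _ C) => //; exact: mshift.
  by apply: (measurableT_comp mcos); apply: measurable_funB; exact: mshift.
have tG1 k : tame_on L (sup_box p (rho + 1)) (fun z => \sum_k' G k k' z).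
  exact: tame_on_sum.
apply: (@le_trans _ _ (\int[L]_z (\sum_k \sum_k' G k k' z))).
  apply: le_Rintegral => //.
  - have [_ _ mg [D gD] _] := tg.
    have := tame_on_integrable (tame_onM tg mg gD).
    by under [X in EFin \o X]eq_fun do rewrite -expr2.
  - exact: tame_on_integrable (tame_on_sum _ mB L1oo tG1).
  move=> z _.
  (* Adding the square of the matching sine sum turns the square of the cosine sum into a double sum
     of cosines of differences. *)
  pose s := \sum_k (a ((z : 'rV[R]_p) + w k) * sin (th ((z : 'rV[R]_p) + w k) + al)).
  have -> : \sum_k \sum_k' G k k' z = g z ^+ 2 + s ^+ 2; last by rewrite lerDl sqr_ge0.
  rewrite !expr2 /g /s !big_distrlr /= -big_split /=; apply: eq_bigr => k _.
  rewrite -big_split /=; apply: eq_bigr => k' _; rewrite /G.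
  have -> : th ((z : 'rV[R]_p) + w k) - th ((z : 'rV[R]_p) + w k') =
    (th ((z : 'rV[R]_p) + w k) + al) - (th ((z : 'rV[R]_p) + w k') + al) by ring.
  by rewrite cosB; ring.
rewrite (Rintegral_tame_sum _ mB L1oo tG1); apply: ler_sum => k _.
rewrite (Rintegral_tame_sum _ mB L1oo (tG k)); apply: ler_sum => k' _.
(* Translating back by [w k'] makes the integrand depend on the difference of the two shifts
   only. *)
rewrite -(Rintegral_shift (- w k') (tG k k')) /G.
rewrite (le_trans (ler_norm _))// le_eqVlt; apply/orP; left; apply/eqP; congr (`| _ |).
by apply: eq_Rintegral => z _; rewrite subrK -addrA [- w k' + _]addrC.
Qed.

End Weyl.

(** * Bump functions *)

Section Bump.
Context {R : realType}.
Local Notation leb := (@lebesgue_measure R).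

Definition ppart (x : R) : R := Num.max 0 x.

Lemma ppart_ge0 x : 0 <= ppart x. Proof. by rewrite le_max lexx. Qed.

Lemma ppart_quadratic (x h : R) :
  `|ppart (x + h) ^+ 2 - ppart x ^+ 2 - 2 * ppart x * h| <= h ^+ 2.
Proof.
rewrite /ppart; case: (lerP 0 x) => x0; case: (lerP 0 (x + h)) => xh0;
  rewrite ler_norml; apply/andP; split; nra.
Qed.

Lemma is_derive_quadratic (f : R -> R) (x l : R) :
  (forall h, `|f (x + h) - f x - l * h| <= h ^+ 2) -> is_derive x (1 : R) f l.
Proof.
move=> H.
have C : h^-1 *: (f (h *: 1 + x) - f x) @[h --> 0^'] --> l.
  apply/cvgrPdist_le => e e0; near=> h.
  have h0 : h != 0 by near: h; exact: nbhs_dnbhs_neq.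
  have he : `|h| <= e.
    by near: h; apply: dnbhs0_le.
  rewrite [h *: 1]mulr1 [h + x]addrC; apply: le_trans he.
  have -> : l - h^-1 *: (f (x + h) - f x) = - (h^-1 * (f (x + h) - f x - l * h)).
    by rewrite /GRing.scale /=; field.
  rewrite normrN normrM normfV ler_pdivrMl ?normr_gt0//.
  by rewrite (le_trans (H h))// -expr2 real_normK ?num_real.
split; first by apply/cvg_ex; exists l.
exact: cvg_lim C.
Unshelve. all: by end_near. Qed.

(** Pulling out a plain monomial reduces differentiability at the kink to the case of the square. *)
Lemma ppart_exprS x k : ppart x ^+ k.+3 = x ^+ k.+1 * ppart x ^+ 2.
Proof.
rewrite /ppart; case: (lerP 0 x) => x0; first by rewrite -exprD; congr (_ ^+ _); lia.
by rewrite !expr0n mulr0.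
Qed.

Lemma is_derive_ppart k x :
  is_derive x (1 : R) (fun t => ppart t ^+ k.+2) (k.+2%:R * ppart x ^+ k.+1).
Proof.
have H2 : is_derive x (1 : R) (fun t => ppart t ^+ 2) (2 * ppart x).
  by apply: is_derive_quadratic => h; exact: ppart_quadratic.
case: k => [|k]; first exact: H2.
have -> : (fun t => ppart t ^+ k.+3) = (fun t => t ^+ k.+1) * (fun t => ppart t ^+ 2).
  by apply/funext => t; rewrite ppart_exprS.
have Hk := @is_deriveX R R (@id R) k.+1 x 1 1 (is_derive_id x 1).
have Ek : (@id R) ^+ k.+1 = (fun t => t ^+ k.+1) by rewrite fctE.
rewrite Ek in Hk; apply: (is_derive_eq (is_deriveM Hk H2)).
rewrite /GRing.scale /= mulr1.
have -> : ppart x ^+ k.+2 = x ^+ k * ppart x ^+ 2.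
  case: (k) => [|k']; [by rewrite expr0 mul1r|exact: ppart_exprS].
have E : x * ppart x = ppart x ^+ 2.
  rewrite /ppart; case: (lerP 0 x) => // _; ring.
rewrite exprS -[k.+3]addn2 natrD.
transitivity ((x ^+ k * 2) * (x * ppart x) + k.+1%:R * x ^+ k * ppart x ^+ 2); first by ring.
by rewrite E -[k.+1]addn1 natrD; ring.
Qed.

Lemma is_derive_affine (sg c s : R) : is_derive s (1 : R) (fun t => sg * t + c) sg.
Proof.
have H1 := is_deriveD (is_deriveZ sg (is_derive_id s (1 : R))) (is_derive_cst c s (1 : R)).
by apply: (is_derive_eq H1); rewrite /GRing.scale /= mulr1 addr0.
Qed.

(** k! 2^k dominates every falling factorial of [k] times a power of a quantity at most 2; j < k
    keeps a positive power, hence continuity. *)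
Lemma bounded_derivs_ppart (a b c0 sg c B : R) (j k : nat) :
  `|sg| <= 1 -> (forall s, a < s < b -> `|sg * s + c| <= 2) ->
  `|c0| * (k`!%:R * 2 ^+ k) <= B -> (j < k)%N ->
  bounded_derivs a b B j (fun s => c0 * ppart (sg * s + c) ^+ k).
Proof.
move=> sg1 H; elim: j k c0 => [|j IH] k c0 HB jk.
all: have bnd s : a < s < b -> `|c0 * ppart (sg * s + c) ^+ k| <= B.
1,3: move=> /H sab; apply: le_trans HB; rewrite normrM ler_wpM2l// normrX.
1,2: have P2 : `|ppart (sg * s + c)| <= 2.
1,3: by rewrite ger0_norm ?ppart_ge0// /ppart ge_max ler0n (le_trans (ler_norm _)).
1,2: rewrite (le_trans (lerXn2r _ _ _ P2)) ?nnegrE// ler_peMl ?exprn_ge0//.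
1,2: by rewrite ler1n fact_gt0.
- split => // s sab; apply: continuousM; first exact: cst_continuous.
  case: k jk {HB bnd} => [//|[|k]] _.
    have -> : (fun t => ppart (sg * t + c) ^+ 1) = (fun t => Num.max 0 (sg * t + c)).
      by apply/funext => t; rewrite expr1.
    apply: (@continuous_max _ _ (fun=> 0) (fun t => sg * t + c)); first exact: cst_continuous.
    exact: is_derive_continuous (is_derive_affine sg c s).
  apply: (@continuous_comp _ _ _ (fun t => sg * t + c) (fun t => ppart t ^+ k.+2)).
    exact: is_derive_continuous (is_derive_affine sg c s).
  exact: is_derive_continuous (is_derive_ppart k (sg * s + c)).
split => //; case: k jk HB {bnd} => [//|[//|k]] jk HB.
exists (fun s => (c0 * (k.+2%:R * sg)) * ppart (sg * s + c) ^+ k.+1).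
  move=> s sab.
  have d1 := is_derive_affine sg c s.
  have d2 := is_deriveZ c0 (@is_derive1_comp _ (fun t => ppart t ^+ k.+2)
    (fun t => sg * t + c) s _ _ (is_derive_ppart k (sg * s + c)) d1).
  by apply: (is_derive_eq d2); rewrite /GRing.scale /=; ring.
apply: IH => //; apply: le_trans HB.
have -> : (k.+2)`!%:R * 2 ^+ k.+2 = k.+2%:R * (2 * (k.+1`!%:R * 2 ^+ k.+1)) :> R.
  by rewrite factS natrM exprS; ring.
rewrite !normrM -!mulrA ler_wpM2l// [`|k.+2%:R|]ger0_norm ?ler0n// ler_wpM2l ?ler0n//.
have X0 : 0 <= k.+1`!%:R * 2 ^+ k.+1 :> R by rewrite mulr_ge0 ?ler0n ?exprn_ge0.
by move: sg1 X0; move: (_ * _ ^+ _) => X; move: (`|sg|) => q; nra.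
Qed.

Variables (N : nat) (r : R).
Hypothesis r01 : 0 < r <= 2^-1.

(** Exponent N + 1 gives exactly the [N] bounded derivatives that the integrations by parts
    consume. *)
Definition bump (t : R) : R := ppart (r + t) ^+ N.+1 * ppart (r - t) ^+ N.+1.

Lemma bump_ge0 t : 0 <= bump t.
Proof. by rewrite mulr_ge0// exprn_ge0// ppart_ge0. Qed.

Lemma bump_le1 t : bump t <= 1.
Proof.
rewrite /bump -exprMn exprn_ile1 ?mulr_ge0 ?ppart_ge0//.
rewrite /ppart; case/andP: r01 => r0 r1.
by case: (lerP 0 (r + t)) => h1; case: (lerP 0 (r - t)) => h2; rewrite ?mul0r ?mulr0 ?ler01//; nra.
Qed.

Lemma bump_eq0 t : r < `|t| -> bump t = 0.
Proof.
rewrite /bump /ppart => H; case: (lerP 0 (r + t)) => h1; last by rewrite expr0n mul0r.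
case: (lerP 0 (r - t)) => h2; last by rewrite [0 ^+ N.+1]expr0n mulr0.
by move: H; rewrite ltNge ler_norml => /negP[]; apply/andP; split; lra_ineq.
Qed.

Lemma bump_continuous : continuous bump.
Proof.
move=> t; have C (sg : R) : {for t, continuous (fun s => ppart (sg * s + r) ^+ N.+1)}.
  have c1 : {for t, continuous (fun s => Num.max 0 (sg * s + r))}.
    apply: (@continuous_max _ _ (fun=> 0) (fun s => sg * s + r)); first exact: cst_continuous.
    exact: is_derive_continuous (is_derive_affine sg r t).
  exact: (continuous_comp c1 (@exprn_continuous _ N.+1 _)).
have -> : bump = (fun s => ppart (1 * s + r) ^+ N.+1 * ppart ((-1) * s + r) ^+ N.+1).
  by apply/funext => s; rewrite /bump mul1r mulN1r ![_ + r]addrC.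
exact: continuousM (C 1) (C (-1)).
Qed.

Definition bump_const : R := 2 ^+ N * ((N.+1`!%:R * 2 ^+ N.+1) * (N.+1`!%:R * 2 ^+ N.+1)).

Lemma bump_const_ge0 : 0 <= bump_const.
Proof. by rewrite !(mulr_ge0, exprn_ge0). Qed.

(** The range 3r leaves room for an argument in a window of radius 2r shifted by up to [r], as for a
    translated amplitude. The constant does not depend on [r]. *)
Lemma bounded_derivs_bump (a b c Q : R) : `|Q| <= 1 ->
  (forall s, a < s < b -> `|c + s| <= 3 * r) ->
  bounded_derivs a b bump_const N (fun s => Q * bump (c + s)).
Proof.
move=> Q1 H; case/andP: r01 => r0 r1.
have B0 : 0 <= (N.+1`!%:R * 2 ^+ N.+1 : R) by rewrite !(mulr_ge0, exprn_ge0).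
have h1 : bounded_derivs a b (N.+1`!%:R * 2 ^+ N.+1) N (fun s => Q * ppart (1 * s + (r + c)) ^+ N.+1).
  apply: bounded_derivs_ppart => //; first by rewrite normr1.
    move=> s /H; rewrite !ler_norml => /andP[s1 s2]; apply/andP; split; lra_ineq.
  by rewrite ler_piMl.
have h2 : bounded_derivs a b (N.+1`!%:R * 2 ^+ N.+1) N (fun s => 1 * ppart ((-1) * s + (r - c)) ^+ N.+1).
  apply: bounded_derivs_ppart => //; first by rewrite normrN normr1.
    move=> s /H; rewrite !ler_norml => /andP[s1 s2]; apply/andP; split; lra_ineq.
  by rewrite normr1 mul1r.
have := bounded_derivsM B0 B0 h1 h2.
rewrite (_ : (fun x => _) = (fun s => Q * bump (c + s)))//.
apply/funext => s; rewrite /bump mul1r mulN1r [in RHS]mulrA mul1r.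
by congr (_ * ppart _ ^+ _ * ppart _ ^+ _); ring.
Qed.

Variables (p : nat) (c : 'rV[R]_p).

Definition amp (z : 'rV[R]_p) : R := \prod_i bump (z 0 i - c 0 i).

Lemma amp_ge0 z : 0 <= amp z. Proof. by apply: prodr_ge0 => i _; exact: bump_ge0. Qed.

Lemma amp_le1 z : amp z <= 1.
Proof. by apply: prodr_ile1 => i _; rewrite bump_ge0 bump_le1. Qed.

Lemma amp_norm z : `|amp z| <= 1. Proof. by rewrite ger0_norm ?amp_ge0 ?amp_le1. Qed.

Lemma amp_coord_eq0 (z : 'rV[R]_p) i : r < `|z 0 i - c 0 i| -> amp z = 0.
Proof. by move=> H; rewrite /amp (bigD1 i)//= bump_eq0// mul0r. Qed.

Lemma amp_eq0 z : r < `|z - c| -> amp z = 0.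
Proof.
move=> H; case: (pselect (exists i, r < `|z 0 i - c 0 i|)) => [[i Hi]|nH].
  exact: amp_coord_eq0 Hi.
move: H; rewrite ltNge => /negP[]; apply: normrV_le; first by case/andP: r01 => /ltW.
by move=> i; rewrite !mxE leNgt; apply/negP => Hi; apply: nH; exists i.
Qed.

Lemma amp_measurable : measurable_fun (setT : set (borelRV R p)) amp.
Proof.
rewrite /amp; apply: measurable_prod => i _.
apply: (measurableT_comp (continuous_measurable_fun bump_continuous)).
by apply: measurable_funB; [exact: coord_measurable|exact: measurable_cst].
Qed.

Lemma amp_line z i s :
  amp (z + s *: ev R i) = (\prod_(j | j != i) bump (z 0 j - c 0 j)) * bump (z 0 i - c 0 i + s).
Proof.
rewrite /amp (bigD1 i)//= mulrC; congr (_ * _).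
  by apply: eq_bigr => j ji; rewrite !mxE (negbTE ji) andbF mulr0 addr0.
by rewrite !mxE !eqxx mulr1; congr bump; ring.
Qed.

Lemma bounded_derivs_amp (a b : R) (z : 'rV[R]_p) i :
  (forall s, a < s < b -> `|z 0 i - c 0 i + s| <= 3 * r) ->
  bounded_derivs a b bump_const N (fun s => amp (z + s *: ev R i)).
Proof.
move=> H; under eq_fun do rewrite amp_line; apply: bounded_derivs_bump => //.
rewrite ger0_norm; first by apply: prodr_ile1 => j _; rewrite bump_ge0 bump_le1.
by apply: prodr_ge0 => j _; exact: bump_ge0.
Qed.

End Bump.

(** * Non-stationary phase along a line *)

Section LinePhase.
Context {R : realType}.
Local Notation leb := (@lebesgue_measure R).

Lemma line_phase (N : nat) (C k D : R) : 0 <= C -> 0 < k -> 0 <= D ->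
  exists2 K : R, 0 <= K & forall (x0 r : R) (phi phi' f : R -> R), 0 < r <= 2^-1 ->
    (forall x, x0 - 2 * r < x < x0 + 2 * r -> is_derive x (1 : R) phi (phi' x)) ->
    bounded_derivs (x0 - 2 * r) (x0 + 2 * r) C N phi' ->
    (forall x, x0 - 2 * r < x < x0 + 2 * r -> k <= `|phi' x|) ->
    bounded_derivs (x0 - 2 * r) (x0 + 2 * r) D N f ->
    (forall x, r < `|x0 - x| -> f x = 0) ->
    forall la al : R, 0 < la ->
    `|\int[leb]_(x in setT) (f x * cos (la * phi x + al))| <= K / la ^+ N.
Proof.
move=> C0 k0 D0; have [K K0 HK] := nonstationary_phase N C0 k0 D0.
exists (2 * K); first by rewrite mulr_ge0.
move=> x0 r phi phi' f /andP[r0 r1] dphi bphi kphi bf f0 la al la0.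
have := HK (x0 - 2 * r) (x0 - 3 / 2 * r) (x0 - r) (x0 + r) (x0 + 3 / 2 * r) (x0 + 2 * r)
  phi phi' f.
do 5 (move=> /(_ ltac:(lra_ineq))).
move=> /(_ dphi bphi kphi bf).
have f0' x : x < x0 - r \/ x0 + r < x -> f x = 0.
  by move=> H; apply: f0; rewrite lter_normr; apply/orP; case: H => H; [left|right]; lra_ineq.
move=> /(_ (fun x _ => f0' x) la al la0) H.
have -> : \int[leb]_(x in setT) (f x * cos (la * phi x + al)) =
    \int[leb]_(x in `[x0 - 3 / 2 * r, x0 + 3 / 2 * r]) (f x * cos (la * phi x + al)).
  rewrite [RHS]Rintegral_mkcond; apply: eq_Rintegral => x _.
  rewrite patchE; case: ifPn => // /negP xI.
  rewrite f0' ?mul0r//; apply: contrapT => /not_orP[/negP h1 /negP h2]; apply: xI.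
  apply/mem_set; rewrite /= in_itv /=; move: h1 h2; rewrite -!leNgt => h1 h2.
  by apply/andP; split; lra_ineq.
have X0 : 0 <= K / la ^+ N by rewrite divr_ge0 ?exprn_ge0 ?(ltW la0).
apply: le_trans H _; rewrite -[X in _ <= X]mulrA; move: X0; move: (K / _) => X X0; nra.
Qed.

End LinePhase.

(** * Decay from a non-stationary direction *)

Section DirectionalDecay.
Context {R : realType} (p : nat).
Local Notation leb := (@lebesgue_measure R).
Variable L : {sigma_finite_measure set (borelRV R p) -> \bar R}.
Hypothesis Linv : forall w (A : set (borelRV R p)), measurable A -> L (shiftV w @^-1` A) = L A.
Hypothesis Lbox : forall r : R, 0 < r -> (0 < L (sup_box p r) < +oo)%E.
Variable c : 'rV[R]_p.

Lemma bounded_derivs_chain (a b C : R) (g : nat -> R -> R) (N k : nat) :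
  (forall i x, (k <= i)%N -> (i <= k + N)%N -> a < x < b ->
     is_derive x (1 : R) (g i) (g i.+1 x) /\ `|g i x| <= C) ->
  bounded_derivs a b C N (g k).
Proof.
elim: N k => [|N IH] k H.
  split => x xab; have [d1 b1] := H k x (leqnn _) (leq_addr _ _) xab => //.
  exact: is_derive_continuous d1.
split; first by move=> x xab; have [] := H k x (leqnn _) (leq_addr _ _) xab.
exists (g k.+1); first by move=> x xab; have [] := H k x (leqnn _) (leq_addr _ _) xab.
by apply: IH => i x ki iN xab; apply: H => //; lia.
Qed.

(** [Psi i] is the i-th derivative of the phase along the axis [J], on a ball twice as large as
    needed for the integral; the true phase [psi] has to agree with [Psi 0] only near the support of
    [f]. *)
Lemma directional_decay (N : nat) (C k D : R) : 0 <= C -> 0 < k -> 0 <= D ->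
  exists2 K : R, 0 <= K & forall (r : R) (J : 'I_p) (Psi : nat -> 'rV[R]_p -> R)
    (f psi : 'rV[R]_p -> R), 0 < r <= 2^-1 ->
  measurable_fun (setT : set (borelRV R p)) f ->
  measurable_fun (setT : set (borelRV R p)) psi ->
  (forall z, `|f z| <= 1) ->
  (forall (z : 'rV[R]_p) i, r < `|z 0 i - c 0 i| -> f z = 0) ->
  (forall z : 'rV[R]_p, bounded_derivs (c 0 J - z 0 J - 2 * r) (c 0 J - z 0 J + 2 * r) D N
     (fun s => f (z + s *: ev R J))) ->
  (forall i (z : 'rV[R]_p) s, (i <= N.+1)%N -> `|z + s *: ev R J - c| < 2 * r ->
     is_derive s (1 : R) (fun t => Psi i (z + t *: ev R J)) (Psi i.+1 (z + s *: ev R J))) ->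
  (forall i z, (i <= N)%N -> `|z - c| < 2 * r -> `|Psi i.+1 z| <= C) ->
  (forall z, `|z - c| < 2 * r -> k <= `|Psi 1%N z|) ->
  (forall z, `|z - c| <= r -> psi z = Psi 0%N z) ->
  forall la al : R, 0 < la ->
  `|\int[L]_z (f z * cos (la * psi z + al))| <= K / la ^+ N * fine (L (sup_box p (`|c| + 2))).
Proof.
move=> C0 k0 D0; have [K K0 HK] := line_phase N C0 k0 D0; exists K => //.
move=> r J Psi f psi r01 mf mpsi f1 f0 bf dPsi bPsi kPsi psiE la al la0.
have [r0 r1] := andP r01.
have -> : `|c| + 2 = (`|c| + 1) + 1 by ring.
have mcos : measurable_fun (setT : set R) (@cos R).
  exact: continuous_measurable_fun (@continuous_cos R).
have fs z : r < `|z - c| -> f z = 0.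
  move=> H; case: (pselect (exists i, r < `|z 0 i - c 0 i|)) => [[i Hi]|nH]; first exact: f0 Hi.
  move: H; rewrite ltNge => /negP[]; apply: normrV_le; first exact: ltW.
  by move=> i; rewrite !mxE leNgt; apply/negP => Hi; apply: nH; exists i.
apply: (@directional_bound _ _ L Linv Lbox (`|c| + 1) _ J 1) => //.
- apply: measurable_funM => //; apply: (measurableT_comp mcos).
  apply: measurable_funD; last exact: measurable_cst.
  by apply: measurable_funM => //; exact: measurable_cst.
- by move=> z; rewrite normrM -[leRHS]mulr1 ler_pM// cos_max.
- move=> z zc; rewrite fs ?mul0r//.
  by have := ler_normD (z - c) c; rewrite subrK => H; lra_ineq.
- by rewrite divr_ge0// exprn_ge0// ltW.
move=> z.
(* A line that misses the support in some other coordinate contributes nothing; on the remaining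
   lines only coordinate [J] varies. *)
case: (pselect (exists i, i != J /\ r < `|z 0 i - c 0 i|)) => [[i [iJ Hi]]|nH].
  have E (s : R) : f (z + s *: ev R J) * cos (la * psi (z + s *: ev R J) + al) = 0.
    by rewrite (f0 _ i) ?mul0r// !mxE (negbTE iJ) andbF mulr0 addr0.
  have -> : (fun s : R => f (z + s *: ev R J) * cos (la * psi (z + s *: ev R J) + al)) = fun=> 0.
    exact/funext.
  by rewrite Rintegral_cst// mul0r normr0 divr_ge0// exprn_ge0// ltW.
have zJ i : i != J -> `|z 0 i - c 0 i| <= r.
  by move=> iJ; rewrite leNgt; apply/negP => Hi; apply: nH; exists i.
pose x0 := c 0 J - z 0 J.
have near0 (s : R) : x0 - 2 * r < s < x0 + 2 * r -> `|z + s *: ev R J - c| < 2 * r.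
  move=> /andP[s1 s2]; apply: normrV_lt => [|i]; first lra_ineq.
  rewrite !mxE; have [->|iJ] := eqVneq i J.
    by rewrite !eqxx mulr1 ltr_norml; move: s1 s2; rewrite /x0 => s1 s2; apply/andP; split; lra_ineq.
  by rewrite andbF mulr0 addr0 (le_lt_trans (zJ i iJ))//; lra_ineq.
have -> : \int[leb]_s (f (z + (s : R) *: ev R J) * cos (la * psi (z + (s : R) *: ev R J) + al)) =
    \int[leb]_s (f (z + (s : R) *: ev R J) * cos (la * Psi 0%N (z + (s : R) *: ev R J) + al)).
  apply: eq_Rintegral => s _.
  have [zr|zr] := lerP `|z + (s : R) *: ev R J - c| r; first by rewrite psiE.
  by rewrite fs// !mul0r.
apply: (HK x0 r (fun s => Psi 0%N (z + s *: ev R J)) (fun s => Psi 1%N (z + s *: ev R J))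
  (fun s => f (z + s *: ev R J))) => //.
- by move=> s /near0; exact: dPsi.
- apply: (@bounded_derivs_chain _ _ _ (fun i s => Psi i (z + s *: ev R J)) N 1) => i s i1 iN.
  move=> /near0 H; split; first by apply: dPsi => //; lia.
  by case: i i1 iN => // i _ iN; apply: bPsi.
- by move=> s /near0; exact: kPsi.
- exact: bf.
- move=> s H; apply: (f0 _ J); rewrite !mxE !eqxx mulr1.
  by move: H; rewrite /x0 distrC; congr (_ < `| _ |); ring.
Qed.

End DirectionalDecay.

(** * Phases of the cone chart *)

Lemma leqS3 (i n : nat) : (i <= n)%N -> (i.+1 <= n.+3)%N /\ (i.+2 <= n.+3)%N.
Proof. by move=> H; split; lia. Qed.

Section ConeChart.
Context {R : realType} (m d : nat).
Variables (O : set 'rV[R]_m) (F : 'rV[R]_m -> 'rV[R]_d) (y0 : 'rV[R]_m) (r C : R) (N : nat).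
Hypothesis sF : smooth_on O F.
Hypothesis r01 : 0 < r <= 2^-1.
Hypothesis C0 : 0 <= C.
Hypothesis FC : forall y : 'rV[R]_m, `|y - y0| < 4 * r -> O y /\
  forall l, (size l <= N.+3)%N -> `|iter_partial l F y| <= C.

Definition hcoord (z : 'rV[R]_(m + 1)) : R := z 0 (rshift m ord0).
(** Height 3/2 keeps the enlarged support, of radius 2r <= 1, at heights of at least 1/2, away from
    the vertex. *)
Definition center : 'rV[R]_(m + 1) := row_mx y0 (const_mx (3 / 2)).
(** [F] is controlled only near [y0]; the value 0 elsewhere makes the map measurable everywhere and
    lies outside the support of the amplitude. *)
Definition chart_ext (y : 'rV[R]_m) : 'rV[R]_d := if `|y - y0| < 4 * r then F y else 0.
Definition conemap (z : borelRV R (m + 1)) : borelRV R (d + 1) :=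
  hcoord z *: row_mx (chart_ext (lsubmx (z : 'rV[R]_(m + 1)))) (const_mx 1).
Definition ylift (w : 'rV[R]_m) : 'rV[R]_(m + 1) := row_mx w 0.

Local Notation J j := (lshift 1 (j : 'I_m)).
Local Notation Jh := (rshift m (ord0 : 'I_1)).

Lemma lsubmx_center : lsubmx center = y0. Proof. exact: row_mxKl. Qed.
Lemma hcoord_center : hcoord center = 3 / 2. Proof. by rewrite /hcoord row_mxEr mxE. Qed.

Lemma lsubmx_norm_le n1 n2 (u : 'rV[R]_(n1 + n2)) : `|lsubmx u| <= `|u|.
Proof. by apply: normrV_le => // i; rewrite mxE; exact: coord_norm_le. Qed.

Lemma lsubmx_line_y (z : 'rV[R]_(m + 1)) s j :
  lsubmx (z + s *: ev R (J j)) = lsubmx z + s *: ev R j.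
Proof. by apply/rowP => i; rewrite !mxE (inj_eq (@lshift_inj _ _)). Qed.

Lemma hcoord_line_y (z : 'rV[R]_(m + 1)) s j : hcoord (z + s *: ev R (J j)) = hcoord z.
Proof. by rewrite /hcoord !mxE eq_rlshift andbF mulr0 addr0. Qed.

Lemma lsubmx_line_h (z : 'rV[R]_(m + 1)) s : lsubmx (z + s *: ev R Jh) = lsubmx z.
Proof. by apply/rowP => i; rewrite !mxE eq_lrshift andbF mulr0 addr0. Qed.

Lemma hcoord_line_h (z : 'rV[R]_(m + 1)) s : hcoord (z + s *: ev R Jh) = hcoord z + s.
Proof. by rewrite /hcoord !mxE !eqxx mulr1. Qed.

Lemma lsubmx_ylift (z : 'rV[R]_(m + 1)) w : lsubmx (z + ylift w) = lsubmx z + w.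
Proof. by rewrite linearD /= row_mxKl. Qed.

Lemma hcoord_ylift (z : 'rV[R]_(m + 1)) w : hcoord (z + ylift w) = hcoord z.
Proof. by rewrite /hcoord mxE row_mxEr mxE addr0. Qed.

Lemma lsubmx_near (z : 'rV[R]_(m + 1)) : `|lsubmx z - y0| <= `|z - center|.
Proof. by rewrite -{1}lsubmx_center -linearB; exact: lsubmx_norm_le. Qed.

Lemma hcoord_near (z : 'rV[R]_(m + 1)) : `|hcoord z - 3 / 2| <= `|z - center|.
Proof.
have := coord_norm_le (z - center) Jh; rewrite mxE [(- center) _ _]mxE.
by rewrite -[center 0 Jh]/(hcoord center) hcoord_center.
Qed.

Definition height_at (xi : 'rV[R]_(d + 1)) (x : 'rV[R]_d) : R :=
  dotv x (lsubmx xi) + xi 0 (rshift d ord0).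

Lemma dotv_conemap z xi :
  dotv (conemap z : 'rV[R]_(d + 1)) xi = hcoord z * height_at xi (chart_ext (lsubmx z)).
Proof.
rewrite /conemap dotvZl -{1}(hsubmxK xi) dotv_row_mx; congr (_ * (_ + _)).
by rewrite /dotv big_ord1 !mxE mul1r.
Qed.

Lemma chart_ext_measurable j :
  measurable_fun (setT : set (borelRV R m)) (fun y : 'rV[R]_m => chart_ext y 0 j).
Proof.
pose D : set (borelRV R m) := [set y : 'rV[R]_m | `|y - y0| < 4 * r].
have oD : open (D : set 'rV[R]_m).
  have -> : (D : set 'rV[R]_m) = ball y0 (4 * r).
    apply/seteqP; split => y; rewrite /D /= -ball_normE /ball_ /= distrC//.
  by apply: ball_open; case/andP: r01; lra_ineq.
have mD : measurable D by exact: open_measurable_rV.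
have mF : measurable_fun D (fun y : 'rV[R]_m => F y 0 j).
  apply: continuous_measurable_open => // y Dy.
  have [Oy _] := FC Dy.
  have [cF _] := sF [::] Oy.
  exact: (@continuous_comp _ _ _ F (fun x : 'rV[R]_d => x 0 j) y cF (@coord_continuous _ _ _ _ _ _)).
have -> : (fun y : 'rV[R]_m => chart_ext y 0 j) = (fun y : 'rV[R]_m => F y 0 j) \_ D.
  apply/funext => y; rewrite patchE /chart_ext.
  by case: ifPn => yD; [rewrite mem_set|rewrite memNset ?mxE//; exact/negP].
exact/(measurable_restrictT _ mD).
Qed.

Lemma lsubmx_measurable : measurable_fun (setT : set (borelRV R (m + 1)))
  ((fun z : 'rV[R]_(m + 1) => lsubmx z) : borelRV R (m + 1) -> borelRV R m).
Proof.
by apply: measurable_rV_coord => i; under eq_fun do rewrite mxE; exact: coord_measurable.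
Qed.

Lemma conemap_measurable : measurable_fun setT conemap.
Proof.
apply: measurable_rV_coord => i; case: (split_ordP i) => j ->.
  under eq_fun do rewrite /conemap mxE row_mxEl.
  apply: measurable_funM; first exact: coord_measurable.
  exact: measurableT_comp (@chart_ext_measurable j) lsubmx_measurable.
under eq_fun do rewrite /conemap mxE row_mxEr mxE mulr1.
exact: coord_measurable.
Qed.

Lemma conemap_dotv_measurable xi : measurable_fun (setT : set (borelRV R (m + 1)))
  (fun z => dotv (conemap z : 'rV[R]_(d + 1)) xi).
Proof. exact: measurableT_comp (dotv_measurable xi) conemap_measurable. Qed.

Variable L : {sigma_finite_measure set (borelRV R (m + 1)) -> \bar R}.
Hypothesis Linv : forall w (A : set (borelRV R (m + 1))),
  measurable A -> L (shiftV w @^-1` A) = L A.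
Hypothesis Lbox : forall rho : R, 0 < rho -> (0 < L (sup_box (m + 1) rho) < +oo)%E.

Local Notation a := (amp N r center).
Local Notation V := (fine (L (sup_box (m + 1) (`|center| + 2)))).

Lemma hcoord_bounds (z : 'rV[R]_(m + 1)) : `|z - center| < 2 * r -> 2^-1 <= hcoord z <= 3.
Proof.
case/andP: r01 => r0 r1 /(le_lt_trans (hcoord_near z)).
by rewrite ltr_norml => /andP[h1 h2]; apply/andP; split; lra_ineq.
Qed.

Lemma is_derive_chart_line l j xi y (s : R) : `|y + s *: ev R j - y0| < 4 * r ->
  is_derive s (1 : R) (fun t => dotv (iter_partial l F (y + t *: ev R j)) xi)
    (dotv (iter_partial (j :: l) F (y + s *: ev R j)) xi).
Proof.
move=> /FC[Oy _]; have D := is_derive_iter_partial xi l j sF Oy.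
have [D1 D2] := D; have := is_derive_along D1; rewrite D2; exact.
Qed.

Lemma iter_partial_dotv_le l xi y : (size l <= N.+3)%N -> `|xi| <= 1 -> `|y - y0| < 4 * r ->
  `|dotv (iter_partial l F y) xi| <= d%:R * C.
Proof.
move=> lN xi1 /FC[_ H]; rewrite (le_trans (dotv_norm_le _ _))//.
by rewrite -mulrA ler_wpM2l// -[leRHS]mulr1 ler_pM// H.
Qed.

(** One constant serves all three ways to be non-stationary, all [xi] in the unit ball and all
    shifts [w]; the sum over pairs of shifts relies on this. *)
Lemma cone_phase (k : R) : 0 < k -> exists2 K : R, 0 <= K &
  forall xi : 'rV[R]_(d + 1), `|xi| <= 1 ->
  [/\ (forall y, `|y - y0| < 4 * r -> k <= `|height_at xi (F y)|) ->
      forall la al : R, 0 < la ->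
      `|\int[L]_z (a z * cos (la * dotv (conemap z : 'rV[R]_(d + 1)) xi + al))| <= K / la ^+ N * V,
      forall j, (forall y, `|y - y0| < 4 * r -> k <= `|dotv (partial j F y) (lsubmx xi)|) ->
      forall la al : R, 0 < la ->
      `|\int[L]_z (a z * cos (la * dotv (conemap z : 'rV[R]_(d + 1)) xi + al))| <= K / la ^+ N * V &
      forall (w : 'rV[R]_m) j, 0 < `|w| <= r ->
      (forall y, `|y - y0| < 2 * r ->
         k * `|w| <= `|dotv (partial j F (y + w) - partial j F y) (lsubmx xi)|) ->
      forall la : R, 0 < la ->
      `|\int[L]_z (a ((z : 'rV[R]_(m + 1)) + ylift w) * a z *
          cos (la * dotv (conemap ((z : 'rV[R]_(m + 1)) + ylift w) : 'rV[R]_(d + 1)) xi -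
               la * dotv (conemap z : 'rV[R]_(d + 1)) xi))| <= K / (la * `|w|) ^+ N * V].
Proof.
move=> k0; have [r0 r1] := andP r01.
set B := @bump_const R N; have B0 : 0 <= B by exact: bump_const_ge0.
(* 3 bounds the height, m + 1 covers the mean value estimate for a differenced phase, and the final
   1 bounds the last coordinate of [xi]. *)
pose C1 : R := 3 * ((m.+1)%:R * (d%:R * C) + 1).
(* Covers both the amplitude and the product of the amplitude with a translate. *)
pose D1 : R := B + 2 ^+ N * (B * B).
have dC0 : 0 <= d%:R * C by rewrite mulr_ge0.
have mdC : d%:R * C <= (m.+1)%:R * (d%:R * C) by rewrite ler_peMl// ler1n.
have mdC' : m%:R * (d%:R * C) <= (m.+1)%:R * (d%:R * C) by rewrite ler_wpM2r// ler_nat.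
have mdC0 : 0 <= (m.+1)%:R * (d%:R * C) by rewrite mulr_ge0.
have C10 : 0 <= C1 by rewrite /C1; lra_ineq.
have BB0 : 0 <= 2 ^+ N * (B * B) by rewrite !(mulr_ge0, exprn_ge0).
have D10 : 0 <= D1 by rewrite /D1 addr_ge0.
have k20 : 0 < k / 2 by lra_ineq.
have [K K0 HK] := directional_decay Linv Lbox center N C10 k20 D10.
exists K => // xi xi1.
have xil : `|lsubmx xi| <= 1 by exact: le_trans (lsubmx_norm_le xi) xi1.
have xih : `|xi 0 (rshift d ord0)| <= 1 by exact: le_trans (coord_norm_le xi _) xi1.
have ma := @amp_measurable R N r (m + 1) center.
have a1 := amp_norm N r01 center.
have a0 := @amp_coord_eq0 R N r (m + 1) center.
have ba (j : 'I_(m + 1)) (z : 'rV[R]_(m + 1)) (v : R) : `|v| <= r ->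
   forall z' : 'rV[R]_(m + 1), z' 0 j = z 0 j + v ->
   bounded_derivs (center 0 j - z 0 j - 2 * r) (center 0 j - z 0 j + 2 * r) B N
     (fun s => a (z' + s *: ev R j)).
  move=> vr z' Ez; apply: bounded_derivs_amp => // s /andP[s1 s2]; rewrite Ez.
  by move: vr; rewrite !ler_norml => /andP[v1 v2]; apply/andP; split; lra_ineq.
have ba0 (j : 'I_(m + 1)) (z : 'rV[R]_(m + 1)) :
   bounded_derivs (center 0 j - z 0 j - 2 * r) (center 0 j - z 0 j + 2 * r) D1 N
     (fun s => a (z + s *: ev R j)).
  apply: (@bounded_derivs_le _ _ _ B); first by rewrite /D1 lerDl.
  by apply: (ba j z 0); rewrite ?normr0 ?addr0// ltW.
have near4 (z : 'rV[R]_(m + 1)) : `|z - center| < 2 * r -> `|lsubmx z - y0| < 2 * r.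
  exact: le_lt_trans (lsubmx_near z).
have extE (y : 'rV[R]_m) : `|y - y0| < 4 * r -> chart_ext y = F y by rewrite /chart_ext => ->.
split.
- move=> Hk la al la0.
  pose Psi (i : nat) (z : 'rV[R]_(m + 1)) : R :=
    match i with 0%N => hcoord z * height_at xi (F (lsubmx z))
               | 1%N => height_at xi (F (lsubmx z)) | _ => 0 end.
  apply: (HK r Jh Psi) => //.
  + exact: conemap_dotv_measurable.
  + move=> [|[|i]] z s _ _ /=.
    * under eq_fun do rewrite lsubmx_line_h hcoord_line_h.
      rewrite lsubmx_line_h; set q := height_at _ _.
      have -> : (fun t : R => (hcoord z + t) * q) = (fun t => q * t + hcoord z * q).
        by apply/funext => t; ring.
      exact: is_derive_affine.
    * under eq_fun do rewrite lsubmx_line_h; exact: is_derive_cst.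
    * exact: is_derive_cst.
  + move=> [|i] z _ /near4 zr /=; last by rewrite normr0.
    rewrite /height_at (le_trans (ler_normD _ _))//.
    have := @iter_partial_dotv_le [::] (lsubmx xi) (lsubmx z) isT xil.
    by move=> /(_ ltac:(lra_ineq)) /=; rewrite /C1; lra_ineq.
  + move=> z /near4 zr /=; rewrite (le_trans _ (Hk _ _))//; lra_ineq.
  + move=> z zr /=; rewrite dotv_conemap extE//.
    by rewrite (le_lt_trans (lsubmx_near z))//; lra_ineq.
- move=> j Hk la al la0.
  pose Psi (i : nat) (z : 'rV[R]_(m + 1)) : R :=
    hcoord z * (dotv (iter_partial (nseq i j) F (lsubmx z)) (lsubmx xi) +
                (if i is 0%N then xi 0 (rshift d ord0) else 0)).
  apply: (HK r (J j) Psi) => //.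
  + exact: conemap_dotv_measurable.
  + move=> i z s _ zr; rewrite /Psi.
    under eq_fun do rewrite lsubmx_line_y hcoord_line_y.
    rewrite lsubmx_line_y hcoord_line_y.
    have zs : `|lsubmx z + s *: ev R j - y0| < 4 * r.
      by rewrite -lsubmx_line_y; have := near4 _ zr; lra_ineq.
    have D := is_deriveZ (hcoord z) (is_deriveD
      (is_derive_chart_line (nseq i j) (lsubmx xi) zs)
      (is_derive_cst (if i is 0%N then xi 0 (rshift d ord0) else 0) s (1 : R))).
    by apply: (is_derive_eq D).
  + move=> i z iN zr; rewrite /Psi addr0 normrM.
    have /andP[h1 h2] := hcoord_bounds zr.
    have := @iter_partial_dotv_le (nseq i.+1 j) (lsubmx xi) (lsubmx z).
    rewrite size_nseq => /(_ (leqS3 iN).1 xil); have := near4 _ zr => zr' /(_ ltac:(lra_ineq)) H.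
    rewrite (@le_trans _ _ (3 * (d%:R * C)))//; last by rewrite /C1; lra_ineq.
    by apply: ler_pM => //; rewrite ger0_norm//; lra_ineq.
  + move=> z zr; rewrite /Psi addr0 normrM.
    have /andP[h1 h2] := hcoord_bounds zr.
    have := near4 _ zr => zr'; have := Hk (lsubmx z) ltac:(lra_ineq) => H.
    have h3 : 2^-1 <= `|hcoord z| by rewrite ger0_norm//; lra_ineq.
    by rewrite [k / 2]mulrC; apply: ler_pM; [rewrite invr_ge0|exact: ltW|exact: h3|exact: H].
  + move=> z zr /=; rewrite dotv_conemap extE//.
    by rewrite (le_lt_trans (lsubmx_near z))//; lra_ineq.
move=> w j /andP[w0 wr] Hk la la0.
have wr' (y : 'rV[R]_m) : `|y - y0| < 2 * r -> `|y + w - y0| < 4 * r.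
  by move=> yr; rewrite addrAC (le_lt_trans (ler_normD _ _))//; lra_ineq.
(* Dividing the phase difference by |w| bounds its derivatives independently of [w]; the large
   parameter becomes la |w|. *)
pose Psi (i : nat) (z : 'rV[R]_(m + 1)) : R := hcoord z *
  (`|w|^-1 * (dotv (iter_partial (nseq i j) F (lsubmx z + w)) (lsubmx xi) -
              dotv (iter_partial (nseq i j) F (lsubmx z)) (lsubmx xi))).
pose psi (z : 'rV[R]_(m + 1)) : R := `|w|^-1 *
  (dotv (conemap (z + ylift w) : 'rV[R]_(d + 1)) xi - dotv (conemap z : 'rV[R]_(d + 1)) xi).
have lw0 : 0 < la * `|w| by rewrite mulr_gt0.
have := HK r (J j) Psi (fun z => a (z + ylift w) * a z) psi r01.
have mshift g : measurable_fun (setT : set (borelRV R (m + 1))) g ->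
    measurable_fun (setT : set (borelRV R (m + 1))) (fun z : 'rV[R]_(m + 1) => g (z + ylift w) : R).
  move=> mg; exact: measurableT_comp mg (@shiftV_measurable R (m + 1) (ylift w)).
move=> /(_ _ _ _ _ _ _ _ _ _ (la * `|w|) 0 lw0) H.
have -> : \int[L]_z (a ((z : 'rV[R]_(m + 1)) + ylift w) * a z *
     cos (la * dotv (conemap ((z : 'rV[R]_(m + 1)) + ylift w) : 'rV[R]_(d + 1)) xi -
          la * dotv (conemap z : 'rV[R]_(d + 1)) xi)) =
   \int[L]_z (a ((z : 'rV[R]_(m + 1)) + ylift w) * a z * cos (la * `|w| * psi z + 0)).
  apply: eq_Rintegral => z _; congr (_ * cos _); rewrite addr0 /psi -mulrBr.
  by rewrite mulrA -[la * _ / _]mulrA mulfV ?mulr1// gt_eqF.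
apply: H.
- by apply: measurable_funM => //; exact: mshift.
- apply: measurable_funM; first exact: measurable_cst.
  have mc := conemap_dotv_measurable xi; exact: measurable_funB (mshift _ mc) mc.
- by move=> z; rewrite normrM -[leRHS]mulr1 ler_pM// a1.
- by move=> z i /a0 ->; rewrite mulr0.
- move=> z; apply: (@bounded_derivs_le _ _ _ (2 ^+ N * (B * B))); first by rewrite /D1 lerDr.
  have -> : (fun s => a (z + s *: ev R (J j) + ylift w) * a (z + s *: ev R (J j))) =
     (fun s => a ((z + ylift w) + s *: ev R (J j)) * a (z + s *: ev R (J j))).
    by apply/funext => s; rewrite addrAC.
  apply: bounded_derivsM => //.
    apply: (ba (J j) z (w 0 j)); first exact: le_trans (coord_norm_le _ _) wr.
    by rewrite mxE row_mxEl.
  by apply: (ba (J j) z 0); rewrite ?normr0 ?addr0// ltW.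
- move=> i z s _ zr; rewrite /Psi.
  under eq_fun do rewrite lsubmx_line_y hcoord_line_y.
  rewrite lsubmx_line_y hcoord_line_y.
  have zs : `|lsubmx z + s *: ev R j - y0| < 2 * r by rewrite -lsubmx_line_y; exact: near4.
  have zs4 : `|lsubmx z + s *: ev R j - y0| < 4 * r by lra_ineq.
  have zw4 : `|(lsubmx z + w) + s *: ev R j - y0| < 4 * r by rewrite [_ + w + _]addrAC; exact: wr'.
  have D := is_deriveZ (hcoord z) (is_deriveZ `|w|^-1 (is_deriveB
      (is_derive_chart_line (nseq i j) (lsubmx xi) zw4)
      (is_derive_chart_line (nseq i j) (lsubmx xi) zs4))).
  have -> : (fun t : R => hcoord z * (`|w|^-1 * (dotv (iter_partial (nseq i j) F (lsubmx z + t *: ev R j + w)) (lsubmx xi) -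
      dotv (iter_partial (nseq i j) F (lsubmx z + t *: ev R j)) (lsubmx xi)))) =
     (fun t : R => hcoord z * (`|w|^-1 * (dotv (iter_partial (nseq i j) F (lsubmx z + w + t *: ev R j)) (lsubmx xi) -
      dotv (iter_partial (nseq i j) F (lsubmx z + t *: ev R j)) (lsubmx xi)))).
    by apply/funext => t; rewrite [_ + w + _]addrAC.
  apply: (is_derive_eq D); rewrite /GRing.scale /=.
  by rewrite [_ + w + _]addrAC.
- move=> i z iN zr; rewrite /Psi normrM.
  have /andP[h1 h2] := hcoord_bounds zr; have := near4 _ zr => zr'.
  rewrite (@le_trans _ _ (3 * (m%:R * (d%:R * C))))//; last by rewrite /C1; lra_ineq.
  apply: ler_pM => //; first by rewrite ger0_norm//; lra_ineq.
  rewrite normrM normfV normr_id mulrC ler_pdivrMr// -dotvBl.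
  have := @iter_partial_lipschitz R m d O F (lsubmx xi) (nseq i.+1 j) (lsubmx z + w) (lsubmx z)
    (d%:R * C) sF.
  rewrite addrAC subrr add0r; apply => z' z'w.
  have z'4 : `|z' - y0| < 4 * r.
    have := ler_normD (z' - lsubmx z) (lsubmx z - y0); rewrite addrA subrK; lra_ineq.
  split; first by have [] := FC z'4.
  by move=> i'; apply: iter_partial_dotv_le => //=; rewrite size_nseq; exact: (leqS3 iN).2.
- move=> z zr; rewrite /Psi normrM.
  have /andP[h1 h2] := hcoord_bounds zr; have := near4 _ zr => zr'.
  have h3 : 2^-1 <= `|hcoord z| by rewrite ger0_norm//; lra_ineq.
  rewrite [k / 2]mulrC; apply: ler_pM; [by rewrite invr_ge0|exact: ltW|exact: h3|].
  rewrite normrM normfV normr_id mulrC ler_pdivlMr// -dotvBl.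
  exact: Hk.
- move=> z zr; rewrite /psi /Psi !dotv_conemap lsubmx_ylift hcoord_ylift.
  have zr' : `|lsubmx z - y0| < 2 * r.
    by rewrite (le_lt_trans (lsubmx_near z))//; lra_ineq.
  rewrite !extE; [|lra_ineq|exact: wr'].
  by rewrite /height_at /=; ring.
Qed.

End ConeChart.

(** * Consequences of non-vanishing curvature *)

Section Nondegenerate.
Context {R : realType}.

Lemma continuous_bigsum (T : topologicalType) (I : Type) (s : seq I) (f : I -> T -> R) :
  (forall i, continuous (f i)) -> continuous (fun x => \sum_(i <- s) f i x).
Proof.
move=> cf; elim: s => [|i s IH] x.
  by under eq_fun do rewrite big_nil; exact: cst_continuous.
by under eq_fun do rewrite big_cons; apply: continuousD; [exact: cf|exact: IH].
Qed.

Lemma sphere_compact n : compact [set v : 'rV[R]_n | `|v| = 1].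
Proof.
apply: bounded_closed_compact.
  exists 1; split; first exact: num_real.
  by move=> M M1 v /= ->; exact: ltW.
have -> : [set v : 'rV[R]_n | `|v| = 1] = (fun v : 'rV[R]_n => `|v|) @^-1` [set 1] by [].
apply: preimage_closed; last exact: closed_eq.
by move=> v _; exact: norm_continuous.
Qed.

Lemma dotvr0 n (u : 'rV[R]_n) : dotv u 0 = 0.
Proof. by rewrite /dotv big1// => i _; rewrite [X in _ * X]mxE mulr0. Qed.

Context (m d : nat).
Variables (F : 'rV[R]_m -> 'rV[R]_d) (y0 : 'rV[R]_m).

Lemma height_atE (xi : 'rV[R]_(d + 1)) x : height_at xi x = dotv xi (row_mx x (const_mx 1)).
Proof.
rewrite -{2}(hsubmxK xi) dotv_row_mx dotvC; congr (_ + _).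
by rewrite /dotv big_ord1 !mxE mulr1.
Qed.

Lemma dotv_lsubmx (xi : 'rV[R]_(d + 1)) x : dotv x (lsubmx xi) = dotv xi (row_mx x 0).
Proof.
rewrite -[X in dotv X (row_mx _ _)](hsubmxK xi) dotv_row_mx dotvC.
by rewrite dotvr0 addr0.
Qed.

Hypothesis ndeg : forall nu : 'rV[R]_d, nu != 0 ->
  (forall i, dotv (partial i F y0) nu = 0) -> \det (second_ff F y0 nu) != 0.

Let hess (xi : 'rV[R]_(d + 1)) (w : 'rV[R]_m) j : R :=
  \sum_i w 0 i * dotv (partial i (partial j F) y0) (lsubmx xi).

(** Zero exactly when each kind of non-stationarity fails; as a continuous function it attains its
    minimum on a product of unit spheres. *)
Let total (v : 'rV[R]_(d + 1) * 'rV[R]_m) : R :=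
  `|height_at v.1 (F y0)| + \sum_i `|dotv (partial i F y0) (lsubmx v.1)| +
  \sum_j `|hess v.1 v.2 j|.

Let total_continuous : continuous total.
Proof.
have c1 (u : 'rV[R]_(d + 1)) :
    continuous (fun v : 'rV[R]_(d + 1) * 'rV[R]_m => dotv v.1 u).
  move=> v; apply: (@continuous_comp _ _ _ fst (fun x : 'rV[R]_(d + 1) => dotv x u)).
    exact: cvg_fst.
  exact: dotv_continuous.
have c2 i : continuous (fun v : 'rV[R]_(d + 1) * 'rV[R]_m => v.2 0 i).
  move=> v; apply: (@continuous_comp _ _ _ snd (fun x : 'rV[R]_m => x 0 i)).
    exact: cvg_snd.
  exact: coord_continuous.
have cn (f : 'rV[R]_(d + 1) * 'rV[R]_m -> R) : continuous f -> continuous (fun v => `|f v|).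
  by move=> cf v; apply: (@continuous_comp _ _ _ f (fun x : R => `|x|)); [exact: cf|exact: norm_continuous].
have cA : continuous (fun v : 'rV[R]_(d + 1) * 'rV[R]_m => `|height_at v.1 (F y0)|).
  have := cn _ (c1 (row_mx (F y0) (const_mx 1))).
  by under eq_fun do rewrite -height_atE.
have cB : continuous (fun v : 'rV[R]_(d + 1) * 'rV[R]_m =>
    \sum_i `|dotv (partial i F y0) (lsubmx v.1)|).
  apply: continuous_bigsum => i; have := cn _ (c1 (row_mx (partial i F y0) 0)).
  by under eq_fun do rewrite -dotv_lsubmx.
have cC : continuous (fun v : 'rV[R]_(d + 1) * 'rV[R]_m => \sum_j `|hess v.1 v.2 j|).
  apply: continuous_bigsum => j; apply: cn; apply: continuous_bigsum => i v.
  have c3 : continuous (fun v : 'rV[R]_(d + 1) * 'rV[R]_m =>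
      dotv (partial i (partial j F) y0) (lsubmx v.1)).
    have := c1 (row_mx (partial i (partial j F) y0) 0).
    by under eq_fun do rewrite -dotv_lsubmx.
  exact: continuousM (c2 i v) (c3 v).
by move=> v; exact: continuousD (continuousD (cA v) (cB v)) (cC v).
Qed.

(** At a zero, either [lsubmx xi] is 0 and the height term kills the last coordinate too, or it is a
    normal at [y0] and the invertible second fundamental form forces w = 0. *)
Let total_gt0 xi w : `|xi| = 1 -> `|w| = 1 -> 0 < total (xi, w).
Proof.
move=> xi1 w1.
have B0 : 0 <= \sum_i `|dotv (partial i F y0) (lsubmx xi)| by exact: sumr_ge0.
have C0 : 0 <= \sum_j `|hess xi w j| by exact: sumr_ge0.
rewrite lt_def !addr_ge0// andbT; apply/negP.
rewrite /total /= !paddr_eq0 ?addr_ge0// => /andP[/andP[/eqP/normr0_eq0 A /eqP B] /eqP C].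
have B' i : dotv (partial i F y0) (lsubmx xi) = 0.
  by apply/normr0_eq0; move: B => /psumr_eq0P/(_ i isT); apply.
have C' j : hess xi w j = 0.
  by apply/normr0_eq0; move: C => /psumr_eq0P/(_ j isT); apply.
have [xil|xil] := eqVneq (lsubmx xi) 0.
  have xi0 : xi = 0.
    apply/rowP => i; rewrite [RHS]mxE; case: (split_ordP i) => j ->.
      by have := congr1 (fun u : 'rV[R]_d => u 0 j) xil; rewrite !mxE.
    move: A; rewrite /height_at xil (ord1 j).
    by rewrite dotvr0 add0r.
  by move: xi1; rewrite xi0 normr0 => /esym/eqP; rewrite oner_eq0.
have := ndeg xil B'; rewrite -unitfE -unitmxE => U.
have wM : w *m second_ff F y0 (lsubmx xi) = 0.
  apply/rowP => j; rewrite !mxE -[RHS](C' j) /hess.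
  by apply: eq_bigr => i _; rewrite mxE.
have : w = 0 by rewrite -[w](mulmxK U) wM mul0mx.
by move=> w0; move: w1; rewrite w0 normr0 => /esym/eqP; rewrite oner_eq0.
Qed.

Lemma nondegenerate_lower_bound : exists2 k : R, 0 < k &
  forall (xi : 'rV[R]_(d + 1)) (w : 'rV[R]_m), `|xi| = 1 -> `|w| = 1 ->
  [\/ k <= `|height_at xi (F y0)|, exists i, k <= `|dotv (partial i F y0) (lsubmx xi)| |
      exists j, k <= `|\sum_i w 0 i * dotv (partial i (partial j F) y0) (lsubmx xi)|].
Proof.
pose K := [set xi : 'rV[R]_(d + 1) | `|xi| = 1] `*` [set w : 'rV[R]_m | `|w| = 1].
(* The product of spheres is empty when [m] is 0; any constant then works. *)
have [K0|K0] := pselect (K !=set0); last first.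
  by exists 1 => // xi w xi1 w1; exfalso; apply: K0; exists (xi, w).
have cK : compact K by apply: compact_setX; exact: sphere_compact.
have [c cK' Hc] := compact_EVT_min K0 cK (continuous_subspaceT total_continuous).
have [c1 c2] := set_mem cK'.
have t0 : 0 < total c by have := total_gt0 c1 c2; rewrite -surjective_pairing.
have n0 : 0 < 2 * m%:R + 1 :> R by rewrite ltr_wpDl// mulr_ge0.
exists (total c / (2 * m%:R + 1)); first exact: divr_gt0.
move=> xi w xi1 w1; set k := total c / _.
apply: contrapT => nO.
have nA : ~~ (k <= `|height_at xi (F y0)|) by apply/negP => H; apply: nO; exact: Or31.
have nB : ~ exists i, k <= `|dotv (partial i F y0) (lsubmx xi)|.
  by move=> H; apply: nO; exact: Or32.
have nC : ~ exists j, k <= `|hess xi w j| by move=> H; apply: nO; exact: Or33.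
have H : total c <= total (xi, w) by apply: Hc; exact/mem_set.
have : total (xi, w) < k + m%:R * k + m%:R * k.
  rewrite /total /=; apply: ltr_leD; first apply: ltr_leD.
  - by rewrite ltNge.
  - rewrite mulr_natl -[X in k *+ X](card_ord m) -sumr_const; apply: ler_sum => i _.
    by rewrite leNgt; apply/negP => /ltW Hi; apply: nB; exists i.
  - rewrite mulr_natl -[X in k *+ X](card_ord m) -sumr_const; apply: ler_sum => j _.
    by rewrite leNgt; apply/negP => /ltW Hi; apply: nC; exists j.
apply/negP; rewrite -leNgt; apply: le_trans H; rewrite le_eqVlt; apply/orP; left; apply/eqP.
have -> : k + m%:R * k + m%:R * k = k * (2 * m%:R + 1) by ring.
by rewrite /k divfK// gt_eqF.
Qed.

(** Half of the constant at [y0] survives on a small ball. In the last case the coordinate [j]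
    depends on [w] but not on [y], so a single direction of integration serves each shift. *)
Lemma nondegenerate_near (O : set 'rV[R]_m) (N : nat) (r1 : R) :
  open O -> smooth_on O F -> O y0 -> 0 < r1 ->
  exists r C k : R, [/\ 0 < r <= 2^-1, 4 * r <= r1, 0 <= C, 0 < k &
  (forall y : 'rV[R]_m, `|y - y0| < 4 * r -> O y /\
    forall l, (size l <= N.+3)%N -> `|iter_partial l F y| <= C) /\
  forall xi : 'rV[R]_(d + 1), `|xi| = 1 ->
  [\/ forall y, `|y - y0| < 4 * r -> k <= `|height_at xi (F y)|,
      exists j, forall y, `|y - y0| < 4 * r -> k <= `|dotv (partial j F y) (lsubmx xi)| |
      forall w : 'rV[R]_m, 0 < `|w| <= r -> exists j, forall y, `|y - y0| < 2 * r ->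
        k * `|w| <= `|dotv (partial j F (y + w) - partial j F y) (lsubmx xi)|]].
Proof.
move=> oO sF Oy0 r10; have [k k0 Hk] := nondegenerate_lower_bound.
(* Makes both the variation d e of a dot product and the Lipschitz constant m d e used below at most
   k/2. *)
pose e := k / (2 * ((m.+1)%:R * (d.+1)%:R)).
have n0 : 0 < (m.+1)%:R * (d.+1)%:R :> R by rewrite mulr_gt0.
have e0 : 0 < e by rewrite divr_gt0// mulr_gt0.
have Ee : (m.+1)%:R * ((d.+1)%:R * e) = k / 2.
  by rewrite /e mulrA; move: (_ * _) n0 => x x0; field; rewrite gt_eqF.
have de0 : 0 <= d%:R * e by rewrite mulr_ge0// ltW.
have dde : d%:R * e <= (d.+1)%:R * e by rewrite ler_wpM2r ?ltW// ltr_nat.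
have mde : m%:R * (d%:R * e) <= k / 2.
  by rewrite -Ee ler_pM// ler_nat.
have de : d%:R * e <= k / 2.
  by rewrite -Ee (le_trans dde)// ler_peMl ?ler1n// mulr_ge0// ltW.
have [r' r'0 Hr'] := smooth_on_ball N.+3 oO sF Oy0 e0.
have [C C0 HC] := iter_partial_bound F y0 N.+3.
pose r := Num.min 2^-1 (Num.min (r' / 4) (r1 / 4)).
have r0 : 0 < r by rewrite !lt_min invr_gt0 !divr_gt0// ltr0n.
have rr' : 4 * r <= r'.
  have : r <= r' / 4 by rewrite !ge_min lexx orbT.
  lra_ineq.
have rr1 : 4 * r <= r1.
  have : r <= r1 / 4 by rewrite !ge_min lexx !orbT.
  lra_ineq.
have Hr (y : 'rV[R]_m) : `|y - y0| < 4 * r -> O y /\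
    forall l, (size l <= N.+3)%N -> `|iter_partial l F y - iter_partial l F y0| <= e.
  by move=> yr; apply: Hr'; apply: lt_le_trans rr'.
exists r, (C + e), (k / 2); split => //.
- by rewrite r0 ge_min lexx.
- by rewrite addr_ge0// ltW.
- by rewrite divr_gt0.
split.
  move=> y /Hr[Oy Hy]; split => // l lN.
  rewrite -[iter_partial l F y](subrK (iter_partial l F y0)) (le_trans (ler_normD _ _))//.
  by rewrite addrC lerD// ?HC// Hy.
move=> xi xi1.
have xil : `|lsubmx xi| <= 1 by rewrite -xi1; exact: lsubmx_norm_le.
have close l y : (size l <= N.+3)%N -> `|y - y0| < 4 * r ->
    `|dotv (iter_partial l F y) (lsubmx xi) - dotv (iter_partial l F y0) (lsubmx xi)| <= d%:R * e.
  move=> lN yr; rewrite -dotvBl (le_trans (dotv_norm_le _ _))//.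
  have [_ /(_ l lN) Hl] := Hr y yr.
  by rewrite -mulrA ler_wpM2l// -[leRHS]mulr1 ler_pM.
have [A|nA] := lerP k `|height_at xi (F y0)|.
  apply: Or31 => y yr; have := close [::] y isT yr.
  rewrite (_ : dotv _ _ - _ = height_at xi (F y) - height_at xi (F y0)); last first.
    by rewrite /height_at /=; ring.
  by move: (height_at xi (F y)) A => q A H; have := lerB_dist (height_at xi (F y0)) q;
    rewrite distrC => H'; lra_ineq.
have [[j B]|nB] := pselect (exists i, k <= `|dotv (partial i F y0) (lsubmx xi)|).
  apply: Or32; exists j => y yr; have := close [:: j] y isT yr => /=.
  move: (dotv (partial j F y) _) B => q B H.
  by have := lerB_dist (dotv (partial j F y0) (lsubmx xi)) q; rewrite distrC => H'; lra_ineq.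
apply: Or33 => w /andP[w0 wr].
have w1 : `| (`|w|^-1) *: w | = 1 by rewrite normrZ normfV normr_id mulVf// gt_eqF.
have [|//|[j Cj]] := Hk xi (`|w|^-1 *: w) xi1 w1; first by rewrite leNgt nA.
exists j => y yr.
pose q : 'rV[R]_m := \row_i dotv (partial i (partial j F) y0) (lsubmx xi).
have Cw : k * `|w| <= `|dotv w q|.
  have E : \sum_i (`|w|^-1 *: w) 0 i * dotv (partial i (partial j F) y0) (lsubmx xi) =
      `|w|^-1 * dotv w q.
    by rewrite /dotv mulr_sumr; apply: eq_bigr => i _; rewrite !mxE mulrA.
  by move: Cj; rewrite E normrM normfV normr_id ler_pdivlMl// mulrC.
pose g (z : 'rV[R]_m) := dotv (partial j F z) (lsubmx xi) - dotv z q.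
have Hg : `|g (y + w) - g y| <= m%:R * (d%:R * e) * `|w|.
  have -> : `|w| = `|y + w - y| by rewrite addrAC subrr add0r.
  apply: partial_lipschitz => z zy i.
  have zr : `|z - y0| < 4 * r.
    have := ler_normD (z - y) (y - y0); rewrite addrA subrK.
    move: zy; rewrite addrAC subrr add0r; lra_ineq.
  have [Oz _] := Hr z zr.
  have D1 := is_derive_iter_partial (lsubmx xi) [:: j] i sF Oz.
  have D2 : is_derive z (ev R i) (fun z : 'rV[R]_m => dotv z q) (q 0 i).
    have D := @is_derive_dotv R m m id z (ev R i) q (@derivable_id _ _ _ _).
    by apply: (is_derive_eq D); rewrite derive_id dotvC ev_coord.
  have [D3 D4] := is_deriveB D1 D2.
  split; first exact: D3.
  have -> : 'D_(ev R i) g z = dotv (iter_partial [:: i; j] F z) (lsubmx xi) - q 0 i := D4.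
  by rewrite mxE; exact: (close [:: i; j]).
have E : dotv w q = dotv (partial j F (y + w) - partial j F y) (lsubmx xi) - (g (y + w) - g y).
  by rewrite /g [dotv (y + w) q]dotvDl dotvBl; ring.
have := ler_normB (dotv (partial j F (y + w) - partial j F y) (lsubmx xi)) (g (y + w) - g y).
rewrite -E => H.
have : m%:R * (d%:R * e) * `|w| <= k / 2 * `|w| by rewrite ler_wpM2r// ltW.
by rewrite (_ : k / 2 * `|w| = k * `|w| / 2); [lra_ineq|ring].
Qed.

End Nondegenerate.

(** * Decay of the oscillatory integral *)

Section Powers.
Context {R : realType}.

(** q^2 = x^-s is the goal for the squared integral. A grid of T^m shifts meets it exactly on the
    diagonal, and [N] is large enough for the off-diagonal factor (T/x)^N to meet it too. *)
Lemma powR_grid (x s : R) (m N : nat) : 1 <= x -> 0 <= s -> s < m%:R ->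
  s <= N%:R * (1 - s / m%:R) ->
  let T := x `^ (s / m%:R) in let q := x `^ (- (s / 2)) in
  [/\ 1 <= T, 0 < q, (T ^+ m)^-1 = q ^+ 2, (T / x) ^+ N <= q ^+ 2 & (x ^+ N)^-1 <= q].
Proof.
move=> x1 s0 sm sN T q; have x0 : 0 < x by lra_ineq.
have m0 : 0 < m%:R :> R by lra_ineq.
have q2 : q ^+ 2 = x `^ (- s).
  by rewrite /q -powR_mulrn ?powR_ge0// -powRrM; congr (_ `^ _); field.
have t0 : 0 <= s / m%:R by rewrite divr_ge0// ltW.
split.
- by rewrite /T -[leLHS](powRr0 x) ler_powR.
- by rewrite powR_gt0.
- rewrite q2 /T -powR_mulrn ?powR_ge0// -powRrM divfK ?gt_eqF//.
  by rewrite powRN.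
- rewrite q2 /T; have -> : x `^ (s / m%:R) / x = x `^ (s / m%:R - 1).
    by rewrite powRD ?powRN ?powRr1 ?(ltW x0)//; apply/implyP => _; rewrite gt_eqF.
  rewrite -powR_mulrn ?powR_ge0// -powRrM ler_powR//.
  by move: sN; move: (s / _) => t; lra_ineq.
- have -> : (x ^+ N)^-1 = x `^ (- N%:R) by rewrite powRN powR_mulrn// ltW.
  rewrite /q ler_powR//.
  have : s <= N%:R.
    by apply: le_trans sN _; rewrite -[leRHS]mulr1 ler_wpM2l//; lra_ineq.
  lra_ineq.
Qed.

(** Divide the differencing inequality by kap^2, where [kap] is the number of shifts, and take
    square roots. *)
Lemma weyl_balance (I kap V X Y q c : R) : 0 < kap -> 0 <= V -> 0 <= q -> 0 <= Y -> 0 <= c ->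
  (kap * I) ^+ 2 <= V * (kap * V + kap ^+ 2 * X) -> kap^-1 <= c * q ^+ 2 -> X <= Y * q ^+ 2 ->
  `|I| <= Num.sqrt (V * (V * c + Y)) * q.
Proof.
move=> k0 V0 q0 Y0 c0 H1 H2 H3.
have H : I ^+ 2 <= V * (V * c + Y) * q ^+ 2.
  have : I ^+ 2 <= V * (kap^-1 * V + X).
    rewrite -(ler_pM2l (exprn_gt0 2 k0)) -exprMn; apply: le_trans H1 _.
    rewrite le_eqVlt; apply/orP; left; apply/eqP; move: k0 => /gt_eqF k0.
    by field; rewrite k0.
  move=> H; apply: le_trans H _; rewrite -mulrA ler_wpM2l//.
  rewrite mulrDl; apply: lerD => //.
  by rewrite [V * c]mulrC -mulrA [V * _]mulrC mulrA ler_wpM2r.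
have W0 : 0 <= V * (V * c + Y) by rewrite mulr_ge0// addr_ge0// mulr_ge0.
rewrite -sqrtr_sqr; have -> : Num.sqrt (V * (V * c + Y)) * q = Num.sqrt (V * (V * c + Y) * q ^+ 2).
  by rewrite [RHS]sqrtrM// sqrtr_sqr ger0_norm.
by rewrite ler_wsqrtr.
Qed.

Lemma grid_power (K V n r x T q : R) (N : nat) : 0 <= K -> 0 <= V -> 0 < r -> 0 < x ->
  0 <= n -> n <= T -> (T / x) ^+ N <= q ^+ 2 ->
  K * V * (n / (r * x)) ^+ N <= K * V / r ^+ N * q ^+ 2.
Proof.
move=> K0 V0 r0 x0 n0 nT H.
have -> : (n / (r * x)) ^+ N = (r ^+ N)^-1 * (n / x) ^+ N.
  by rewrite -exprVn -exprMn; congr (_ ^+ _); rewrite invfM; ring.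
rewrite mulrA ler_wpM2l// ?mulr_ge0 ?invr_ge0 ?exprn_ge0 ?(ltW r0)//.
apply: le_trans H; apply: lerXn2r.
- by rewrite nnegrE divr_ge0// ltW.
- by rewrite nnegrE divr_ge0// ?(ltW x0)// (le_trans n0).
- by rewrite ler_pM2r ?invr_gt0.
Qed.

Lemma natr_dist_ge1 (i j : nat) : i != j -> 1 <= `|i%:R - j%:R| :> R.
Proof.
by case: (ltngtP i j) => // ij _; [rewrite distrC|]; rewrite -natrB ?(ltnW ij)// normr_nat ler1n subn_gt0.
Qed.

Lemma sum_offdiag_le (T : finType) (P : T -> T -> R) (V X : R) : 0 <= X ->
  (forall i, P i i <= V) -> (forall i j, i != j -> P i j <= X) ->
  \sum_i \sum_j P i j <= #|T|%:R * V + #|T|%:R ^+ 2 * X.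
Proof.
move=> X0 Pd Po; apply: (@le_trans _ _ (\sum_(i : T) (V + \sum_(j : T) X))).
  apply: ler_sum => i _; rewrite (bigD1 i)//=; apply: lerD; first exact: Pd.
  apply: (@le_trans _ _ (\sum_(j | j != i) X)).
    by apply: ler_sum => j ij; apply: Po; rewrite eq_sym.
  by rewrite [leRHS](bigD1 i)//= lerDr.
rewrite big_split /= !sumr_const -[V *+ _]mulr_natl -[(X *+ _) *+ _]mulr_natl -[X *+ _]mulr_natl.
by rewrite expr2 mulrA.
Qed.

End Powers.

Section ConeDecay.
Context {R : realType} (m d : nat).
Variables (O : set 'rV[R]_m) (F : 'rV[R]_m -> 'rV[R]_d) (y0 : 'rV[R]_m) (r C k : R) (N : nat).
Hypothesis sF : smooth_on O F.
Hypothesis r01 : 0 < r <= 2^-1.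
Hypothesis C0 : 0 <= C.
Hypothesis k0 : 0 < k.
Hypothesis FC : forall y : 'rV[R]_m, `|y - y0| < 4 * r -> O y /\
  forall l, (size l <= N.+3)%N -> `|iter_partial l F y| <= C.
Hypothesis Fk : forall xi : 'rV[R]_(d + 1), `|xi| = 1 ->
  [\/ forall y, `|y - y0| < 4 * r -> k <= `|height_at xi (F y)|,
      exists j, forall y, `|y - y0| < 4 * r -> k <= `|dotv (partial j F y) (lsubmx xi)| |
      forall w : 'rV[R]_m, 0 < `|w| <= r -> exists j, forall y, `|y - y0| < 2 * r ->
        k * `|w| <= `|dotv (partial j F (y + w) - partial j F y) (lsubmx xi)|].
Variable L : {sigma_finite_measure set (borelRV R (m + 1)) -> \bar R}.
Hypothesis Linv : forall w (A : set (borelRV R (m + 1))),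
  measurable A -> L (shiftV w @^-1` A) = L A.
Hypothesis Lbox : forall rho : R, 0 < rho -> (0 < L (sup_box (m + 1) rho) < +oo)%E.

Local Notation c0 := (center y0).
Local Notation a := (amp N r c0).
Local Notation V := (fine (L (sup_box (m + 1) (`|c0| + 2)))).
Local Notation G := (conemap F y0 r).

Let grid (n : nat) (i : {ffun 'I_m -> 'I_n}) : 'rV[R]_m := \row_j (r / n%:R * (i j)%:R).

Let grid_sub n (i i' : {ffun 'I_m -> 'I_n}) : (0 < n)%N -> i != i' ->
  r / n%:R <= `|grid i - grid i'| <= r.
Proof.
move=> n0 ii; have [r0 r1] := andP r01.
have rn0 : 0 < r / n%:R by rewrite divr_gt0// ltr0n.
have E j : (grid i - grid i') 0 j = r / n%:R * ((i j)%:R - (i' j)%:R).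
  by rewrite !mxE; ring.
apply/andP; split.
  have [j ij] : exists j, i j != i' j.
    apply: contrapT => H; move/negP: ii; apply; apply/eqP/ffunP => j.
    by apply/eqP; apply: contrapT => Hj; apply: H; exists j; exact/negP.
  apply: le_trans (coord_norm_le _ j); rewrite E normrM (ger0_norm (ltW rn0)).
  by rewrite -[leLHS]mulr1 ler_pM2l//; exact: natr_dist_ge1.
apply: normrV_le => [|j]; first exact: ltW.
rewrite E normrM (ger0_norm (ltW rn0)) -mulrA ger_pMr//.
rewrite mulrC ler_pdivrMr ?ltr0n// mul1r.
have i1 : (i j)%:R <= n%:R :> R by rewrite ler_nat ltnW.
have i2 : (i' j)%:R <= n%:R :> R by rewrite ler_nat ltnW.
have i3 : 0 <= (i j)%:R :> R by [].
have i4 : 0 <= (i' j)%:R :> R by [].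
by rewrite ler_norml; apply/andP; split; lra_ineq.
Qed.

Let grid_le n (i : {ffun 'I_m -> 'I_n}) : (0 < n)%N -> `|ylift (grid i)| <= 1.
Proof.
move=> n0; have [r0 r1] := andP r01.
apply: normrV_le => // j; case: (split_ordP j) => j' ->; last by rewrite row_mxEr mxE normr0.
rewrite row_mxEl mxE ger0_norm; last by rewrite mulr_ge0// divr_ge0// ltW.
rewrite -mulrA -[leRHS]mulr1; apply: ler_pM; [exact: ltW|by rewrite mulr_ge0// invr_ge0|lra_ineq|].
by rewrite mulrC ler_pdivrMr ?ltr0n// mul1r ler_nat ltnW.
Qed.

Lemma cone_oscillation (s : R) : 0 <= s -> s < m%:R -> s <= N%:R * (1 - s / m%:R) ->
  exists2 B : R, 0 <= B & forall (xi : 'rV[R]_(d + 1)) (al : R), 1 <= `|xi| ->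
    `|\int[L]_z (a z * cos (2 * pi * dotv (G z : 'rV[R]_(d + 1)) xi + al))| <=
    B * `|xi| `^ (- (s / 2)).
Proof.
move=> s0 sm sN; have [r0 r1] := andP r01.
have [K K0 HK] := cone_phase sF r01 C0 FC Linv Lbox k0.
have c2 : 0 < `|c0| + 2 by rewrite ltr_wpDl.
have /andP[V0e Voo] := Lbox c2.
have V0 : 0 < V by rewrite fine_gt0// V0e.
pose Y := K * V / r ^+ N.
have Y0 : 0 <= Y by rewrite /Y !(mulr_ge0, invr_ge0, exprn_ge0)// ltW.
pose B1 := Num.sqrt (V * (V * 2 ^+ m + Y)).
exists (B1 + K * V); first by rewrite addr_ge0// ?sqrtr_ge0// mulr_ge0// ltW.
move=> xi al xi1; set La := `|xi| in xi1 *.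
have La0 : 0 < La by lra_ineq.
have [T1 q0 Tm TN LN] := powR_grid xi1 s0 sm sN.
set T := La `^ (s / m%:R) in T1 Tm TN; set q := La `^ (- (s / 2)) in q0 Tm TN LN *.
(* Normalise the frequency: the direction [eta] ranges over a compact sphere, and its size becomes
   the large parameter. *)
pose la : R := 2 * pi * La; pose eta := La^-1 *: xi.
have la_La : La <= la.
  rewrite /la ler_peMl//; first exact: ltW.
  by have := @pi_ge2 R; move: (pi : R) => x; lra_ineq.
have la0 : 0 < la by exact: lt_le_trans la_La.
have eta1 : `|eta| = 1 by rewrite normrZ normfV normr_id mulVf// gt_eqF.
have phE z : 2 * pi * dotv (G z : 'rV[R]_(d + 1)) xi = la * dotv (G z : 'rV[R]_(d + 1)) eta.
  by rewrite /eta dotvZr /la; move: (dotv _ _) (pi : R) => x y; field; rewrite gt_eqF.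
have -> : \int[L]_z (a z * cos (2 * pi * dotv (G z : 'rV[R]_(d + 1)) xi + al)) =
    \int[L]_z (a z * cos (la * dotv (G z : 'rV[R]_(d + 1)) eta + al)).
  by apply: eq_Rintegral => z _; rewrite phE.
have eta1' : `|eta| <= 1 by rewrite eta1.
have [HA HB HC] := HK eta eta1'.
have easy : `|\int[L]_z (a z * cos (la * dotv (G z : 'rV[R]_(d + 1)) eta + al))| <= K / la ^+ N * V ->
  `|\int[L]_z (a z * cos (la * dotv (G z : 'rV[R]_(d + 1)) eta + al))| <= (B1 + K * V) * q.
  move=> H; apply: le_trans H _; rewrite mulrAC mulrDl.
  apply: (@le_trans _ _ (K * V * q)); last by rewrite lerDr mulr_ge0 ?sqrtr_ge0 ?ltW.
  rewrite ler_wpM2l ?mulr_ge0 ?(ltW V0)//; apply: le_trans LN.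
  by rewrite lef_pV2 ?posrE ?exprn_gt0// lerXn2r// ?nnegrE ltW.
have [A|[j HBj]|HCw] := Fk eta1; [by apply: easy; exact: HA|by apply: easy; exact: (HB j)|].
set I := \int[L]_z _.
apply: (@le_trans _ _ (B1 * q)); last first.
  by rewrite ler_pM2r// lerDl mulr_ge0// ltW.
(* Rounding costs a factor at most 2 per axis since T >= 1, hence the 2^m in [B1]. *)
pose n := Num.truncn T.
have n0 : (0 < n)%N by rewrite truncn_gt0.
have /andP[nT Tn] := truncn_itv (le_trans ler01 T1).
have n0R : 0 < n%:R :> R by rewrite ltr0n.
have Tn2 : T <= 2 * n%:R.
  have : n.+1%:R = n%:R + 1 :> R by rewrite -natr1.
  have : 1 <= n%:R :> R by rewrite ler1n.
  by move: Tn; rewrite -/n; lra_ineq.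
pose KT := {ffun 'I_m -> 'I_n}.
pose w (i : KT) := ylift (grid i).
pose th (z : 'rV[R]_(m + 1)) := la * dotv (G z : 'rV[R]_(d + 1)) eta.
have mth : measurable_fun (setT : set (borelRV R (m + 1))) th.
  have mG := conemap_dotv_measurable sF FC eta.
  exact: measurable_funM (measurable_cst _) mG.
have ma := @amp_measurable R N r (m + 1) c0.
have a1 := amp_norm N r01 c0.
have c1 : 0 < `|c0| + 1 by rewrite ltr_wpDl.
have asup : supported_in (`|c0| + 1) a.
  move=> z zc; apply: amp_eq0 => //.
  by have := ler_normD (z - c0) c0; rewrite subrK => H; lra_ineq.
have W := weyl_differencing Linv Lbox al c1 ma mth a1 asup (fun i : KT => grid_le i n0).
have VE : `|c0| + 1 + 1 = `|c0| + 2 by ring.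
rewrite VE in W.
pose X := K * V * (n%:R / (r * La)) ^+ N.
have kapE : (#|{: KT}|%:R : R) = n%:R ^+ m.
  by rewrite card_ffun !card_ord natrX.
have kap0 : 0 < (#|{: KT}|%:R : R) by rewrite kapE exprn_gt0.
apply: (@weyl_balance _ I (#|{: KT}|%:R) V X Y q (2 ^+ m)) => //; try exact: ltW.
- apply: le_trans W _; rewrite ler_pM2l//.
  pose P i i' := `|\int[L]_z (a ((z : 'rV[R]_(m + 1)) + (w i - w i')) * a z *
     cos (th ((z : 'rV[R]_(m + 1)) + (w i - w i')) - th z))|.
  have Pd i : P i i <= V.
    rewrite /P subrr; rewrite -[leRHS]mul1r.
    have -> : (fun z : 'rV[R]_(m + 1) => a (z + 0) * a z * cos (th (z + 0) - th z)) =
        (fun z => a z * a z).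
      by apply/funext => z; rewrite addr0 subrr cos0 mulr1.
    have aa z : `|a z * a z| <= 1 by rewrite normrM -[leRHS]mulr1 ler_pM.
    apply: normr_Rintegral_tame => //.
    apply: (@supported_tame _ _ L Lbox _ _ 1) => //; first exact: measurable_funM.
    by move=> z zc; rewrite asup ?mul0r//; lra_ineq.
  have Po i i' : i != i' -> P i i' <= X.
    move=> ii; have /andP[u1 u2] := grid_sub n0 ii.
    have rn0 : 0 < r / n%:R by rewrite divr_gt0.
    have u0 : 0 < `|grid i - grid i'| by exact: lt_le_trans u1.
    have ww : w i - w i' = ylift (grid i - grid i').
      by rewrite /w /ylift opp_row_mx add_row_mx subr0.
    have [j Hj] := HCw (grid i - grid i') ltac:(by rewrite u0).
    have := HC (grid i - grid i') j ltac:(by rewrite u0) Hj la la0.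
    rewrite /P ww => H; apply: le_trans H _; rewrite /X mulrAC ler_wpM2l ?mulr_ge0 ?(ltW V0)//.
    rewrite -exprVn; apply: lerXn2r; rewrite ?nnegrE ?invr_ge0 ?divr_ge0 ?mulr_ge0 ?pi_ge0 ?(ltW la0) ?(ltW r0) ?(ltW La0)//.
    have -> : n%:R / (r * La) = (La * (r / n%:R))^-1.
      by rewrite !invfM invrK; ring.
    have p1 : 0 < La * (r / n%:R) by exact: mulr_gt0.
    have p2 : 0 < la * `|grid i - grid i'| by exact: mulr_gt0.
    rewrite lef_pV2 ?posrE//; apply: ler_pM; [exact: ltW|exact: ltW|exact: la_La|exact: u1].
  have X0 : 0 <= X.
    by rewrite /X !(mulr_ge0, exprn_ge0, invr_ge0)// ltW.
  exact: (@sum_offdiag_le _ KT P V X X0 Pd Po).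
- rewrite kapE -Tm -[(T ^+ m)^-1]mulr1.
  have Tm0 : 0 < T ^+ m by rewrite exprn_gt0//; lra_ineq.
  rewrite mulr1 -(ler_pM2r Tm0) divfK ?gt_eqF// mulrC ler_pdivrMr ?exprn_gt0// -exprMn.
  by apply: lerXn2r => //; rewrite nnegrE ?mulr_ge0 ?(ltW n0R)//; lra_ineq.
- by apply: (@grid_power _ K V n%:R r La T q N K0 (ltW V0) r0 La0 (ltW n0R) nT TN).
Qed.

End ConeDecay.

(** * Measures with a density *)

Lemma Rintegral_mrestr dsp (T : measurableType dsp) (R : realType)
    (P : {measure set T -> \bar R}) (A : set T) (mA : measurable A) (f : T -> R) :
  (mrestr P mA).-integrable setT (EFin \o f) ->
  \int[mrestr P mA]_x f x = \int[P]_x (f x * \1_A x).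
Proof.
move=> If.
have NA : mrestr P mA (~` A) = 0%E.
  have E : mrestr P mA (~` A) = P (~` A `&` A) by [].
  by rewrite E setICl measure0.
have E1 := negligible_integral (measurableC mA) measurableT If NA.
rewrite setDE setCK setTI in E1.
have E2 : (\int[mrestr P mA]_(x in A) (EFin \o f) x = \int[P]_(x in A) (EFin \o f) x)%E.
  apply: eq_measure_integral => B mB BA.
  by rewrite -[in RHS](setIidl BA).
apply: (congr1 fine); apply: (etrans E1); apply: (etrans E2).
rewrite integral_mkcond; apply: eq_integral => z _.
by rewrite patchE indicE; case: ifPn => _ /=; rewrite ?mulr1 ?mulr0.
Qed.

Section DensityMeasure.
Context dsp (T : measurableType dsp) (R : realType).
Local Notation leb := (@lebesgue_measure R).
Variable L : {sigma_finite_measure set T -> \bar R}.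

(* The density [a] is realised by restricting [L \x leb] to the region under its graph. *)
Lemma density_measure (D : set T) (a : T -> R) : measurable D -> (L D < +oo)%E ->
  measurable_fun setT a -> (forall x, 0 <= a x <= 1) -> (forall x, ~ D x -> a x = 0) ->
  exists nu : {finite_measure set T -> \bar R}, forall (g : T -> R) (C : R),
    measurable_fun setT g -> (forall x, `|g x| <= C) ->
    \int[nu]_x g x = \int[L]_x (a x * g x).
Proof.
move=> mD Doo ma a01 a0.
pose A : set (T * measurableTypeR R) := [set z | 0 <= (z.2 : R) < a z.1].
have mA : measurable A.
  have m2 : measurable_fun (setT : set (T * measurableTypeR R)) (fun z => z.2 : R).
    exact: (@measurable_snd _ _ T (measurableTypeR R)).
  have m1 : measurable_fun (setT : set (T * measurableTypeR R)) (fun z => z.2 - a z.1 : R).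
    apply: measurable_funB => //.
    exact: measurableT_comp ma (@measurable_fst _ _ T (measurableTypeR R)).
  have -> : A = ((fun z => z.2 : R) @^-1` `[0, +oo[%classic) `&`
      ((fun z => z.2 - a z.1 : R) @^-1` `]-oo, 0[%classic).
    apply/seteqP; split => z; rewrite /A /= !in_itv /= andbT.
      by move=> /andP[h1 h2]; split => //; lra_ineq.
    by move=> [h1 h2]; apply/andP; split => //; lra_ineq.
  apply: measurableI.
    by have := m2 measurableT _ (measurable_itv `[0, +oo[); rewrite setTI.
  by have := m1 measurableT _ (measurable_itv `]-oo, 0[); rewrite setTI.
pose I01 : set (measurableTypeR R) := `[0, 1]%classic.
have mI : measurable I01 by exact: measurable_itv.
have Ioo : (leb I01 < +oo)%E.
  have -> := lebesgue_measure_itv `[0, 1 : R].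
  by rewrite /= lte_fin ltr01 -EFinB ltry.
have nA z : ~ (D `*` I01) z -> ~ A z.
  case: z => x u nDI /= /andP[u0 u1]; apply: nDI; split => /=.
    by apply: contrapT => /a0 E; move: u1; rewrite E; lra_ineq.
  have /andP[_ h] := a01 x; rewrite /I01 /= in_itv /=; apply/andP; split => //.
  exact: le_trans (ltW u1) h.
pose P : {measure set (T * measurableTypeR R) -> \bar R} := (L \x leb)%E.
have DIoo : (P (D `*` I01) < +oo)%E.
  have E := product_measure1E L leb mD mI.
  have : ((L D * leb I01)%E < +oo)%E by rewrite lte_mul_pinfty// ge0_fin_numE.
  by rewrite -E.
have Aoo : (P A < +oo)%E.
  apply: le_lt_trans DIoo; apply: le_measure; rewrite ?inE//; first exact: measurableX.
  by move=> z Az; apply: contrapT => /nA.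
pose nu0 := push_measure (mrestr P mA) (@measurable_fst _ _ T (measurableTypeR R)).
have nuoo : (nu0 setT < +oo)%E.
  have E : nu0 setT = P A by rewrite -[X in P X]setTI.
  by rewrite E.
exists (finite_pack nuoo) => g C mg gC.
have mg1 : measurable_fun (setT : set (T * measurableTypeR R)) (fun z => g z.1).
  exact: measurableT_comp mg (@measurable_fst _ _ T (measurableTypeR R)).
have rfin : (mrestr P mA setT < +oo)%E.
  by have E : mrestr P mA setT = P A; [rewrite -[X in P X]setTI|rewrite E].
have Ig1 : (mrestr P mA).-integrable setT (EFin \o (g \o fst)).
  apply: (@Rintegral_setT_box _ _ _ _ setT (g \o fst) C) => //.
    by move=> z; exact: gC.
  by move=> z nz; exfalso; exact: nz.
transitivity (\int[nu0]_x g x); first by [].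
have Epush := @Rintegral_push _ _ _ _ R (mrestr P mA) fst
  (@measurable_fst _ _ T (measurableTypeR R)) g mg Ig1.
rewrite [LHS]Epush.
have tf : tame_on P (D `*` I01) (fun z => g z.1 * \1_A z).
  apply: (@tame_on_prod _ _ _ _ _ L leb D I01 _ (C * 1)) => //.
  - by apply: measurable_funM => //; exact: measurable_indic.
  - move=> z; rewrite normrM ler_pM// indicE.
    by case: (_ \in _); rewrite ?normr1 ?normr0.
  - by move=> x u nDI; rewrite indicE memNset ?mulr0//; exact: nA.
transitivity (\int[P]_z (g z.1 * \1_A z)).
  have E3 := @Rintegral_mrestr _ _ _ P A mA (fun z => g z.1) Ig1.
  exact: E3.
rewrite (Rintegral_prod tf mD mI Doo Ioo); apply: eq_Rintegral => x _ /=.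
have /andP[ax0 ax1] := a01 x.
pose J : set (measurableTypeR R) := `[0, a x[%classic.
have mJ : measurable J by exact: measurable_itv.
have J1 : leb J = (a x)%:E.
  have -> := lebesgue_measure_itv `[0, a x[.
  rewrite /= lte_fin; case: ifPn => [_|]; first by rewrite -EFinB subr0.
  by rewrite -leNgt => h; congr (_%:E); lra_ineq.
have Joo : (leb J < +oo)%E by rewrite J1 ltry.
have IJ : \int[leb]_u (\1_J u : R) = a x.
  exact: etrans (Rintegral_indic_setT _ mJ) (congr1 fine J1).
transitivity (\int[leb]_u (g x * \1_J u)).
  by apply: eq_Rintegral => u _; congr (_ * _); rewrite !indicE; congr ((nat_of_bool _)%:R).
rewrite RintegralZl//; first by rewrite [X in _ * X]IJ mulrC.
by apply: (@tame_on_integrable _ _ _ _ J); apply: tame_on_indic => //; exact: Joo.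
Qed.

End DensityMeasure.

Section RowContinuity.
Context {R : realType}.

Lemma continuous_rV_coord (U : topologicalType) n (g : U -> 'rV[R]_n) (x : U) :
  (forall i, {for x, continuous (fun y => g y 0 i)}) -> {for x, continuous g}.
Proof.
move=> cg; apply/cvgrPdist_lt => e e0.
have H : \forall y \near x, forall i, `|g x 0 i - g y 0 i| < e.
  apply: filter_forall => i; have /cvgrPdist_lt := cg i; exact.
near=> y; apply: normrV_lt => // i; rewrite !mxE.
by move: i; near: y; exact: H.
Unshelve. all: by end_near. Qed.

End RowContinuity.

(** * The extremal measures *)

Section LowerBound.
Context {R : realType}.

Lemma fourier_abs_le n (mu : {measure set (borelRV R n) -> \bar R}) (xi : 'rV[R]_n) (B : R) :
  (forall al, `|\int[mu]_x wave xi al x| <= B) -> fourier_abs mu xi <= 2 * B.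
Proof.
move=> H; rewrite /fourier_abs.
have Hc : `|\int[mu]_x cos (2 * pi * dotv (x : 'rV[R]_n) xi)| <= B.
  have := H 0; congr (`| _ | <= _); apply: eq_Rintegral => x _; by rewrite /wave addr0.
have Hs : `|\int[mu]_x sin (2 * pi * dotv (x : 'rV[R]_n) xi)| <= B.
  have := H (- (pi / 2)); congr (`| _ | <= _); apply: eq_Rintegral => x _.
  by rewrite /wave cosD cosN sinN cos_pihalf sin_pihalf mulr0 add0r mulrN1 opprK.
have B0 : 0 <= B by exact: le_trans Hc.
have sq (x : R) : `|x| <= B -> x ^+ 2 <= B ^+ 2.
  by move=> h; rewrite -[x ^+ 2]real_normK ?num_real// lerXn2r// nnegrE.
rewrite -[leRHS]ger0_norm ?mulr_ge0// -sqrtr_sqr ler_wsqrtr// sqrrN.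
move: (sq _ Hc) (sq _ Hs) (sqr_ge0 B); rewrite exprMn.
by move: (_ ^+ 2) (_ ^+ 2) (B ^+ 2) => x y b; lra_ineq.
Qed.

(** The second fundamental form is linear in the normal, so non-degeneracy passes from unit normals
    to all nonzero ones. *)
Lemma unit_normal_second_ff m n (F : 'rV[R]_m -> 'rV[R]_n) y (nu : 'rV[R]_n) :
  (forall nu, unit_normal F y nu -> gauss_curv F y nu != 0) ->
  nu != 0 -> (forall i, dotv (partial i F y) nu = 0) -> \det (second_ff F y nu) != 0.
Proof.
move=> H nu0 orth.
have e0 : 0 < enorm nu.
  rewrite sqrtr_gt0 lt_def dotv_ge0 andbT; apply: contra nu0.
  by move=> /eqP/dotv_eq0 ->.
have un : unit_normal F y ((enorm nu)^-1 *: nu).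
  split; last by move=> i; rewrite dotvZl dotvC orth mulr0.
  rewrite /enorm dotvZl dotvZr mulrA -expr2 sqrtrM ?sqr_ge0// sqrtr_sqr.
  by rewrite ger0_norm ?invr_ge0 ?(ltW e0)// mulVf// gt_eqF.
have := H _ un; rewrite /gauss_curv.
have -> : second_ff F y ((enorm nu)^-1 *: nu) = (enorm nu)^-1 *: second_ff F y nu.
  by apply/matrixP => i j; rewrite !mxE dotvZr.
rewrite detZ; apply: contra => /eqP ->; by rewrite mulr0 mul0r.
Qed.

(** The half-space constrains the first coordinate only, so a boundary point can be pushed inward
    within its chart. *)
Lemma interior_chart_point m n (S : set 'rV[R]_n) : (0 < m)%N -> S !=set0 ->
  embedded_submanifold m S -> exists O U F (y : 'rV[R]_m),
    is_chart S O U F /\ (O `&` (@halfspace_int R m)) y.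
Proof.
move=> m0 [p Sp] /(_ p Sp)[Oc [U [F [ch Up]]]]; exists Oc, U, F.
have [oO [_ [_ [_ [im _]]]]] := ch.
have [y [Oy hy] _] : (F @` (Oc `&` (@halfspace R m))) p by rewrite im.
have [e e0 He] := open_rV_ball oO Oy.
pose i0 : 'I_m := Ordinal m0.
exists (y + (e / 2) *: ev R i0); split => //; split.
  apply: He; rewrite addrAC subrr add0r normrZ norm_ev mulr1 ger0_norm; lra_ineq.
move=> i i_0; have -> : i = i0 by exact: val_inj.
by rewrite !mxE !eqxx mulr1; have := hy i0 erefl; lra_ineq.
Qed.

Lemma halfspace_int_near m (y0 : 'rV[R]_m) : @halfspace_int R m y0 ->
  exists2 r : R, 0 < r & forall y : 'rV[R]_m, `|y - y0| < r -> @halfspace R m y.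
Proof.
case: m y0 => [|m] y0 hy; first by exists 1 => // y _ [].
exists (y0 0 ord0); first exact: hy.
move=> y yr i i0; have -> : i = ord0 by exact: val_inj.
have := le_lt_trans (coord_norm_le (y - y0) ord0) yr; rewrite !mxE ltr_norml => /andP[h _]; lra_ineq.
Qed.

Lemma eq_continuous_for (U V : topologicalType) (f g : U -> V) (x : U) :
  f =1 g -> {for x, continuous f} -> {for x, continuous g}.
Proof. by move=> /funext ->. Qed.

(** [chart_ext] may jump at the edge of its ball, so continuity is claimed inside only; that
    suffices for the image of the support to be compact. *)
Lemma conemap_continuous m d (O : set 'rV[R]_m) (F : 'rV[R]_m -> 'rV[R]_d) y0 (r : R) z :
  smooth_on O F -> (forall y : 'rV[R]_m, `|y - y0| < 4 * r -> O y) ->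
  `|lsubmx z - y0| < 4 * r ->
  {for z, continuous (conemap F y0 r : 'rV[R]_(m + 1) -> 'rV[R]_(d + 1))}.
Proof.
move=> sF HO zr.
have cl : {for z, continuous (fun u : 'rV[R]_(m + 1) => lsubmx u)}.
  apply: continuous_rV_coord => i.
  apply: (@eq_continuous_for _ _ (fun u : 'rV[R]_(m + 1) => u 0 (lshift 1 i))).
    by move=> u; rewrite mxE.
  exact: coord_continuous.
have ch : {for z, continuous (fun u : 'rV[R]_(m + 1) => hcoord u)} by exact: coord_continuous.
have cF : {for z, continuous (fun u : 'rV[R]_(m + 1) => F (lsubmx u))}.
  apply: (continuous_comp cl); exact: (sF [::] _ (HO _ zr)).1.
pose G (u : 'rV[R]_(m + 1)) : 'rV[R]_(d + 1) := hcoord u *: row_mx (F (lsubmx u)) (const_mx 1).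
have cG : {for z, continuous G}.
  apply: continuous_rV_coord => i; case: (split_ordP i) => j ->.
    apply: (@eq_continuous_for _ _ (fun u : 'rV[R]_(m + 1) => hcoord u * F (lsubmx u) 0 j)).
      by move=> u; rewrite /G mxE row_mxEl.
    exact: continuousM ch (continuous_comp cF (@coord_continuous _ _ _ _ _ _)).
  apply: (@eq_continuous_for _ _ (fun u : 'rV[R]_(m + 1) => hcoord u)) => // u.
  by rewrite /G mxE row_mxEr mxE mulr1.
have E : \forall u \near z, G u = (conemap F y0 r u : 'rV[R]_(d + 1)).
  have : \forall u \near z, `|lsubmx u - y0| < 4 * r.
    have cn : {for z, continuous (fun u : 'rV[R]_(m + 1) => `|lsubmx u - y0|)}.
      have c1 : {for z, continuous (fun u : 'rV[R]_(m + 1) => lsubmx u - y0)}.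
        by apply: continuousB => //; exact: cst_continuous.
      exact: (continuous_comp c1 (@norm_continuous _ _ _)).
    by move: cn => /cvgr_lt; apply.
  by apply: filterS => u ur; rewrite /conemap /G /chart_ext ur.
have EZ : G z = conemap F y0 r z by rewrite /conemap /G /chart_ext zr.
have H : (conemap F y0 r : 'rV[R]_(m + 1) -> 'rV[R]_(d + 1)) u @[u --> z] --> G z.
  exact: cvg_trans (near_eq_cvg E) cG.
by rewrite EZ in H.
Qed.

Lemma amp_ge N (r : R) p (c z : 'rV[R]_p) : 0 < r -> `|z - c| <= r / 2 ->
  ((r / 2) ^+ N.+1 * (r / 2) ^+ N.+1) ^+ p <= amp N r c z.
Proof.
move=> r0 zr; have h0 : 0 <= r / 2 by lra_ineq.
rewrite -[X in _ ^+ X](card_ord p) -prodr_const; apply: ler_prod => i _.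
rewrite mulr_ge0 ?exprn_ge0//=.
have := le_trans (coord_norm_le (z - c) i) zr; rewrite !mxE ler_norml => /andP[h1 h2].
by apply: ler_pM; rewrite ?exprn_ge0//; apply: lerXn2r; rewrite ?nnegrE ?ppart_ge0//;
  rewrite le_max; apply/orP; right; lra_ineq.
Qed.

Lemma cone_decay_attained d (S : set 'rV[R]_d) (s : R) : (2 <= d)%N -> S !=set0 ->
  embedded_submanifold d.-1 S -> nonvanishing_gauss_interior d.-1 S ->
  0 <= s -> s < d.-1%:R ->
  exists mu : {finite_measure set (borelRV R (d + 1)) -> \bar R},
    supported_on mu (cone S) /\ (0 < mu setT)%E /\
    exists M : R, forall xi : 'rV[R]_(d + 1), enorm xi `^ (s / 2) * fourier_abs mu xi <= M.
Proof.
move=> d2 S0 emb ndg s0 sm; set m := d.-1 in emb ndg sm *.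
have m0 : (0 < m)%N by rewrite /m; case: (d) d2 => [|[]].
have m0R : 0 < m%:R :> R by rewrite ltr0n.
have [Oc [U [F [y0 [ch [Oy0 hy0]]]]]] := interior_chart_point m0 S0 emb.
have [oO [_ [sF [_ [im _]]]]] := ch.
have [r1 r10 Hr1] := halfspace_int_near hy0.
have th1 : 0 < 1 - s / m%:R by rewrite subr_gt0 ltr_pdivrMr// mul1r.
(* Enough integrations by parts for N (1 - s/m) >= s; such an [N] exists because s < m. *)
pose N := (Num.truncn (s / (1 - s / m%:R))).+1.
have sN : s <= N%:R * (1 - s / m%:R).
  rewrite -ler_pdivrMr//; have /andP[_ /ltW] := truncn_itv (divr_ge0 s0 (ltW th1)); exact.
have nd (nu : 'rV[R]_d) := @unit_normal_second_ff m d F y0 nu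
  (fun nu => ndg Oc U F y0 nu ch (conj Oy0 hy0)).
have [r [C [k [r01 rr1 C0 k0 [FC Fk]]]]] := nondegenerate_near nd N oO sF Oy0 r10.
have [r0 rhalf] := andP r01.
have [L [Linv Lbox]] := @haar_measure R (m + 1).
have [B B0 HB] := cone_oscillation sF r01 C0 k0 FC Fk Linv Lbox s0 sm sN.
set c0 := center y0 in HB; set a := amp N r c0 in HB; set G := conemap F y0 r in HB.
pose rho := `|c0| + 1.
have rho0 : 0 < rho by rewrite ltr_wpDl.
have /andP[_ rhooo] := Lbox rho rho0.
have mbox := @sup_box_measurable R (m + 1) rho.
have ma : measurable_fun (setT : set (borelRV R (m + 1))) a by exact: amp_measurable.
have mG : measurable_fun setT G by exact: (conemap_measurable sF FC).
have a01 z : 0 <= a z <= 1 by rewrite amp_ge0 amp_le1.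
have a0 z : ~ sup_box (m + 1) rho z -> a z = 0.
  move=> /negP; rewrite -ltNge => zr; apply: amp_eq0 => //.
  by have := ler_normD (z - c0 : 'rV[R]_(m + 1)) c0; rewrite subrK; move: zr; rewrite /rho; lra_ineq.
have [nu Hnu] := density_measure mbox rhooo ma a01 a0.
have muoo : (push_measure nu mG setT < +oo)%E.
  by rewrite (push_measureE nu mG) preimage_setT -ge0_fin_numE// fin_num_measure.
pose mu : {finite_measure set (borelRV R (d + 1)) -> \bar R} := finite_pack muoo.
have Imu (g : 'rV[R]_(d + 1) -> R) (D : R) :
    measurable_fun (setT : set (borelRV R (d + 1))) g -> (forall x, `|g x| <= D) ->
    \int[mu]_x g x = \int[L]_z (a z * g (G z)).
  move=> mg gD; have mgG := measurableT_comp mg mG.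
  rewrite -(Hnu (fun z => g (G z)) D)//.
  apply: (@Rintegral_push _ _ _ _ R nu G mG g mg).
  by apply: (@bounded_integrable _ _ _ nu (g \o G) D) => // z; exact: gD.
exists mu.
(* [supported_on] asks for a Borel subset of the cone that carries [mu]: the image of this closed
   ball, Borel because it is compact. *)
have Kc : compact [set z : 'rV[R]_(m + 1) | `|z - c0| <= r].
  apply: bounded_closed_compact.
    exists (rho); split; first exact: num_real.
    move=> M rM z /= zr.
    have := ler_normD (z - c0) c0; rewrite subrK; move: rM; rewrite /rho; lra_ineq.
  have -> : [set z : 'rV[R]_(m + 1) | `|z - c0| <= r] =
      (fun z : 'rV[R]_(m + 1) => `|z - c0|) @^-1` `]-oo, r]%classic.
    by apply/seteqP; split => z /=; rewrite in_itv.
  apply: preimage_closed; last exact: interval_closed.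
  have cn : continuous (fun z : 'rV[R]_(m + 1) => `|z - c0|).
    move=> z; have c1 : {for z, continuous (fun u : 'rV[R]_(m + 1) => u - c0)}.
      by apply: continuousB; [exact: cvg_id|exact: cst_continuous].
    exact: (continuous_comp c1 (@norm_continuous _ _ _)).
  by move=> z _; exact: cn.
set K := [set z : 'rV[R]_(m + 1) | `|z - c0| <= r] in Kc.
have Kl z : K z -> `|lsubmx z - y0| < 4 * r.
  move=> Kz; apply: le_lt_trans (lsubmx_near y0 z) _; apply: le_lt_trans Kz _; lra_ineq.
have mK : measurable (K : set (borelRV R (m + 1))).
  by apply: closed_measurable_rV; apply: compact_closed => //; exact: norm_hausdorff.
have GKc : compact ((G : 'rV[R]_(m + 1) -> 'rV[R]_(d + 1)) @` K).
  apply: continuous_compact => //; apply: continuous_in_subspaceT => z /set_mem Kz.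
  apply: (conemap_continuous sF) => [y /FC[]//|]; exact: Kl.
have mGK : measurable ((G : 'rV[R]_(m + 1) -> 'rV[R]_(d + 1)) @` K : set (borelRV R (d + 1))).
  by apply: closed_measurable_rV; apply: compact_closed => //; exact: norm_hausdorff.
have nuI (D : set (borelRV R (m + 1))) : measurable D ->
    nu D = (\int[L]_z (a z * \1_D z))%:E.
  move=> mD; rewrite -(Hnu (fun z => \1_D z) 1).
  - by rewrite Rintegral_indic_setT// fineK// fin_num_measure.
  - exact: measurable_indic.
  - by move=> z; rewrite indicE; case: (_ \in _); rewrite ?normr1 ?normr0.
split.
  exists ((G : 'rV[R]_(m + 1) -> 'rV[R]_(d + 1)) @` K); split => //; split.
    move=> _ [z Kz <-]; exists (F (lsubmx z)), (hcoord z); split.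
      have zr := Kl z Kz.
      have [Oz _] := FC _ zr.
      have hz : @halfspace R m (lsubmx z) by apply: Hr1; exact: lt_le_trans rr1.
      have : (F @` (Oc `&` (@halfspace R m))) (F (lsubmx z)) by exists (lsubmx z).
      by rewrite im => -[].
    by rewrite /G /conemap /chart_ext (Kl z Kz).
  have E : mu (~` (G @` K)) = nu (G @^-1` (~` (G @` K))) by [].
  apply: (etrans E); apply/eqP; rewrite eq_le measure_ge0 andbT.
  have -> : 0%E = nu (~` K).
    rewrite nuI; last exact: measurableC.
    have -> : (fun z => a z * \1_(~` K) z) = (fun=> 0).
      apply/funext => z; rewrite indicE; have [|nK] := boolP (z \in ~` K).
        move=> /set_mem nK; have -> : a z = 0; last by rewrite mul0r.
        by apply: amp_eq0 => //; rewrite ltNge; apply/negP.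
      by rewrite mulr0.
    by rewrite Rintegral_cst// mul0r.
  apply: le_measure; rewrite ?inE.
  - by have := mG measurableT _ (measurableC mGK); rewrite setTI.
  - exact: measurableC.
  - by move=> z /= nz Kz; apply: nz; exists z.
(* The density exceeds a positive constant on a ball of half the radius, which has positive measure
   by translation from the origin. *)
have nuT : 0 < \int[L]_z (a z * \1_(setT : set (borelRV R (m + 1))) z).
  pose D : set (borelRV R (m + 1)) := shiftV (- c0) @^-1` sup_box (m + 1) (r / 2).
  have r20 : 0 < r / 2 by lra_ineq.
  have mD : measurable D.
    have := @shiftV_measurable R (m + 1) (- c0) measurableT _
      (@sup_box_measurable R (m + 1) (r / 2)).
    by rewrite setTI.
  have LD : L D = L (sup_box (m + 1) (r / 2)) by apply: Linv; exact: sup_box_measurable.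
  have /andP[LD0 LDoo] := Lbox _ r20.
  pose del : R := ((r / 2) ^+ N.+1 * (r / 2) ^+ N.+1) ^+ (m + 1).
  have del0 : 0 < del by rewrite exprn_gt0// mulr_gt0// exprn_gt0.
  have LDoo' : (L D < +oo)%E by rewrite LD.
  have tD : tame_on L D (fun z => \1_D z) by apply: tame_on_indic => //; exact: LDoo'.
  have ID : \int[L]_z (\1_D z : R) = fine (L (sup_box (m + 1) (r / 2))).
    exact: etrans (Rintegral_indic_setT L mD) (congr1 fine LD).
  apply: (@lt_le_trans _ _ (\int[L]_z (del * \1_D z))).
    rewrite RintegralZl//; last exact: tame_on_integrable tD.
    by rewrite [X in _ * X]ID mulr_gt0// fine_gt0// LD0.
  apply: le_Rintegral => //.
  - exact: tame_on_integrable (tame_onZ del tD).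
  - apply: (@tame_on_integrable _ _ _ _ (sup_box (m + 1) rho)).
    apply: (@tame_onM _ _ _ _ _ _ _ 1).
    + by split => //; exists 1 => z; exact: amp_norm.
    + exact: measurable_indic.
    + by move=> z; rewrite indicE; case: (_ \in _); rewrite ?normr1 ?normr0.
  move=> z _; rewrite indicT mulr1 indicE; have [zD|zD] := boolP (z \in D).
    by rewrite mulr1; apply: amp_ge => //; exact: set_mem zD.
  by rewrite mulr0 amp_ge0.
split.
  have E : mu setT = nu setT by rewrite -[X in nu X](preimage_setT G).
  by rewrite E nuI// lte_fin.
have wint xi al : \int[mu]_x wave xi al x =
    \int[L]_z (a z * cos (2 * pi * dotv (G z : 'rV[R]_(d + 1)) xi + al)).
  by rewrite (Imu (wave xi al) 1)//; [exact: wave_measurable|move=> x; exact: wave_le1].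
pose Q := (d + 1)%:R `^ (s / 2) : R.
have Q0 : 0 <= Q by exact: powR_ge0.
pose mass := fine (mu setT).
have mass0 : 0 <= mass by exact: fine_ge0.
have s20 : 0 <= s / 2 by lra_ineq.
(* The oscillatory bound handles |xi| >= 1 and the total mass handles |xi| < 1; [Q] compares the
   Euclidean norm with the sup norm. *)
exists (Q * (2 * B) + Q * (2 * mass)) => xi.
have f0 : 0 <= fourier_abs mu xi by exact: sqrtr_ge0.
have en : enorm xi <= (d + 1)%:R * `|xi| by exact: enorm_le_norm.
have en0 : 0 <= enorm xi by exact: sqrtr_ge0.
have enQ : enorm xi `^ (s / 2) <= Q * `|xi| `^ (s / 2).
  by rewrite /Q -powRM// ge0_ler_powR// nnegrE// mulr_ge0.
have [xi1|xi1] := lerP 1 `|xi|.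
  have H : fourier_abs mu xi <= 2 * (B * `|xi| `^ (- (s / 2))).
    by apply: fourier_abs_le => al; rewrite wint; exact: HB.
  apply: (@le_trans _ _ (Q * (2 * B))); last by rewrite lerDl !mulr_ge0.
  apply: (@le_trans _ _ (Q * `|xi| `^ (s / 2) * (2 * (B * `|xi| `^ (- (s / 2)))))).
    by apply: ler_pM => //; exact: powR_ge0.
  have P0 : 0 < `|xi| `^ (s / 2) by rewrite powR_gt0//; lra_ineq.
  rewrite powRN le_eqVlt; apply/orP; left; apply/eqP; move: P0.
  by move: (`|xi| `^ _) => x /gt_eqF x0; field; rewrite x0.
have H : fourier_abs mu xi <= 2 * mass.
  apply: fourier_abs_le => al; rewrite -[leRHS]mul1r; apply: normr_Rintegral_le.
    exact: wave_measurable.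
  by move=> x; exact: wave_le1.
apply: (@le_trans _ _ (Q * (2 * mass))); last by rewrite lerDr !mulr_ge0.
apply: ler_pM => //; first exact: powR_ge0.
apply: le_trans enQ _; rewrite ler_piMr//.
have := @ge0_ler_powR R (s / 2) s20 `|xi| 1; rewrite powR1 !nnegrE; apply => //; exact: ltW.
Qed.

End LowerBound.

(** For empty [S] no nonzero measure lives on the cone and [sup] takes its default value 0, which
    differs from d - 1; hence [S !=set0]. *)
Theorem mainTheorem1 (R : realType) (d : nat) (S : set 'rV[R]_d) :
  (2 <= d)%N ->
  S !=set0 ->
  embedded_submanifold d.-1 S ->
  nonvanishing_gauss_interior d.-1 S ->
  fourier_dim (cone S) = (d.-1)%:R.
Proof.
move=> d2 S0 emb ndg; rewrite /fourier_dim; set E := [set s | _].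
have d1 : (0 < d.-1)%N by case: (d) d2 => [|[]].
have in_E (s : R) : 0 <= s -> s < d.-1%:R -> E s.
  move=> s0 sm; split; last exact: cone_decay_attained.
  rewrite s0 (le_trans (ltW sm))// ler_nat; lia.
have E0 : E 0 by apply: in_E; rewrite ?ltr0n.
have ubE : ubound E d.-1%:R.
  move=> s [_ [mu [supp [mu0 [M HM]]]]].
  exact: (cone_decay_le d2 emb supp mu0 HM).
apply/eqP; rewrite eq_le; apply/andP; split; first by apply: ge_sup => //; exists 0.
(* If the supremum were smaller than d - 1, the midpoint between the two would still be an
   admissible exponent. *)
rewrite leNgt; apply/negP => lt_sup.
have hsE : has_sup E by split; [exists 0|exists d.-1%:R].
have sup0 : 0 <= sup E by apply: ub_le_sup => //; case: hsE.
have [mid1 mid2] := midf_lt lt_sup.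
have : (sup E + d.-1%:R) / 2 <= sup E.
  apply: ub_le_sup; first by case: hsE.
  by apply: in_E => //; apply: le_trans sup0 (ltW mid1).
by rewrite leNgt mid1.
Qed.
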